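(* For every $n\ge 1$, the formal series $$D_n(z;q,t)=\sum_{\lambda\subseteq\delta_n}\ \sum_{T\in \mathrm{SSYT}((\lambda+(1^n))/\lambda)} t^{|\delta_n/\lambda|}\,q^{\mathrm{dinv}(T)}\,z^T$$ is a symmetric function in $z=z_1,z_2,\ldots$, and it is Schur positive, i.e. $\langle D_n(z;q,t),s_\mu(z)\rangle\in\mathbb{N}[q,t]$ for all partitions $\mu$. In fact, for each partition $\lambda\subseteq\delta_n$ the individual term $$D_n^{\lambda}(z;q)=\sum_{T\in \mathrm{SSYT}((\lambda+(1^n))/\lambda)} q^{\mathrm{dinv}(T)}\,z^T$$ is a symmetric function in $z$ and is Schur positive (its coefficients on the Schur basis lie in $\mathbb{N}[q]$).
   Context: $\mathbb{N}=\{0,1,2,\ldots\}$. A partition $\lambda=(\lambda_1\ge\lambda_2\ge\cdots)$ is identified with its diagram $\{(i,j)\in\mathbb{N}\times\mathbb{N}:0\le j<\lambda_{i+1}\}$ ($i$ indexes rows, $j$ indexes columns). $\delta_n=(n-1,n-2,\ldots,1,0)$. For $\lambda\subseteq\delta_n$, $|\delta_n/\lambda|=\binom n2-|\lambda|$, and $(\lambda+(1^n))/\lambda$ is the skew shape consisting of the $n$ cells $(i,\lambda_{i+1})$, $0\le i\le n-1$. For a (skew) shape $\nu$, $\mathrm{SSYT}(\nu)$ is the set of semistandard tableaux $T:\nu\to\{1<2<\cdots\}$, weakly increasing (in $j$) along each row and strictly increasing (in $i$) along each column; $z^T=\prod_{x\in\nu}z_{T(x)}$. For a cell $x=(i,j)$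 put $d(x)=i+j$. For $T\in\mathrm{SSYT}((\lambda+(1^n))/\lambda)$, a pair of entries $T(x)=a$, $T(y)=b$ with $a<b$, $x=(i,j)$, $y=(i',j')$, forms a d-inversion if either (i) $d(y)=d(x)$ and $j>j'$, or (ii) $d(y)=d(x)+1$ and $j<j'$. $\mathrm{dinv}(T)$ is the number of d-inversions in $T$. $\langle-,-\rangle$ is the Hall inner product, $\langle s_\lambda,s_\mu\rangle=\delta_{\lambda\mu}$, extended linearly over the coefficient ring. *)

(* Defs.v *)
From HB Require Import structures.
From mathcomp Require Import all_boot all_order all_algebra.
From mathcomp Require Import finmap.
From mathcomp Require Import all_classical.

Set Implicit Arguments.
Unset Strict Implicit.
Unset Printing Implicit Defensive.

Import Order.TTheory GRing.Theory Num.Theory.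

Local Open Scope classical_set_scope.
Local Open Scope fset_scope.
Local Open Scope ring_scope.

(* A cell is (row, column), both counted from 0. *)
Definition cell := (nat * nat)%type.

Definition diag_index (x : cell) : nat := (x.1 + x.2)%N.

(* Trailing zeros are dropped, so that equality of partitions is Leibniz
   equality of lists; the part lambda_(i+1) is nth 0 lambda i. *)
Definition is_part (s : seq nat) : bool := sorted geq s && (0%N \notin s).
Definition intpart := {s : seq nat | is_part s}.

Definition parts (la : intpart) : seq nat := val la.

Definition diagram (s : seq nat) : {fset cell} :=
  [fset ((i, j) : cell) | i in iota 0 (size s), j in iota 0 (nth 0%N s i)].

Definition delta (n : nat) : seq nat := [seq (n - i.+1)%N | i <- iota 0 n].

Definition in_delta (n : nat) (la : intpart) : bool :=
  diagram (parts la) `<=` diagram (delta n).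

(* |delta_n / lambda| *)
Definition codeg (n : nat) (la : intpart) : nat :=
  #|` diagram (delta n) `\` diagram (parts la)|.

(* The skew shape (lambda + (1^n)) / lambda. *)
Definition strip (n : nat) (la : intpart) : {fset cell} :=
  [fset ((i, nth 0%N (parts la) i) : cell) | i in iota 0 n].

(* Fillings of a finite set of cells.  The letters 1 < 2 < ... are encoded as
   0 < 1 < ..., and correspondingly z_(k+1) is the variable of index k. *)
Notation filling nu := {ffun nu -> nat}.

Section Tableaux.
Variable nu : {fset cell}.
Implicit Types T : filling nu.

Definition is_ssyt T : bool :=
  [forall x : nu, forall y : nu,
     (((val x).1 == (val y).1) && ((val x).2 < (val y).2)%N ==> (T x <= T y)%N)
  && (((val x).2 == (val y).2) && ((val x).1 < (val y).1)%N ==> (T x < T y)%N)].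

Definition d_inversion T (x y : nu) : bool :=
  (T x < T y)%N &&
  ((diag_index (val y) == diag_index (val x)) && ((val y).2 < (val x).2)%N
   || (diag_index (val y) == (diag_index (val x)).+1)
      && ((val x).2 < (val y).2)%N).

Definition dinv T : nat := #|[set p : nu * nu | d_inversion T p.1 p.2]%SET|.

End Tableaux.

(* Monomials in z, as exponent functions. *)
Notation monomial := {fsfun nat -> nat with 0%N}.

(* The exponent of z^T. *)
Definition content (nu : {fset cell}) (T : filling nu) : monomial :=
  [fsfun k in [fset T x | x : nu] => #|[set x | T x == k]%SET|].

(* Formal series in infinitely many variables, as families of coefficients. *)
Definition series (R : Type) := monomial -> R.

(* The sum over T in SSYT(nu) of w(T) z^T; finitely many T have a given
   content. *)
Definition ssyt_gf (R : comNzRingType) (nu : {fset cell})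
    (w : filling nu -> R) : series R :=
  fun a => \sum_(T \in [set T : filling nu | is_ssyt T /\ content T = a]) w T.

Section SymmetricFunctions.
Variable R : comNzRingType.
Implicit Types (f g : series R).

Definition bounded_degree f : Prop :=
  exists d : nat, forall a : monomial,
    f a != 0 -> (\sum_(k <- finsupp a) a k <= d)%N.

Definition symmetric_function f : Prop :=
  bounded_degree f /\
  forall s : nat -> nat, bijective s ->
    forall a b : monomial, (forall k, b k = a (s k)) -> f b = f a.

Definition schur (mu : intpart) : series R :=
  ssyt_gf (fun _ : filling (diagram (parts mu)) => 1).

Definition schur_expansion f (c : {fsfun intpart -> R with 0}) : Prop :=
  forall a : monomial, f a = \sum_(mu <- finsupp c) c mu * schur mu a.

(* The coefficients of f on the Schur basis.  They are unique by
   schur_expansion_uniq below; the default value is only used when f is not a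
   symmetric function. *)
Definition schur_coord f : {fsfun intpart -> R with 0} :=
  xget [fsfun] [set c | schur_expansion f c].

(* The bilinear form on symmetric functions for which the Schur functions are
   orthonormal; see hall_schur below. *)
Definition hall f g : R :=
  \sum_(mu <- finsupp (schur_coord f)) schur_coord f mu * schur_coord g mu.

End SymmetricFunctions.

Lemma contentE (nu : {fset cell}) (T : filling nu) k :
  content T k = #|[set x | T x == k]%SET|.
Proof.
rewrite /content fsfunE; case: ifPn => // kT; apply/esym/eqP; rewrite cards_eq0.
apply/eqP/setP => x; rewrite !inE; apply/negP => /eqP Txk.
by move/negP: kT; apply; apply/imfsetP; exists x.
Qed.

Lemma mem_diagram s (x : cell) : (x \in diagram s) = (x.2 < nth 0%N s x.1)%N.
Proof.
apply/imfset2P/idP => [[i /= _] [j]|].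
  by rewrite mem_iota /= => jlt ->.
case: x => i j /= jlt; exists i; last by exists j; rewrite //= mem_iota.
by rewrite /= mem_iota /=; case: (ltnP i (size s)) => // le; rewrite nth_default in jlt.
Qed.

Lemma card_lt_content (nu : {fset cell}) (T : filling nu) r :
  #|[set x | (T x < r)%N]%SET| = (\sum_(k < r) content T k)%N.
Proof.
elim: r => [|r IH].
  by rewrite big_ord0; apply/eqP; rewrite cards_eq0; apply/eqP/setP => x; rewrite !inE.
rewrite big_ord_recr /= -IH contentE -cardsUI -[LHS]addn0; congr addn.
  by apply: eq_card => x; rewrite !inE ltnS leq_eqVlt orbC.
apply/esym/eqP; rewrite cards_eq0; apply/eqP/setP => x; rewrite !inE.
by case: (ltngtP (T x) r).
Qed.

Lemma nth_part_le (mu : intpart) i j : (i <= j)%N ->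
  (nth 0 (parts mu) j <= nth 0 (parts mu) i)%N.
Proof.
move=> ij; case: (ltnP j (size (parts mu))) => [jlt|/(nth_default 0%N)->//].
have /andP[so _] := valP mu.
have tr : transitive geq by move=> a b c /= ab bc; apply: leq_trans bc ab.
by apply: (sorted_leq_nth tr (fun x => leqnn x) 0%N so) => //; rewrite unfold_in /= ?(leq_ltn_trans ij).
Qed.

Section Superstandard.
Variable mu : intpart.
Let nu := diagram (parts mu).

Lemma ssyt_row (T : filling nu) : is_ssyt T -> forall x : nu, ((val x).1 <= T x)%N.
Proof.
move=> /forallP sT x; move: {2}(val x).1 (erefl (val x).1) => i.
elim: i x => [|i IH] x; first by move->.
move=> xi; rewrite xi.
have yP : (i, (val x).2) \in nu.
  rewrite mem_diagram /=; have := valP x; rewrite mem_diagram xi => h.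
  by apply: leq_trans h (nth_part_le _ _).
have {IH}:= IH [` yP] erefl => /= h; apply: leq_ltn_trans h _.
have /forallP/(_ x)/andP[_ /implyP] := sT [` yP]; apply => /=.
by rewrite eqxx xi ltnSn.
Qed.

Definition super : filling nu := [ffun x : nu => (val x).1].

Lemma super_ssyt : is_ssyt super.
Proof.
apply/forallP => x; apply/forallP => y; rewrite /super !ffunE.
apply/andP; split; apply/implyP => /andP[/eqP h] //.
by rewrite h.
Qed.

Lemma super_uniq (T : filling nu) : is_ssyt T -> content T = content super -> T = super.
Proof.
move=> sT cT; apply/ffunP => x.
have sub r : [set x | (T x < r)%N]%SET = [set x | (super x < r)%N]%SET.
  apply/eqP; rewrite eqEcard; apply/andP; split.
    apply/fintype.subsetP => y; rewrite !inE ffunE; apply: leq_ltn_trans; exact: ssyt_row.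
  by rewrite !card_lt_content cT.
have e r : (T x < r)%N = (super x < r)%N by have /setP/(_ x) := sub r; rewrite !inE.
apply/eqP; rewrite eqn_leq.
by have := e (T x); have := e (super x); rewrite !ltnn => /negbT + /esym/negbT; rewrite -!leqNgt => -> ->.
Qed.
End Superstandard.

(* The number of cells in the first r rows. *)
Definition prefix_card (mu : intpart) r := #|[set x | (super mu x < r)%N]%SET|.

Lemma pre_part (mu la : intpart) : (forall r, prefix_card mu r = prefix_card la r) -> mu = la.
Proof.
move=> E.
have P (m : intpart) i : (nth 0 (parts m) i = prefix_card m i.+1 - prefix_card m i)%N.
  rewrite /prefix_card !card_lt_content big_ord_recr /= addnC addnK contentE.
  pose f (j : 'I_(nth 0 (parts m) i)) : diagram (parts m) :=
    FSetSub (etrans (mem_diagram (parts m) (i, nat_of_ord j)) (ltn_ord j)).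
  have fi : injective f by move=> j k /(congr1 val) [] /val_inj.
  rewrite -[LHS]card_ord -(card_imset predT fi); apply: eq_card => x; rewrite [RHS]inE ffunE.
  apply/imsetP/eqP => [[j _ ->]//|xi].
  have := valP x; rewrite mem_diagram xi => jlt; exists (Ordinal jlt) => //.
  by apply: val_inj; rewrite /f /= -xi -surjective_pairing.
have e i : nth 0%N (parts mu) i = nth 0%N (parts la) i by rewrite !P !E.
have z (m : intpart) i : (i < size (parts m))%N = (0 < nth 0 (parts m) i)%N.
  case: ltnP => [lt|/(nth_default 0%N)->//]; rewrite lt0n; apply/esym.
  by have /andP[_] := valP m; apply: contra => /eqP <-; rewrite mem_nth.
apply: val_inj; apply: (@eq_from_nth _ 0%N) => //.
case: (ltngtP (size (parts mu)) (size (parts la))) => // h.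
  by move: (h); rewrite z -e -z ltnn.
by move: (h); rewrite z e -z ltnn.
Qed.

Section SchurBasis.
Variable R : comNzRingType.

Lemma schur_super la : schur R la (content (super la)) = 1.
Proof.
rewrite /schur /ssyt_gf.
rewrite (_ : [set _ | _] = [set super la]) ?fsbig_set1 //.
apply/seteqP; split => T /=.
  by case=> h1 h2; exact: super_uniq.
by move->; split => //; exact: super_ssyt.
Qed.

Lemma schur_pre mu la : schur R mu (content (super la)) != 0 ->
  forall r, (prefix_card la r <= prefix_card mu r)%N.
Proof.
move=> + r; apply: contraR => h.
rewrite /schur /ssyt_gf (_ : [set _ | _] = set0) ?fsbig_set0 //.
apply/seteqP; split => T //= [sT cT]; apply: (negP h).
rewrite /prefix_card card_lt_content -cT -card_lt_content subset_leq_card //.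
apply/fintype.subsetP => y; rewrite !inE ffunE; apply: leq_ltn_trans; exact: ssyt_row.
Qed.

Lemma pre_big mu r : (size (parts mu) <= r)%N -> prefix_card mu r = #|` diagram (parts mu)|.
Proof.
move=> le; rewrite /prefix_card cardfE; apply: eq_card => x; rewrite !inE ffunE.
suff h : ((val x).1 < size (parts mu))%N by rewrite (leq_trans h le).
by have := valP x; rewrite mem_diagram; case: (ltnP (val x).1 (size (parts mu))) => // h; rewrite nth_default.
Qed.

(* The Schur functions are linearly independent: the one indexed by la is
   detected on the monomial z^la when la is maximal in the dominance order. *)
Lemma schur_expansion_uniq (f : series R) c d :
  schur_expansion f c -> schur_expansion f d -> c = d.
Proof.
move=> hc hd; apply/eqP; apply/negPn/negP => /eqP ncd.
have [la0 n0] : exists la, c la != d la.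
  by apply: contrapT => h; apply: ncd; apply/fsfunP => la; apply/eqP/negPn/negP => n; apply: h; exists la.
pose X := [fset la in finsupp c `|` finsupp d | c la != d la].
have inX la : (la \in X) = (c la != d la).
  rewrite !inE /=; case: (eqVneq (c la) (d la)) => [|n]; rewrite ?andbF ?andbT //.
  rewrite !mem_finsupp; apply: contraNT n; rewrite negb_or !negbK => /andP[/eqP-> /eqP->] //.
pose N := (\sum_(la <- X) size (parts la)).+1.
pose M la := (\sum_(r < N) prefix_card la r)%N.
have sz la : la \in X -> (size (parts la) < N)%N.
  by move=> h; rewrite /N ltnS (big_fsetD1 la) //= leq_addr.
have h0 : la0 \in X by rewrite inX.
pose L := [arg max_(i > [` h0]) M (val i)].
have [LX Lmax] : val L \in X /\ forall mu, mu \in X -> (M mu <= M (val L))%N.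
  rewrite /L; case: arg_maxnP => // i _ hi; split; first exact: valP.
  by move=> mu hmu; exact: (hi [` hmu]).
set la := val L in LX Lmax.
have sup (e : {fsfun intpart -> R with 0}) (F : intpart -> R) : {subset finsupp e <= finsupp c `|` finsupp d} ->
   \sum_(mu <- finsupp e) e mu * F mu = \sum_(mu <- finsupp c `|` finsupp d) e mu * F mu.
  move=> s; apply: big_fset_incl; first by apply/fsubsetP.
  by move=> mu _; rewrite memNfinsupp => /eqP ->; rewrite mul0r.
have := hc (content (super la)); rewrite (hd (content (super la))).
rewrite !sup; [|by move=> m h; rewrite inE h ?orbT..].
move=> /eqP; rewrite -subr_eq0 -sumrB => /eqP.
under eq_bigr do rewrite -mulrBl.
have laS : la \in finsupp c `|` finsupp d by move: LX; rewrite !inE /= => /andP[].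
rewrite (big_fsetD1 la) //= schur_super mulr1 big1_fset ?addr0.
  by move: LX; rewrite inX => n /eqP; rewrite subr_eq0 eq_sym (negbTE n).
have LX' := LX; rewrite inX in LX'.
move=> mu; rewrite !inE => /andP[nmu _] _.
case: (eqVneq (c mu) (d mu)) => [->|n]; first by rewrite subrr mul0r.
have muX : mu \in X by rewrite inX.
apply/eqP; apply: contraNT nmu => n1.
have n2 : schur R mu (content (super la)) != 0 by apply: contraNneq n1 => ->; rewrite mulr0.
have le := schur_pre n2.
apply/eqP/esym/pre_part.
have e r : (r < N)%N -> prefix_card la r = prefix_card mu r.
  move=> rN; apply/eqP; rewrite eqn_leq le /= leqNgt; apply/negP => lt.
  have := Lmax _ muX; rewrite leqNgt => /negP; apply.
  rewrite /M (bigD1 (Ordinal rN)) //= [X in (_ < X)%N](bigD1 (Ordinal rN)) //=.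
  by rewrite -addSn leq_add // leq_sum.
move=> r; case: (ltnP r N) => [/e//|rN].
rewrite !pre_big; try by apply: leq_trans rN; apply: ltnW; apply: sz.
rewrite -(@pre_big la N.-1) -?(@pre_big mu N.-1) ?e //; by rewrite -ltnS sz.
Qed.

Lemma schur_coordE (f : series R) c : schur_expansion f c -> schur_coord f = c.
Proof.
move=> h; rewrite /schur_coord; case: xgetP => [d _ hd|/(_ c)//].
exact: schur_expansion_uniq hd h.
Qed.

Lemma schur_coord_schur mu nu : schur_coord (schur R mu) nu = (mu == nu)%:R.
Proof.
rewrite (@schur_coordE _ [fsfun x in [fset mu] => 1]).
  by rewrite fsfunE inE eq_sym; case: eqP.
move=> a.
rewrite (@big_fset_incl _ _ _ _ _ [fset mu]) ?big_seq_fset1 ?fsfunE ?inE ?eqxx ?mul1r //.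
  exact: finsupp_sub.
by move=> nu'; rewrite memNfinsupp => _ /eqP->; rewrite mul0r.
Qed.

Lemma hall_schur mu nu : hall (schur R mu) (schur R nu) = (mu == nu)%:R.
Proof.
rewrite /hall (@big_fset_incl _ _ _ _ _ [fset mu]) ?big_seq_fset1.
- by rewrite !schur_coord_schur eqxx mul1r eq_sym.
- apply/fsubsetP => x; rewrite mem_finsupp schur_coord_schur inE.
  by rewrite [x == mu]eq_sym; case: (mu == x) => //=; rewrite eqxx.
by move=> x _; rewrite memNfinsupp => /eqP->; rewrite mul0r.
Qed.

Lemma hall_schur_coord (f : series R) c mu : schur_expansion f c -> hall f (schur R mu) = c mu.
Proof.
move=> h; rewrite /hall (schur_coordE h).
case: (boolP (mu \in finsupp c)) => muc.
  rewrite (big_fsetD1 mu) //= schur_coord_schur eqxx mulr1 big1_fset ?addr0 //.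
  by move=> x; rewrite !inE => /andP[n _] _; rewrite schur_coord_schur eq_sym (negbTE n) mulr0.
rewrite big1_fset; first by move: muc; rewrite memNfinsupp => /eqP->.
move=> x xc _; rewrite schur_coord_schur; case: eqP => [e|]; last by rewrite mulr0.
by rewrite e xc in muc.
Qed.
End SchurBasis.

(* Z[q] is {poly int}, and Z[q, t] is {poly {poly int}} with t the outer
   variable. *)
Definition qt_q : {poly {poly int}} := 'X%:P.
Definition qt_t : {poly {poly int}} := 'X.

Definition Nq : {pred {poly int}} := polyOver Num.nat.
Definition Nqt : {pred {poly {poly int}}} := polyOver Nq.

Definition Dlam (n : nat) (la : intpart) : series {poly int} :=
  ssyt_gf (fun T : filling (strip n la) => 'X ^+ dinv T).

Definition D (n : nat) : series {poly {poly int}} :=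
  fun a => \sum_(la \in [set la : intpart | in_delta n la])
             ssyt_gf (fun T : filling (strip n la) =>
                        qt_t ^+ codeg n la * qt_q ^+ dinv T) a.

(* Main.v *)
Require Import Defs.
From HB Require Import structures.
From mathcomp Require Import finmap all_classical.
From mathcomp Require Import all_boot all_order all_algebra.
From mathcomp Require Import all_fingroup all_field all_character.
From mathcomp Require Import ring zify.
From mathcomp Require mpoly.
Import -(notations) mpoly.

Set Implicit Arguments.
Unset Strict Implicit.
Unset Printing Implicit Defensive.

Import Order.TTheory GRing.Theory Num.Theory GroupScope.

Local Open Scope ring_scope.

(** The strip of a partition has one cell in each row, so that a filling of it is
    a word indexed by n cells, and it is semistandard exactly when it increases
    strictly down each column.  List the cells in reading order: diagonal by
    diagonal, and from right to left inside a diagonal.  The pairs that may form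
    a d-inversion make up a relation, here called attacks, with the property
    (closed_rel) that a cell read between two attacking cells attacks, or is
    attacked by, both of them; and dinv counts the ascents of the word along
    this relation.  The series of the strip therefore counts words strict on the
    columns by their ascents along attacks, and the proof finds the
    representation of the symmetric group behind that count.

    The representation comes from the equivariant cohomology of Hessenberg
    varieties, in the purely algebraic form given by the GKM conditions.
    Consider functions f from words to polynomials in one variable per cell such
    that f w - f w', where w' exchanges the letters of w at two attacking cells
    p and q, is divisible by x_p - x_q.  For each word w there is such a function
    which vanishes before w, takes at w the product of x_p - x_q over the ascents
    of w, and has no larger degree (flow_up_exists).  It is constructed by adding
    the pairs of the relation one at a time, a longest one last.  When the pair
    (i, j) is added, the obstruction is the difference f w - f w' for the
    exchange at i and j, taken modulo x_i - x_j; its first nonzero value is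
    divisible by the product belonging to the ascents (anti_lead_dvd), so that it
    can be cancelled by a multiple of a class that exists already.  The one case
    of that divisibility that needs a square factor is the hexagon lemma.

    The columns enter by specializing x_p to the column of p, which keeps
    x_p - x_q nonzero for attacking cells, and by antisymmetrizing over the
    permutations that preserve the columns.  The class of a strict word then
    survives.  For a word that is not strict some two neighbours i, j in a column
    do not ascend; the pair (i, j) can be added to the relation, and the class
    for the larger relation is killed by the antisymmetrization.  Hence the
    functions on permutations obtained in degree at most k form a module for the
    symmetric group, in which the vectors fixed by the stabilizer of a word b
    have dimension the number of strict rearrangements of b with at most k
    ascents (level_characters).

    It remains to convert this into Schur functions.  Let hperm b be the
    character of the permutations of the rearrangements of b.  The product of two
    such characters counts matrices with given row and column sums
    (cfdot_hperm), which by the Robinson-Schensted-Knuth count (rsk_count) is a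
    sum of products of Kostka numbers.  As the Kostka matrix is unitriangular,
    there are irreducible characters xi mu with
    hperm b = sum over mu of K(mu, b) xi mu (hperm_decomposition).  Therefore the
    number of strict rearrangements of b with exactly k ascents is the sum of
    K(mu, b) c(k, mu), where the natural number c(k, mu) is the multiplicity of
    xi mu in the k-th graded piece (graded_multiplicities).  Since K(mu, b) is
    the coefficient in the Schur function of mu of the monomial with the content
    of b (schur_chain), the coefficient of that Schur function in the series of
    the strip is the polynomial with the coefficients c(k, mu).  Symmetry holds
    because hperm b is not affected by an injective relabelling of the letters. *)

(** * Words and the permutations of their positions *)

Local Open Scope nat_scope.

Section WordContent.
Variables (P L : finType).
Implicit Types (W : {ffun P -> L}) (s t : {perm P}).

Definition wact W s : {ffun P -> L} := [ffun p => W (s p)].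
Definition wcount W l := #|[set p | W p == l]|.

Lemma wact_fixP W s : reflect (forall p, W (s p) = W p) (wact W s == W).
Proof.
apply: (iffP eqP) => [/ffunP e p|e]; first by have := e p; rewrite ffunE.
by apply/ffunP => p; rewrite ffunE.
Qed.

Lemma wact_count W s l : wcount (wact W s) l = wcount W l.
Proof.
rewrite /wcount -(card_imset _ (@perm_inj _ s)); apply: eq_card => q; rewrite inE.
apply/imsetP/eqP => [[p]|<-]; first by rewrite inE ffunE => /eqP <- ->.
by exists (s^-1 q)%g; rewrite ?permKV // inE ffunE permKV.
Qed.

Lemma wcount_count W l : wcount W l = count_mem l (fgraph W).
Proof.
rewrite /wcount -sum1_card -codom_ffun codomE count_map -sum1_count big_enum_cond /=.
by apply: eq_bigl => p; rewrite inE.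
Qed.

Lemma same_count_wact W W' : wcount W =1 wcount W' -> exists s, W' = wact W s.
Proof.
move=> e.
have : perm_eq (fgraph W') (fgraph W).
  by apply/allP => l _ /=; rewrite -!wcount_count e.
move=> /tuple_permP[t et].
pose f p := enum_val (t (enum_rank p)).
have fI : injective f by move=> p q /enum_val_inj/perm_inj/enum_rank_inj.
exists (perm fI); apply/ffunP => p; rewrite ffunE permE.
have h (i : 'I_#|P|) : tnth (fgraph W') i = tnth (fgraph W) (t i).
  by rewrite (tnth_nth (W' p)) et nth_mktuple.
by have := h (enum_rank p); rewrite !tnth_fgraph enum_rankK.
Qed.

Lemma word_of_count (m : L -> nat) : \sum_l m l = #|P| -> exists W, forall l, wcount W l = m l.
Proof.
move=> e.
pose s := flatten [seq nseq (m l) l | l <- enum L].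
have sz : size s == #|P|.
  rewrite size_flatten /shape -map_comp sumnE big_map big_enum -e /=.
  by apply/eqP; apply: eq_bigr => l _; rewrite size_nseq.
exists (Finfun (Tuple sz)) => l; rewrite wcount_count FinfunK /=.
rewrite count_flatten sumnE !big_map -enumT big_enum /= (bigD1 l) //= count_nseq /= eqxx mul1n.
by rewrite big1 ?addn0 // => l' nl; rewrite count_nseq /= (negbTE nl).
Qed.

Definition in_class W W' := [exists s, W' == wact W s].

Lemma in_classP W W' : reflect (exists s, W' = wact W s) (in_class W W').
Proof. exact: 'exists_eqP. Qed.

Definition word_stab W := [set s | wact W s == W].

Lemma word_stabP W s : reflect (forall p, W (s p) = W p) (s \in word_stab W).
Proof. by rewrite inE; exact: wact_fixP. Qed.

Lemma word_stab_group_set W : group_set (word_stab W).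
Proof.
apply/group_setP; split=> [|s t /word_stabP hs /word_stabP ht].
  by apply/word_stabP => p; rewrite perm1.
by apply/word_stabP => p; rewrite permM ht hs.
Qed.
Canonical word_stab_group W := Group (word_stab_group_set W).
End WordContent.
Local Open Scope ring_scope.

(** * Polynomials with variables indexed by a finite type *)

Definition divides (A : comNzRingType) (d f : A) := exists g, f = d * g.

Section Polynomials.
Variable P : finType.
Local Notation pol := (mpoly #|P| algC).
Implicit Types (f g : pol) (p q r s : P).

Definition var p : pol := mpolyX algC (mnm1 (enum_rank p)).
Definition lin p q : pol := var p - var q.
Definition subst (h : P -> P) : pol -> pol :=
  mmap (mpolyC #|P| (R := algC)) (fun i => var (h (enum_val i))).
Definition merge p q r := if r == p then q else r.
Definition evalp (a : P -> algC) : pol -> algC := meval (fun i => a (enum_val i)).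

HB.instance Definition _ h := GRing.RMorphism.on (subst h).
HB.instance Definition _ a := GRing.RMorphism.on (evalp a).

Lemma subst_var h p : subst h (var p) = var (h p).
Proof. by rewrite /subst /var mmapX mmap1U enum_rankK. Qed.

Lemma evalp_var a p : evalp a (var p) = a p.
Proof. by rewrite /evalp /var mevalXU enum_rankK. Qed.

Lemma var_inj : injective var.
Proof.
move=> p q e; have := congr1 (evalp (fun r => (r == p)%:R)) e.
by rewrite !evalp_var eqxx; case: eqP => // _ /eqP; rewrite oner_eq0.
Qed.

Lemma lin_eq0 p q : (lin p q == 0) = (p == q).
Proof. by rewrite subr_eq0 (inj_eq var_inj). Qed.

Lemma lin_neq0 p q : (lin p q != 0) = (p != q).
Proof. by rewrite lin_eq0. Qed.

Lemma linN p q : - lin p q = lin q p. Proof. exact: opprB. Qed.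

Lemma subst_lin h p q : subst h (lin p q) = lin (h p) (h q).
Proof. by rewrite rmorphB /= !subst_var. Qed.

Lemma evalp_lin a p q : evalp a (lin p q) = a p - a q.
Proof. by rewrite rmorphB /= !evalp_var. Qed.

Lemma substC h c : subst h (mpolyC _ c) = mpolyC _ c.
Proof. exact: mmapC. Qed.

Lemma evalpC a c : evalp a (mpolyC _ c) = c.
Proof. exact: mevalC. Qed.

Lemma pol_ind (K : pol -> Prop) :
  (forall c, K (mpolyC _ c)) -> (forall p, K (var p)) ->
  (forall f g, K f -> K g -> K (f + g)) -> (forall f g, K f -> K g -> K (f * g)) ->
  forall f, K f.
Proof.
move=> KC KX KD KM f; rewrite (mpolyE f).
have K0 : K 0 by rewrite -(mpolyC0 #|P| algC).
have K1 : K 1 by rewrite -(mpolyC1 #|P| algC).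
apply: (big_ind K K0 KD) => m _; rewrite -mul_mpolyC; apply: (KM) => //.
rewrite mpolyXE_id; apply: (big_ind K K1 KM) => i _.
have Ki : K (mpolyX algC (mnm1 i)) by have := KX (enum_val i); rewrite /var enum_valK.
have KE (g : pol) k : K g -> K (g ^+ k).
  by move=> Kg; elim: k => [|k IH]; rewrite ?expr0 // exprS; apply: (KM).
exact: KE.
Qed.

Lemma subst_comp h1 h2 f : subst h1 (subst h2 f) = subst (h1 \o h2) f.
Proof.
elim/pol_ind: f => [c|p|f g IH1 IH2|f g IH1 IH2].
- by rewrite !substC.
- by rewrite !subst_var.
- by rewrite !rmorphD /= IH1 IH2.
- by rewrite !rmorphM /= IH1 IH2.
Qed.

Lemma eq_subst h1 h2 f : h1 =1 h2 -> subst h1 f = subst h2 f.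
Proof.
move=> e; elim/pol_ind: f => [c|p|f g IH1 IH2|f g IH1 IH2].
- by rewrite !substC.
- by rewrite !subst_var e.
- by rewrite !rmorphD /= IH1 IH2.
- by rewrite !rmorphM /= IH1 IH2.
Qed.

Lemma subst_mergeE p q f : divides (lin p q) (f - subst (merge p q) f).
Proof.
elim/pol_ind: f => [c|r|f g [f1 e1] [g1 e2]|f g [f1 e1] [g1 e2]].
- by exists 0; rewrite substC mulr0 subrr.
- rewrite subst_var /merge; case: (r =P p) => [->|_].
    by exists 1; rewrite mulr1.
  by exists 0; rewrite mulr0 subrr.
- by exists (f1 + g1); rewrite rmorphD /= mulrDr -e1 -e2 opprD addrACA.
exists (f1 * g + subst (merge p q) f * g1).
rewrite rmorphM /= mulrDr mulrA -e1 mulrCA -e2 mulrBl mulrBr.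
by rewrite addrA subrK.
Qed.

(** Modulo x_p - x_q a polynomial does not change when x_p is replaced by x_q,
    so that divisibility by x_p - x_q is the vanishing of a substitution. Every
    divisibility below is tested in this way. *)
Lemma lin_dvdP p q f : divides (lin p q) f <-> subst (merge p q) f = 0.
Proof.
split=> [[g ->]|e].
  by rewrite rmorphM /= subst_lin /merge eqxx; case: eqP => [->|_]; rewrite /lin subrr mul0r.
by have := subst_mergeE p q f; rewrite e subr0.
Qed.

Lemma lin_dvd_sym p q f : divides (lin p q) f -> divides (lin q p) f.
Proof. by case=> g ->; exists (- g); rewrite mulrN -mulNr linN. Qed.

(** The substitution takes its values in a domain, so its kernel is prime. *)
Lemma lin_prime p q c f :
  subst (merge p q) c != 0 -> divides (lin p q) (c * f) -> divides (lin p q) f.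
Proof.
move=> nc /lin_dvdP; rewrite rmorphM /= => /eqP; rewrite mulf_eq0 (negbTE nc) /= => /eqP e.
exact/lin_dvdP.
Qed.

(** The measure is one more than the degree, and 0 for the zero polynomial,
    which thus satisfies every degree bound. *)
Definition deg_le (k : nat) f := (mmeasure mdeg f <= k.+1)%N.

Lemma deg_le0 k : deg_le k 0. Proof. by rewrite /deg_le mmeasure0. Qed.

Lemma deg_leW k l f : (k <= l)%N -> deg_le k f -> deg_le l f.
Proof. by move=> kl h; apply: leq_trans h _; rewrite ltnS. Qed.

Lemma deg_leD k f g : deg_le k f -> deg_le k g -> deg_le k (f + g).
Proof.
by move=> h1 h2; apply: leq_trans (mmeasureD_le _ _ _) _; rewrite geq_max; apply/andP.
Qed.

Lemma deg_leN k f : deg_le k (- f) = deg_le k f.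
Proof. by rewrite /deg_le mmeasureN. Qed.

Lemma deg_leB k f g : deg_le k f -> deg_le k g -> deg_le k (f - g).
Proof. by move=> h1 h2; apply: deg_leD; rewrite ?deg_leN. Qed.

Lemma deg_leM k l f g : deg_le k f -> deg_le l g -> deg_le (k + l) (f * g).
Proof.
case: (eqVneq f 0) => [->|nf]; first by rewrite mul0r => _ _; exact: deg_le0.
case: (eqVneq g 0) => [->|ng]; first by rewrite mulr0 => _ _; exact: deg_le0.
rewrite /deg_le msizeM // => h1 h2.
have : (mmeasure mdeg f + mmeasure mdeg g <= k.+1 + l.+1)%N by exact: leq_add.
by rewrite addSn addnS -subn1 leq_subLR add1n.
Qed.

Lemma deg_le_sum k (I : Type) (s : seq I) (Q : pred I) (F : I -> pol) :
  (forall i, Q i -> deg_le k (F i)) -> deg_le k (\sum_(i <- s | Q i) F i).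
Proof. by move=> h; apply: (big_ind (deg_le k)) => //; [exact: deg_le0|exact: deg_leD]. Qed.

Lemma deg_leC c : deg_le 0 (mpolyC _ c).
Proof. by rewrite /deg_le mmeasureC; case: (c != 0). Qed.

Lemma deg_le_var p : deg_le 1 (var p).
Proof. by rewrite /deg_le /var msizeX mdeg1. Qed.

Lemma deg_le_lin p q : deg_le 1 (lin p q).
Proof. by apply: deg_leB; apply: deg_le_var. Qed.

Lemma deg_le_subst k h f : deg_le k f -> deg_le k (subst h f).
Proof.
move=> hf; rewrite /subst /mmap big_seq; apply: deg_le_sum => m mf.
rewrite -[k]add0n; apply: deg_leM; first exact: deg_leC.
have km : (mdeg m <= k)%N by have := leq_trans (msize_mdeg_lt mf) hf; rewrite ltnS.
apply: deg_leW km _; rewrite mdegE /mmap1.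
apply: (big_ind2 (fun d g => deg_le d g)).
- exact: (deg_leC 1).
- by move=> d1 g1 d2 g2; exact: deg_leM.
move=> i _; have dE (g : pol) d : deg_le 1 g -> deg_le d (g ^+ d).
  move=> hg; elim: d => [|d IH]; first by rewrite expr0; exact: (deg_leC 1).
  by rewrite exprS -add1n; apply: deg_leM.
by apply: dE; exact: deg_le_var.
Qed.

Lemma msize_lin p q : p != q -> mmeasure mdeg (lin p q) = 2.
Proof.
move=> npq; apply/eqP; rewrite eqn_leq [(_ <= 2)%N]deg_le_lin /= ltnNge; apply/negP => h.
have /= e := msize1_polyC h.
have := congr1 (evalp (fun r => (r == p)%:R)) e.
have := congr1 (evalp (fun r => 0)) e.
rewrite !evalp_lin /evalp !mevalC subr0 => <-; rewrite eqxx eq_sym (negbTE npq) subr0.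
by move/eqP; rewrite oner_eq0.
Qed.

Lemma deg_le_lin_div p q f k : p != q -> deg_le k (lin p q * f) -> f = 0 \/ (0 < k)%N && deg_le k.-1 f.
Proof.
move=> npq; case: (eqVneq f 0) => [->|nf]; first by left.
rewrite /deg_le msizeM ?lin_neq0 // msize_lin // => h; right.
have f0 : (0 < mmeasure mdeg f)%N by rewrite lt0n mmeasure_poly_eq0.
by case: k h => [|k] /=; move: f0; case: (mmeasure _ f).
Qed.
End Polynomials.

(** * The GKM condition on functions of words *)

Section Divisibility.
Variable P : finType.
Local Notation pol := (mpoly #|P| algC).

Lemma divides_sub (A : comNzRingType) (d f g : A) : divides d f -> divides d g -> divides d (f - g).
Proof. by move=> [f' ->] [g' ->]; exists (f' - g'); rewrite mulrBr. Qed.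

Lemma divides_add (A : comNzRingType) (d f g : A) : divides d f -> divides d g -> divides d (f + g).
Proof. by move=> [f' ->] [g' ->]; exists (f' + g'); rewrite mulrDr. Qed.

Lemma divides_mull (A : comNzRingType) (d f g : A) : divides d g -> divides d (f * g).
Proof. by move=> [g' ->]; exists (f * g'); rewrite mulrCA. Qed.

Lemma merge_neq (a b a' b' : P) : a' != b' ->
  [set a'; b'] != [set a; b] -> merge a b a' != merge a b b'.
Proof.
move=> n; rewrite /merge; apply: contraNneq; case: eqP => [ea|na]; case: eqP => [eb|nb].
- by move: n; rewrite ea eb eqxx.
- by move=> <-; rewrite ea.
- by move=> ->; rewrite eb setUC.
- by move=> e; move: n; rewrite e eqxx.
Qed.

(** Cancels c factor by factor, each of them being prime. *)
Lemma lins_prime (T : eqType) (s : seq T) (a b : T -> P) (c f : pol) :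
  (forall e, e \in s -> a e != b e) ->
  (forall e, e \in s -> subst (merge (a e) (b e)) c != 0) ->
  divides (\prod_(e <- s) lin (a e) (b e)) (c * f) ->
  divides (\prod_(e <- s) lin (a e) (b e)) f.
Proof.
elim: s f => [|e s IH] f ab cn.
  by rewrite !big_nil => _; exists f; rewrite mul1r.
rewrite !big_cons => -[y ey].
have [||f' ef] := @lin_prime _ (a e) (b e) c f.
- by apply: cn; rewrite inE eqxx.
- by exists (\prod_(e <- s) lin (a e) (b e) * y); rewrite ey mulrA.
have l0 : lin (a e) (b e) != 0 by rewrite lin_neq0 ab // inE eqxx.
have [|||y' ey'] := IH f'.
- by move=> e' e's; apply: ab; rewrite inE e's orbT.
- by move=> e' e's; apply: cn; rewrite inE e's orbT.
- exists y; apply: (mulfI l0).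
  by rewrite mulrCA -ef ey mulrA.
by exists y'; rewrite -mulrA -ey'.
Qed.

(** Linear forms on different pairs of variables are coprime, so that only the
    factors sharing their pair have to be treated together. Such factors arise
    when two variables have been merged. *)
Lemma prod_lin_dvd (T : finType) (S : {set T}) (a b : T -> P) (f : pol) :
  (forall e, e \in S -> a e != b e) ->
  (forall e, e \in S ->
     divides (\prod_(e' in S | [set a e'; b e'] == [set a e; b e]) lin (a e') (b e')) f) ->
  divides (\prod_(e in S) lin (a e) (b e)) f.
Proof.
move=> ab H.
rewrite (partition_big (fun e => [set a e; b e]) predT) //=.
have {}H (k : {set P}) :
    divides (\prod_(e in S | [set a e; b e] == k) lin (a e) (b e)) f.
  case: (pickP [pred e in S | [set a e; b e] == k]) => [e /andP[eS /eqP <-]|no].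
    exact: H.
  by rewrite big_pred0 //; exists f; rewrite mul1r.
elim: (index_enum _) (index_enum_uniq {set P}) => [|k s IH] /=.
  by rewrite big_nil => _; exists f; rewrite mul1r.
move=> /andP[ks us]; rewrite big_cons.
have [g eg] := IH us.
suff [g' eg'] : divides (\prod_(e in S | [set a e; b e] == k) lin (a e) (b e)) g.
  by exists g'; rewrite eg eg' mulrCA mulrA.
have := H k; rewrite -big_filter eg => h; apply: lins_prime h.
  by move=> e; rewrite mem_filter => /andP[/andP[eS _] _]; exact: ab.
move=> e; rewrite mem_filter => /andP[/andP[eS /eqP ke] _].
rewrite rmorph_prod /= big_seq prodf_seq_neq0.
apply/allP => k' _; apply/implyP => k's.
rewrite rmorph_prod /= prodf_seq_neq0; apply/allP => e' _.
apply/implyP => /andP[e'S /eqP ke'].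
rewrite subst_lin lin_neq0; apply: merge_neq; first exact: ab.
by rewrite ke' ke; apply: contraNneq ks => <-.
Qed.
End Divisibility.

Section Words.
Variables (P : finType) (rk : P -> nat) (r : nat).
Hypothesis rk_inj : injective rk.
Local Notation pol := (mpoly #|P| algC).
Local Notation word := {ffun P -> 'I_r}.
Implicit Types (u v w : word) (p q x : P) (E : rel P) (f : word -> pol).

Definition swap p q w : word := [ffun x => w (tperm p q x)].

Lemma swapK p q : involutive (swap p q).
Proof. by move=> w; apply/ffunP => x; rewrite !ffunE tpermK. Qed.

Lemma swapC p q w : swap p q w = swap q p w.
Proof. by apply/ffunP => x; rewrite !ffunE tpermC. Qed.

Lemma swapL p q w : swap p q w p = w q. Proof. by rewrite ffunE tpermL. Qed.

Lemma swapR p q w : swap p q w q = w p. Proof. by rewrite ffunE tpermR. Qed.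

Lemma swapD p q w x : x != p -> x != q -> swap p q w x = w x.
Proof. by move=> xp xq; rewrite ffunE tpermD 1?eq_sym. Qed.

(** Lexicographic order in which a larger letter comes first, so that exchanging
    the two letters of an ascent gives an earlier word. *)
Definition wlt u v :=
  [exists p, (v p < u p)%N && [forall q, (rk q < rk p)%N ==> (u q == v q)]].

Lemma wltP u v : reflect (exists2 p, (v p < u p)%N & forall q, (rk q < rk p)%N -> u q = v q)
  (wlt u v).
Proof.
apply: (iffP existsP) => -[p].
  by move=> /andP[h /forallP h']; exists p => // q /(implyP (h' q)) /eqP.
by move=> h h'; exists p; rewrite h; apply/forallP => q; apply/implyP => /h' /eqP.
Qed.

Lemma wltxx u : wlt u u = false.
Proof. by apply/wltP => -[p]; rewrite ltnn. Qed.

Lemma wlt_trans v u w : wlt u v -> wlt v w -> wlt u w.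
Proof.
move=> /wltP[p h1 e1] /wltP[q h2 e2]; apply/wltP.
case: (ltngtP (rk p) (rk q)) => [pq|qp|/rk_inj epq].
- by exists p => [|x xp]; [rewrite -e2|rewrite e1 // e2 // (ltn_trans xp)].
- by exists q => [|x xq]; [rewrite e1|rewrite e1 ?(ltn_trans xq) // e2].
- by exists p => [|x xp]; [rewrite (ltn_trans _ h1) // epq|rewrite e1 // e2 // -epq].
Qed.

Lemma wlt_total u v : u != v -> wlt u v || wlt v u.
Proof.
move=> nuv.
have [p0 np0] : exists p, u p != v p.
  apply/existsP; apply: contraNT nuv; rewrite negb_exists => /forallP h.
  by apply/eqP/ffunP => x; have := h x; rewrite negbK => /eqP.
pose p := [arg min_(x < p0 | u x != v x) rk x].
have [np pmin] : u p != v p /\ forall q, (rk q < rk p)%N -> u q = v q.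
  rewrite /p; case: arg_minnP => // x nx xmin; split=> // q qx.
  by apply/eqP; apply: contraTT qx => /xmin; rewrite -leqNgt.
case: (ltngtP (u p) (v p)) => [h|h|/val_inj e]; last by rewrite e eqxx in np.
  by apply/orP; right; apply/wltP; exists p => // q /pmin.
by apply/orP; left; apply/wltP; exists p.
Qed.

Definition word_index w := #|[set u | wlt u w]|.

Lemma word_index_lt u v : wlt u v -> (word_index u < word_index v)%N.
Proof.
move=> uv; apply: proper_card; apply/properP; split.
  by apply/subsetP => x; rewrite !inE => /wlt_trans; apply.
by exists u; rewrite inE ?uv // wltxx.
Qed.

Lemma word_index_ltE u v : (word_index u < word_index v)%N = wlt u v.
Proof.
apply/idP/idP => [h|]; last exact: word_index_lt.
have n : u != v by apply: contraTneq h => ->; rewrite ltnn.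
case/orP: (wlt_total n) => // /word_index_lt h'.
by have := ltn_trans h h'; rewrite ltnn.
Qed.

Lemma word_index_inj : injective word_index.
Proof.
move=> u v e; apply/eqP; apply: contraTT isT => /wlt_total/orP[] /word_index_lt; by rewrite e ltnn.
Qed.

Lemma wlt_swap p q v : (rk p < rk q)%N -> (v p < v q)%N -> wlt (swap p q v) v.
Proof.
move=> pq h; apply/wltP; exists p; first by rewrite swapL.
move=> x xp; rewrite swapD //; first by apply: contraTneq xp => ->; rewrite ltnn.
by apply: contraTneq xp => ->; rewrite -leqNgt ltnW.
Qed.

(** These are the incomparability relations of natural unit interval orders:
    with the cells arranged by rk, the pairs are those below a Dyck path. *)
Definition closed_rel E :=
  (forall p q, E p q -> (rk p < rk q)%N) /\
  (forall p x q, E p q -> (rk p < rk x)%N -> (rk x < rk q)%N -> E p x && E x q).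

(** The divisibility conditions of Goresky, Kottwitz and MacPherson for the
    equivariant cohomology of a Hessenberg variety, whose moment graph has an
    edge for every exchange along E. *)
Definition gkm E f := forall p q w, E p q -> divides (lin p q) (f w - f (swap p q w)).

Definition asc E w := [set e : P * P | E e.1 e.2 && (w e.1 < w e.2)%N].
Definition lead E w : pol := \prod_(e in asc E w) lin e.1 e.2.

(** Exchanging the letters of an ascent gives an earlier word, at which f
    vanishes; this makes f w divisible by each factor of the leading product,
    and the factors are pairwise coprime. *)
Lemma gkm_lead_dvd E f w : closed_rel E -> gkm E f ->
  (forall u, wlt u w -> f u = 0) -> divides (lead E w) (f w).
Proof.
move=> [Erk _] fM fw; rewrite /lead; apply: prod_lin_dvd => [[p q]|[p q]].
  by rewrite inE /= => /andP[/Erk h _]; apply: contraTneq h => ->; rewrite ltnn.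
rewrite inE /= => /andP[Epq pq].
rewrite (big_pred1 (p, q)) => [|[p' q']] /=.
  have := fM _ _ w Epq; rewrite (fw (swap p q w)) ?subr0 //.
  by apply: wlt_swap pq; exact: Erk.
rewrite inE /=; apply/andP/eqP => [[/andP[E' _]]|[-> ->]]; last by rewrite Epq pq eqxx.
move=> /eqP/setP e; have := e p; have := e q; have := e p'; have := e q'.
rewrite !inE !eqxx !orbT /=; have := Erk _ _ Epq; have := Erk _ _ E'.
move=> l1 l2 /esym/orP[]/eqP e1 /esym/orP[]/eqP e2.
- by move: l1; rewrite e1 e2 ltnn.
- by move: l1; rewrite e1 e2 => /(ltn_trans l2); rewrite ltnn.
- by move=> _ _; congr pair.
- by move: l1; rewrite e1 e2 ltnn.
Qed.
End Words.

(** * The hexagon identity *)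

Section Hexagon.
Variable P : finType.
Local Notation pol := (mpoly #|P| algC).
Variables (i x j : P).
Hypotheses (ix : i != x) (xj : x != j) (ij : i != j).

Let coll y := if (y == x) || (y == j) then i else y.

(** Putting x_x in place of x_j, or x_i in place of x_x, kills one of the two
    terms and shows that the other coefficient vanishes; coll makes all three
    variables equal and factors through both substitutions. *)
Lemma coll_zero (f g : pol) : lin i x * f + lin x j * g = 0 ->
  subst coll f = 0 /\ subst coll g = 0.
Proof.
move=> e; split.
  have := congr1 (subst (merge j x)) e.
  rewrite rmorphD !rmorphM /= !subst_lin rmorph0 /merge eqxx (negbTE ij) (negbTE xj).
  rewrite [lin x x]subrr mul0r addr0 => /eqP; rewrite mulf_eq0 lin_eq0 (negbTE ix) /= => /eqP e'.
  have := congr1 (subst coll) e'; rewrite rmorph0 subst_comp => <-.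
  apply: eq_subst => y; rewrite /coll /merge /=; case: (eqVneq y j) => [->|]; rewrite ?eqxx ?orbT //.
  by move=> /negbTE ->.
have := congr1 (subst (merge x i)) e.
rewrite rmorphD !rmorphM /= !subst_lin rmorph0 /merge eqxx (negbTE ix) eq_sym (negbTE xj).
rewrite [lin i i]subrr mul0r add0r => /eqP; rewrite mulf_eq0 lin_eq0 (negbTE ij) /= => /eqP e'.
have := congr1 (subst coll) e'; rewrite rmorph0 subst_comp => <-.
apply: eq_subst => y; rewrite /coll /merge /=; case: (eqVneq y x) => [->|/negbTE ->] /=.
  by rewrite (negbTE ix) (negbTE ij).
by [].
Qed.

(** The values of a GKM function at the six words obtained by rearranging three
    letters at i, x, j sit around a hexagon. Its sides are exchanges at (i, x)
    or (x, j), and its long diagonals are exchanges at (i, j). Two of these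
    diagonals are known to vanish modulo x_i - x_j; they cut the hexagon into
    shorter cycles. Around each cycle the differences add up to zero, and
    coll_zero turns this into relations between the quotients of the sides,
    which yield the second factor for the third diagonal. *)
Lemma hexagon (F1 F2 F3 F4 F5 F6 : pol) :
  divides (lin i x) (F1 - F2) -> divides (lin x j) (F2 - F3) -> divides (lin i x) (F3 - F4) ->
  divides (lin x j) (F4 - F5) -> divides (lin i x) (F5 - F6) -> divides (lin x j) (F6 - F1) ->
  subst (merge j i) (F6 - F3) = 0 -> subst (merge j i) (F2 - F5) = 0 ->
  divides (lin i x * lin x i) (subst (merge j i) (F1 - F4)).
Proof.
move=> [A1 e1] [A2 e2] [A3 e3] [A4 e4] [A5 e5] [A6 e6].
move=> /lin_dvdP/lin_dvd_sym[C c] /lin_dvdP/lin_dvd_sym[C' c'].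
have lij : lin i j = lin i x + lin x j :> pol by rewrite /lin addrA subrK.
rewrite lij in c c'.
(* The whole hexagon. *)
have [z1 _] : subst coll (A1 + A3 + A5) = 0 /\ subst coll (A2 + A4 + A6) = 0.
  apply: coll_zero; rewrite !mulrDr -e1 -e2 -e3 -e4 -e5 -e6; ring.
(* The cycle F3, F4, F5, F6, closed by a diagonal. *)
have [z2 z3] : subst coll (A3 + A5 + C) = 0 /\ subst coll (A4 + C) = 0.
  apply: coll_zero; transitivity ((lin i x + lin x j) * C + lin i x * A3 + lin x j * A4 + lin i x * A5).
    ring.
  by rewrite -c -e3 -e4 -e5; ring.
(* The cycle F2, F3, F4, F5, closed by the other diagonal. *)
have [z4 z5] : subst coll (A3 - C') = 0 /\ subst coll (A2 + A4 - C') = 0.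
  apply: coll_zero; transitivity (lin x j * A2 + lin i x * A3 + lin x j * A4 - (lin i x + lin x j) * C').
    ring.
  by rewrite -c' -e3 -e4 -e2; ring.
have -> : F1 - F4 = lin i x * (A1 + A3) + lin x j * A2.
  by rewrite mulrDr -e1 -e2 -e3; ring.
rewrite rmorphD !rmorphM /= !subst_lin /merge eqxx (negbTE xj) (negbTE ij).
have [B b] : divides (lin x i) (subst (merge j i) (A1 + A3 - A2)).
  apply/lin_dvdP; rewrite subst_comp.
  have -> : subst (merge x i \o merge j i) (A1 + A3 - A2) = subst coll (A1 + A3 - A2).
    apply: eq_subst => y; rewrite /coll /merge /=; case: (eqVneq y j) => [->|]; rewrite ?orbT ?orbF //.
    by rewrite (negbTE ix).
  have -> : A1 + A3 - A2 = (A1 + A3 + A5) - (A3 + A5 + C) + (A4 + C) + (A3 - C') - (A2 + A4 - C').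
    by ring.
  by rewrite rmorphB rmorphD rmorphD rmorphB /= z1 z2 z3 z4 z5; ring.
by exists B; rewrite -mulrA -b rmorphB /= -(linN i x) -/(merge j i); ring.
Qed.
End Hexagon.

(** * Antisymmetrizing across a corner *)

Section Corner.
Variables (P : finType) (rk : P -> nat) (r : nat).
Hypothesis rk_inj : injective rk.
Local Notation pol := (mpoly #|P| algC).
Local Notation word := {ffun P -> 'I_r}.
Implicit Types (u v w : word) (p q x : P) (f : word -> pol).

Lemma swap_conj a b c w : a != c -> b != c ->
  swap a b (swap b c w) = swap a c (swap a b w).
Proof.
move=> ac bc; apply/ffunP => y; rewrite !ffunE -!permM; congr (w (fun_of_perm _ _)).
have := tpermJ b c (tperm a b); rewrite tpermR (tpermD ac bc) conjgE tpermV => <-.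
by rewrite -!mulgA tperm2 mulg1.
Qed.

Lemma swap_disj a b c d w : a != c -> a != d -> b != c -> b != d ->
  swap a b (swap c d w) = swap c d (swap a b w).
Proof.
move=> ac ad bc bd; apply/ffunP => y; rewrite !ffunE -!permM; congr (w (fun_of_perm _ _)).
have := tpermJ c d (tperm a b); rewrite !tpermD // conjgE tpermV => {2}<-.
by rewrite -!mulgA tperm2 mulg1.
Qed.

Variables (E : rel P) (i j : P).
Hypotheses (Ecl : closed_rel rk E) (nEij : ~~ E i j) (ij : (rk i < rk j)%N).
Hypothesis Ebet : forall x, (rk i < rk x)%N -> (rk x < rk j)%N -> E i x && E x j.

(** The obstruction to the GKM condition for the pair (i, j). *)
Definition anti f w := subst (merge j i) (f w - f (swap i j w)).

Let rk_neq p q : (rk p < rk q)%N -> p != q.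
Proof. by apply: contraTneq => ->; rewrite ltnn. Qed.

Variable f : word -> pol.
Hypothesis fM : gkm E f.
Variable v : word.
Hypotheses (vij : (v i < v j)%N) 
  (v0 : forall u, (u i < u j)%N -> wlt rk u v -> anti f u = 0).

Let R w := subst (merge j i) (f w).

Let antiE w : anti f w = R w - R (swap i j w). Proof. exact: rmorphB. Qed.

Let cong p q w : E p q -> divides (lin (merge j i p) (merge j i q)) (R w - R (swap p q w)).
Proof. by move=> /fM-/(_ w)[g e]; exists (subst (merge j i) g); rewrite -rmorphB e rmorphM /= subst_lin. Qed.

Let mE p : p != j -> merge j i p = p. Proof. by rewrite /merge => /negbTE ->. Qed.
Let mj : merge j i j = i. Proof. by rewrite /merge eqxx. Qed.

Lemma anti_disj p q : E p q -> (v p < v q)%N -> p != i -> p != j -> q != i -> q != j ->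
  divides (lin p q) (anti f v).
Proof.
move=> Epq pq pi pj qi qj.
have h1 := cong v Epq; have h2 := cong (swap i j v) Epq.
have := fun h => @v0 _ h (wlt_swap (Ecl.1 _ _ Epq) pq).
rewrite !swapD 1?eq_sym // => /(_ vij) h3; rewrite !mE // in h1 h2; move: h3; rewrite !antiE (swap_disj _ pi pj qi qj) in h2 * => h3.
by have := divides_sub h1 h2; congr (divides _ _); rewrite -[RHS]subr0 -h3; ring.
Qed.

(** The exchange at (p, i) relates the values of f at v and after exchanging i
    and j to those at two earlier words, where the antisymmetrization vanishes;
    a third exchange joins the partners of these words under i and j. *)
Lemma anti_left p : E p i -> (v p < v i)%N -> divides (lin p i) (anti f v).
Proof.
move=> Epi pi.
have rpi := Ecl.1 _ _ Epi; have rpj := ltn_trans rpi ij.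
have npi := rk_neq rpi; have npj := rk_neq rpj; have nij := rk_neq ij.
have pj := ltn_trans pi vij.
have h1 := cong v Epi; have h2 := cong (swap i j v) Epi.
have h3 := cong (swap i j (swap p i v)) Epi.
have w1 : wlt rk (swap p i v) v by exact: wlt_swap.
have w2 : wlt rk (swap p i (swap i j v)) v.
  apply/wltP; exists p; first by rewrite swapL swapL.
  by move=> x xp; rewrite !swapD ?rk_neq // (ltn_trans xp).
have e1 : anti f (swap p i v) = 0 by refine (@v0 _ _ w1); rewrite swapR swapD // eq_sym.
have e2 : anti f (swap p i (swap i j v)) = 0.
  by refine (@v0 _ _ w2); rewrite swapR [swap i j v p]swapD // swapD 1?eq_sym // swapR.
rewrite !antiE in e1 e2 *; rewrite !mE // in h1 h2 h3.
have e3 : swap p i (swap i j (swap p i v)) = swap i j (swap p i (swap i j v)).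
  rewrite swap_conj // swapK swapC [swap p i _]swapC [swap i j (swap _ _ _)]swapC.
  by rewrite [swap i j v]swapC swap_conj // 1?eq_sym // swapK.
rewrite e3 in h3.
have := divides_add (divides_sub h1 h2) h3; congr (divides _ _).
by rewrite -[RHS]addr0 -[X in _ = _ + X](subrr 0) -{1}e2 -e1; ring.
Qed.

(** As for anti_left, on the other side of the corner. *)
Lemma anti_right q : E j q -> (v j < v q)%N -> divides (lin i q) (anti f v).
Proof.
move=> Ejq jq.
have rjq := Ecl.1 _ _ Ejq; have riq := ltn_trans ij rjq.
have njq := rk_neq rjq; have niq := rk_neq riq; have nij := rk_neq ij.
have h1 := cong v Ejq; have h2 := cong (swap i j v) Ejq.
have h3 := cong (swap i j (swap j q v)) Ejq.
have w1 : wlt rk (swap j q v) v by exact: wlt_swap.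
have w2 : wlt rk (swap j q (swap i j v)) v.
  apply/wltP; exists i; first by rewrite swapD ?swapL.
  by move=> x xi; rewrite !swapD ?rk_neq // (ltn_trans xi) // (ltn_trans ij).
have e1 : anti f (swap j q v) = 0.
  by refine (@v0 _ _ w1); rewrite swapL swapD // (ltn_trans vij).
have e2 : anti f (swap j q (swap i j v)) = 0.
  by refine (@v0 _ _ w2); rewrite swapL swapD // swapL swapD // eq_sym.
rewrite !antiE in e1 e2 *; rewrite mj mE 1?eq_sym // in h1 h2 h3.
have e3 : swap j q (swap i j (swap j q v)) = swap i j (swap j q (swap i j v)).
  transitivity (swap i q v).
    by rewrite swapC [swap i j _]swapC swap_conj // 1?eq_sym // [swap j q v]swapC swapK swapC.
  by rewrite swap_conj // swapK.
rewrite e3 in h3.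
have := divides_add (divides_sub h1 h2) h3; congr (divides _ _).
by rewrite -[RHS]addr0 -[X in _ = _ + X](subrr 0) -{1}e2 -e1; ring.
Qed.

Section Between.
Variable x : P.
Hypotheses (ix : (rk i < rk x)%N) (xj : (rk x < rk j)%N).
Let nix := rk_neq ix. Let nxj := rk_neq xj. Let nij := rk_neq ij.
Let Eix : E i x. Proof. by have /andP[] := Ebet ix xj. Qed.
Let Exj : E x j. Proof. by have /andP[] := Ebet ix xj. Qed.

Let wix w : swap x j (swap i j w) = swap i j (swap i x w).
Proof. by rewrite [RHS]swapC swap_conj // 1?eq_sym // swapC [swap i j w]swapC. Qed.

Let wxj w : swap i x (swap i j w) = swap i j (swap x j w).
Proof. by rewrite [swap x j w]swapC swap_conj // eq_sym. Qed.

Let mi : merge j i i = i. Proof. exact: mE. Qed.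
Let mx : merge j i x = x. Proof. exact: mE. Qed.

(** The exchange at (i, j) is a product of exchanges at (i, x), (x, j) and (i,
    x), and modulo x_i - x_j each of these contributes a multiple of x_i - x_x.
    *)
Lemma anti_between : divides (lin i x) (anti f v).
Proof.
have h1 := cong v Eix; have h2 := lin_dvd_sym (cong (swap i x v) Exj).
have h3 := cong (swap x j (swap i x v)) Eix.
rewrite mj !mi !mx in h1 h2 h3.
have e : swap i x (swap x j (swap i x v)) = swap i j v.
  by rewrite swap_conj // swapK.
rewrite e in h3; rewrite antiE.
by have := divides_add (divides_add h1 h2) h3; congr (divides _ _); ring.
Qed.

(** When (i, x) and (x, j) are both ascents they give the same linear form up to
    sign modulo x_i - x_j, so that its square has to divide. The other two
    diagonals of the hexagon start at words earlier than v, where the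
    antisymmetrization vanishes. *)
Lemma anti_between_both : (v i < v x)%N -> (v x < v j)%N ->
  divides (lin i x * lin x i) (anti f v).
Proof.
move=> vix vxj.
have := @hexagon _ i x j nix nxj nij (f v) (f (swap i x v)) (f (swap x j (swap i x v)))
  (f (swap i j v)) (f (swap i j (swap i x v))) (f (swap x j v)).
have w1 : swap x j (swap i x v) = swap i j (swap x j v).
  by rewrite swapC [swap i x v]swapC swap_conj // 1?eq_sym // swapC [swap j x v]swapC.
have w2 : swap i x (swap x j (swap i x v)) = swap i j v.
  by rewrite w1 wxj swapK.
have w3 : swap x j (swap i j v) = swap i j (swap i x v) by exact: wix.
have w4 : swap i x (swap i j (swap i x v)) = swap x j v.
  by rewrite wxj w1 swapK.
apply.
- exact: fM.
- exact: fM.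
- by rewrite -w2; exact: fM.
- by rewrite -w3; exact: fM.
- by rewrite -w4; exact: fM.
- by rewrite -{2}[v](swapK x j); exact: fM.
- rewrite w1; apply: v0; last exact: wlt_swap.
  by rewrite swapR swapD.
- apply: v0; last exact: wlt_swap.
  by rewrite swapL swapD // eq_sym.
Qed.
End Between.

Let from_i q : E i q -> (rk q < rk j)%N.
Proof.
move=> Eiq; case: (ltngtP (rk q) (rk j)) => // [h|/rk_inj e].
  by have /andP[Eij _] := Ecl.2 _ _ _ Eiq ij h; move: nEij; rewrite Eij.
by move: nEij; rewrite -e Eiq.
Qed.

Let to_j p : E p j -> (rk i < rk p)%N.
Proof.
move=> Epj; case: (ltngtP (rk i) (rk p)) => // [h|/rk_inj e].
  by have /andP[_ Eij] := Ecl.2 _ _ _ Epj h ij; move: nEij; rewrite Eij.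
by move: nEij; rewrite e Epj.
Qed.

Let set2_eq (a b c d : P) : [set a; b] = [set c; d] -> (a = c /\ b = d) \/ (a = d /\ b = c).
Proof.
move=> /setP e; have := e a; have := e b; have := e c; have := e d.
rewrite !inE !eqxx !orbT /= => /orP hd /orP hc /esym/orP hb /esym/orP ha.
by case: ha hb hc hd => [/eqP->|/eqP->] [/eqP->|/eqP->] [/eqP?|/eqP?] [/eqP?|/eqP?]; subst; auto.
Qed.

Let m_inv y z : merge j i y = z -> y = z \/ (y = j /\ z = i).
Proof. by rewrite /merge; case: eqP => [->|_] ->; auto. Qed.

Let m_eq y z : merge j i y = merge j i z -> [\/ y = z, y = i /\ z = j | y = j /\ z = i].
Proof.
by rewrite /merge; case: eqP => [->|_]; case: eqP => [->|_] e; subst;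
   [apply: Or31|apply: Or33|apply: Or32|apply: Or31].
Qed.

Ltac cyc := match goal with
  | H : is_true (?a < ?a)%N |- _ => by move: H; rewrite ltnn
  | H : is_true (?a < ?b)%N, H' : is_true (?b < ?a)%N |- _ =>
      by have := ltn_trans H H'; rewrite ltnn
  | H : is_true (?a < ?b)%N, H' : is_true (?b < ?c)%N, H'' : is_true (?c < ?a)%N |- _ =>
      by have := ltn_trans (ltn_trans H H') H''; rewrite ltnn
  | H : is_true (E i j) |- _ => by move: nEij; rewrite H
  end.

Lemma merge_edge p q : E p q -> merge j i p != merge j i q.
Proof.
move=> Epq; have l := Ecl.1 _ _ Epq.
by apply/eqP => /m_eq[e|[e e']|[e e']]; subst; cyc.
Qed.

(** Merging j into i identifies the linear forms of two ascents only when these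
    are (i, x) and (x, j) for some x between i and j. As (i, j) is not in E,
    closedness prevents E from joining i to a cell after j, or a cell before i
    to j, so every other factor can be treated alone. *)
Lemma anti_lead_dvd : divides (subst (merge j i) (lead E v)) (anti f v).
Proof.
rewrite /lead rmorph_prod /=.
under eq_bigr => e _ do rewrite subst_lin.
apply: (@prod_lin_dvd _ _ _ (fun e : P * P => merge j i e.1) (fun e : P * P => merge j i e.2)).
  by move=> [p q]; rewrite inE /= => /andP[/merge_edge].
move=> [p q]; rewrite inE /= => /andP[Epq vpq]; have l := Ecl.1 _ _ Epq.
have unique : ~~ ((rk i < rk p < rk j)%N && (q == j)) -> ~~ ((rk i < rk q < rk j)%N && (p == i)) ->
    divides (lin (merge j i p) (merge j i q)) (anti f v) ->
    divides (\prod_(e' in asc E v | [set merge j i e'.1; merge j i e'.2] ==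
       [set merge j i p; merge j i q]) lin (merge j i e'.1) (merge j i e'.2)) (anti f v).
  move=> n1 n2; rewrite (big_pred1 (p, q)) // => -[p' q'] /=.
  rewrite inE /=; apply/andP/eqP => [[/andP[E' _]]|[-> ->]]; last by rewrite Epq vpq eqxx.
  move=> /eqP/set2_eq; have l' := Ecl.1 _ _ E'.
  have := @from_i q; have := @from_i q'; have := @to_j p; have := @to_j p'.
  move=> a' a b' b [[/m_eq ep /m_eq eq]|[/m_eq ep /m_eq eq]];
    case: ep => [ep|[ep1 ep2]|[ep1 ep2]]; case: eq => [eq|[eq1 eq2]|[eq1 eq2]]; subst => //;
    try cyc;
    try (have := a' Epq => ?); try (have := a Epq => ?); try (have := a E' => ?); 
    try (have := a' E' => ?); try (have := b' Epq => ?); try (have := b Epq => ?);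
    try (have := b E' => ?); try (have := b' E' => ?); try cyc; move: n1 n2; by rewrite ?eqxx ?l ?l' ?andbT.
have between x : (rk i < rk x)%N -> (rk x < rk j)%N ->
    divides (\prod_(e' in asc E v | [set merge j i e'.1; merge j i e'.2] == [set i; x])
       lin (merge j i e'.1) (merge j i e'.2)) (anti f v).
  move=> ix xj; have /andP[Eix Exj] := Ebet ix xj.
  have nix := rk_neq ix; have nxj := rk_neq xj; have nij := rk_neq ij.
  have keyE e' : (e' \in asc E v) && ([set merge j i e'.1; merge j i e'.2] == [set i; x]) =
      (e' == (i, x)) && (v i < v x)%N || (e' == (x, j)) && (v x < v j)%N.
    case: e' => p' q'; rewrite inE !xpair_eqE /=.
    apply/andP/orP => [[/andP[E' v'] /eqP/set2_eq]|].
      have l' := Ecl.1 _ _ E'.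
      by case=> -[/m_inv[ep|[ep ep']] /m_inv[eq|[eq eq']]]; subst; try cyc;
        rewrite ?eqxx v'; auto.
    case=> /andP[/andP[/eqP-> /eqP->] ->]; first by rewrite Eix !mE.
    by rewrite Exj mj mE // setUC.
  rewrite (eq_bigl _ _ keyE).
  case: (boolP (v i < v x)%N) => vix; case: (boolP (v x < v j)%N) => vxj.
  - rewrite (bigD1 (i, x)) ?eqxx //= (big_pred1 (x, j)) => [|[p' q']] /=.
      by rewrite mj !mE //; exact: anti_between_both.
    rewrite !xpair_eqE !andbT; case: eqP => [->|_] /=; rewrite ?(negbTE nix) //= ?andbT //.
    by case: eqP.
  - rewrite (big_pred1 (i, x)) => [|e' /=]; last by rewrite andbT andbF orbF.
    by rewrite !mE //=; exact: anti_between.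
  - rewrite (big_pred1 (x, j)) => [|e' /=]; last by rewrite andbT andbF.
    by rewrite mj !mE //=; by apply: lin_dvd_sym; exact: anti_between.
  - rewrite big_pred0 => [|e' /=]; last by rewrite !andbF.
    by exists (anti f v); rewrite mul1r.
rewrite /=; have nij := rk_neq ij.
case: (eqVneq p i) => [epi|pi].
  rewrite epi in Epq l; have qj := from_i Epq.
  by rewrite epi !mE //; [exact: between|exact: rk_neq].
case: (eqVneq q j) => [eqj|qj].
  rewrite eqj in Epq l; have ip := to_j Epq.
  by rewrite eqj mj mE ?rk_neq // setUC; exact: between.
apply: unique; rewrite ?(negbTE pi) ?(negbTE qj) ?andbF //.
case: (eqVneq q i) => [eqi|qi].
  rewrite eqi in Epq vpq l *; rewrite !mE //; first exact: anti_left.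
  by apply: rk_neq; apply: ltn_trans ij.
case: (eqVneq p j) => [epj|pj].
  rewrite epj in Epq vpq l *; rewrite mj mE //; exact: anti_right.
by rewrite !mE //; exact: anti_disj.
Qed.
End Corner.

(** * Flow-up classes *)

Section FlowUp.
Variables (P : finType) (rk : P -> nat) (r : nat).
Hypothesis rk_inj : injective rk.
Local Notation pol := (mpoly #|P| algC).
Local Notation word := {ffun P -> 'I_r}.
Implicit Types (u v w : word) (p q x : P) (E : rel P) (f : word -> pol).

Lemma deg_le_prod_lin_div (T : eqType) (s : seq T) (a b : T -> P) k (f : pol) :
  all (fun e => a e != b e) s ->
  deg_le k (\prod_(e <- s) lin (a e) (b e) * f) ->
  f = 0 \/ (size s <= k)%N /\ deg_le (k - size s) f.
Proof.
elim: s k => [|e s IH] k /=; first by rewrite big_nil mul1r subn0; right.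
move=> /andP[ab abs]; rewrite big_cons -mulrA => /(deg_le_lin_div ab)[/eqP|/andP[k0]].
  rewrite mulf_eq0 prodf_seq_eq0 => /orP[/hasP[e' e's]|/eqP]; last by left.
  by rewrite /= lin_eq0 (negbTE (allP abs _ e's)).
by move=> /(IH _ abs)[]; [left|case: k k0 => // k _ /= [h1 h2]; right; rewrite subSS].
Qed.

(** These play the part of the equivariant Schubert classes: they are triangular
    for the order of words, and their leading value is the smallest that
    gkm_lead_dvd permits. *)
Definition flow_up E w f :=
  [/\ gkm E f, f w = lead E w, forall u, wlt rk u w -> f u = 0
    & forall u, deg_le #|asc E w| (f u)].

Lemma deg_le_lead_div E w k (f : pol) : closed_rel rk E -> deg_le k (lead E w * f) ->
  f = 0 \/ (#|asc E w| <= k)%N /\ deg_le (k - #|asc E w|) f.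
Proof.
move=> [Erk _]; rewrite /lead -big_enum /= [#|asc E w|]cardE => /deg_le_prod_lin_div; apply.
apply/allP => -[p q]; rewrite mem_enum inE /= => /andP[/Erk h _].
by apply: contraTneq h => ->; rewrite ltnn.
Qed.

Section AddCorner.
Variables (E : rel P) (i j : P).
Hypotheses (Ecl : closed_rel rk E) (nEij : ~~ E i j) (ij : (rk i < rk j)%N).
Hypothesis Ebet : forall x, (rk i < rk x)%N -> (rk x < rk j)%N -> E i x && E x j.

Definition add_corner p q := E p q || (p == i) && (q == j).

Let nij : i != j. Proof. by apply: contraTneq ij => ->; rewrite ltnn. Qed.

Lemma gkm_add_corner f : gkm E f -> (forall w, anti i j f w = 0) -> gkm add_corner f.
Proof.
move=> fM f0 p q w /orP[/fM|/andP[/eqP-> /eqP->]] //.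
by apply: lin_dvd_sym; apply/lin_dvdP; exact: f0.
Qed.

Lemma asc_add_corner_le w : (w j <= w i)%N -> asc add_corner w = asc E w.
Proof.
move=> wij; apply/setP => -[p q]; rewrite !inE /add_corner /=.
have [/andP[/eqP-> /eqP->]|] := boolP ((p == i) && (q == j)); last by rewrite orbF.
by rewrite ltnNge wij !andbF.
Qed.

Lemma asc_add_corner_lt w : (w i < w j)%N -> asc add_corner w = (i, j) |: asc E w.
Proof.
move=> wij; apply/setP => -[p q]; rewrite !inE /add_corner /= xpair_eqE orbC.
by have [/andP[/eqP-> /eqP->]|_ //] := boolP ((p == i) && (q == j)); rewrite wij.
Qed.

Lemma anti_swap f w : anti i j f (swap i j w) = - anti i j f w.
Proof. by rewrite /anti swapK -rmorphN opprB. Qed.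

Hypothesis flowE : forall w, exists f, flow_up E w f.

(** The words at which the antisymmetrization does not vanish are removed in
    increasing order. At the first of them, v, the value of the
    antisymmetrization is divisible by the leading value of a class at v, by
    anti_lead_dvd; subtracting the quotient times this class makes it zero, does
    not affect earlier words, and keeps the degree bound. All such v come after
    w, so the value at w stays the same. *)
Lemma kill_anti w m : (w j <= w i)%N -> exists f, flow_up E w f /\
  forall u, (u i < u j)%N -> (word_index rk u < m)%N -> anti i j f u = 0.
Proof.
move=> wij; elim: m => [|m [f [[fM fw f0 fd] fu]]].
  by have [f fF] := flowE w; exists f.
have [/existsP[v /and3P[vij /eqP vm nv]]|] :=
  boolP [exists v : word, [&& (v i < v j)%N, word_index rk v == m & anti i j f v != 0]]; last first.
  rewrite negb_exists => /forallP h; exists f; split=> // u uij.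
  rewrite ltnS leq_eqVlt => /orP[um|/fu->//].
  by have := h u; rewrite uij um /= negbK => /eqP.
have sv : wlt rk (swap i j v) v by exact: wlt_swap.
have wv : wlt rk w v.
  have nwv : w != v by apply: contraTneq wij => ->; rewrite -ltnNge.
  case/orP: (wlt_total rk nwv) => // vw.
  by move: nv; rewrite /anti !f0 ?subrr ?rmorph0 ?eqxx // (wlt_trans rk_inj sv).
have vdvd : divides (subst (merge j i) (lead E v)) (anti i j f v).
  apply: (anti_lead_dvd rk_inj Ecl) => // u uij uv; apply: fu => //.
  by rewrite -vm word_index_ltE.
have [a ea] := vdvd; have [g [gM gv g0 gd]] := flowE v.
have gw : g w = 0 by exact: g0.
have antiB u : anti i j (fun u => f u - a * g u) u = anti i j f u - subst (merge j i) a * anti i j g u.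
  by rewrite /anti !rmorphB !rmorphM /=; ring.
exists (fun u => f u - a * g u); split; first split.
- move=> p q u Epq; have := divides_sub (fM _ _ u Epq) (divides_mull a (gM _ _ u Epq)).
  by congr (divides _ _); ring.
- by rewrite gw mulr0 subr0.
- by move=> u uw; rewrite f0 // g0 ?mulr0 ?subr0 // (wlt_trans rk_inj uw).
- move=> u; apply: deg_leB => //.
  have : deg_le #|asc E w| (subst (merge j i) (lead E v) * a).
    by rewrite -ea; apply: deg_le_subst; exact: deg_leB.
  rewrite /lead rmorph_prod /= -big_enum /=.
  under eq_bigr => e _ do rewrite subst_lin.
  case/(@deg_le_prod_lin_div _ _ (fun e : P * P => merge j i e.1) (fun e : P * P => merge j i e.2)).
  + apply/allP => -[p q]; rewrite mem_enum inE /= => /andP[Epq _].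
    exact: (merge_edge Ecl nEij ij Epq).
  + by move=> ->; rewrite mul0r; exact: deg_le0.
  + rewrite -[size _]cardE => -[le da]; rewrite -(subnK le); exact: deg_leM.
move=> u uij; rewrite ltnS leq_eqVlt antiB => /orP[/eqP um|um].
  have -> : u = v by apply: (@word_index_inj _ rk); rewrite // um vm.
  have idm (h : pol) : subst (merge j i) (subst (merge j i) h) = subst (merge j i) h.
    rewrite subst_comp; apply: eq_subst => y; rewrite /merge /=.
    by case: (eqVneq y j) => [_|/negbTE->]; rewrite ?(negbTE nij).
  rewrite [anti i j g v]/anti gv g0 // subr0 mulrC.
  have := congr1 (subst (merge j i)) ea.
  by rewrite rmorphM /= !idm [X in _ -> X - _ = _]/anti => ->; rewrite subrr.
have uv : wlt rk u v by rewrite -word_index_ltE // vm.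
rewrite fu // {1}/anti !g0 ?subrr ?rmorph0 ?mulr0 ?subr0 //.
by apply: (wlt_trans rk_inj _ uv); exact: wlt_swap.
Qed.

(** If (i, j) is an ascent of w, multiplication by x_i - x_j produces both the
    new condition and the new factor of the leading value. Otherwise the leading
    value does not change, and kill_anti supplies the new condition. *)
Lemma flow_up_add_corner w : exists f, flow_up add_corner w f.
Proof.
case: (ltnP (w i) (w j)) => [wij|wij].
  have [f [fM fw f0 fd]] := flowE w; exists (fun u => lin i j * f u); split.
  - move=> p q u /orP[Epq|/andP[/eqP-> /eqP->]].
      by rewrite -mulrBr; apply: divides_mull; exact: fM.
    by rewrite -mulrBr; exists (f u - f (swap i j u)).
  - rewrite fw /lead asc_add_corner_lt // big_setU1 //=.
    by rewrite inE /= (negbTE nEij).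
  - by move=> u uw; rewrite f0 // mulr0.
  - move=> u; rewrite asc_add_corner_lt // cardsU1 inE /= (negbTE nEij).
    by apply: deg_leM; [exact: deg_le_lin|exact: fd].
have [f [[fM fw f0 fd] fa]] := kill_anti #|word|.+1 wij.
have lt_card v : (word_index rk v < #|word|.+1)%N by rewrite ltnS max_card.
have anti0 u : anti i j f u = 0.
  case: (ltngtP (u i) (u j)) => [/fa->//|uji|/val_inj uij].
    by rewrite -[u](swapK i j) anti_swap fa ?oppr0 // swapL swapR.
  rewrite /anti (_ : swap i j u = u) ?subrr ?rmorph0 //.
  by apply/ffunP => y; rewrite ffunE; case: tpermP => [->|->|//]; rewrite ?uij.
exists f; split=> //; first exact: gkm_add_corner.
  by rewrite fw /lead asc_add_corner_le.
by rewrite asc_add_corner_le.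
Qed.
End AddCorner.

Lemma flow_up_ext E E' w f : E =2 E' -> flow_up E w f -> flow_up E' w f.
Proof.
move=> ee; have ea : asc E' w = asc E w by apply/setP => e; rewrite !inE ee.
move=> [fM fw f0 fd]; split; rewrite /lead ?ea //.
by move=> p q u; rewrite -ee; exact: fM.
Qed.

(** Induction on the number of pairs. Removing a longest pair (i, j) leaves a
    closed relation, because closedness only ever derives pairs that are shorter
    than a given one; and i and j remain joined to everything between them. *)
Theorem flow_up_exists E w : closed_rel rk E -> exists f, flow_up E w f.
Proof.
move: {2}#|[set e : P * P | E e.1 e.2]| (erefl #|[set e : P * P | E e.1 e.2]|) => m.
elim: m E w => [|m IH] E w.
  move=> /eqP; rewrite cards_eq0 => /eqP/setP E0 Ecl.
  have asc0 : asc E w = set0.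
    by apply/setP => e; rewrite !inE; have := E0 e; rewrite !inE => ->.
  exists (fun u => (u == w)%:R); split.
  - by move=> p q u Epq; have := E0 (p, q); rewrite !inE /= Epq.
  - by rewrite eqxx /lead asc0 big_set0.
  - by move=> u; case: eqP => [->|//]; rewrite wltxx.
  - by move=> u; case: (u == w); rewrite /deg_le ?mmeasure1 ?mmeasure0.
move=> Em [Erk Ebet].
have [e0 e0E] : exists e, e \in [set e : P * P | E e.1 e.2].
  by apply/set0Pn; rewrite -cards_eq0 Em.
pose len (e : P * P) := (rk e.2 - rk e.1)%N.
have [[i j] Eij maxe] : exists2 e : P * P, E e.1 e.2 & forall p q, E p q -> (len (p, q) <= len e)%N.
  rewrite inE in e0E.
  case: (@arg_maxnP _ e0 (fun e => E e.1 e.2) len e0E) => e ee emax; exists e => // p q Epq.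
  exact: (emax (p, q)).
rewrite /= in Eij; have ij := Erk _ _ Eij.
pose E' p q := E p q && ((p, q) != (i, j)).
have ee : add_corner E' i j =2 E.
  move=> p q; rewrite /add_corner /E' xpair_eqE.
  have [/andP[/eqP-> /eqP->]|_] := boolP ((p == i) && (q == j)); rewrite ?orbT //.
  by rewrite andbT orbF.
have short p q p' q' : E p q -> (rk p <= rk p')%N -> (rk q' <= rk q)%N ->
    (rk p < rk p')%N || (rk q' < rk q)%N -> (rk p' < rk q')%N -> (p', q') != (i, j).
  move=> Epq h1 h2 h3 h4; apply: contraTneq isT => -[e1 e2]; have := maxe _ _ Epq.
  rewrite /len /= -e1 -e2; move: h1 h2 h3 h4.
  by move: (rk p) (rk q) (rk p') (rk q') => a b c d; clear; lia.
have E'cl : closed_rel rk E'.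
  split=> [p q /andP[/Erk]//|p x q /andP[Epq _] px xq].
  have /andP[Epx Exq] := Ebet _ _ _ Epq px xq.
  have s1 : (p, x) != (i, j).
    by apply: (short _ _ _ _ Epq (leqnn _) (ltnW xq) _ px); rewrite xq orbT.
  have s2 : (x, q) != (i, j).
    by apply: (short _ _ _ _ Epq (ltnW px) (leqnn _) _ xq); rewrite px.
  by apply/andP; split; apply/andP.
have nE' : ~~ E' i j by rewrite /E' eqxx andbF.
have E'bet x : (rk i < rk x)%N -> (rk x < rk j)%N -> E' i x && E' x j.
  move=> ix xj; have /andP[Eix Exj] := Ebet _ _ _ Eij ix xj.
  have s1 : (i, x) != (i, j).
    by apply: (short _ _ _ _ Eij (leqnn _) (ltnW xj) _ ix); rewrite xj orbT.
  have s2 : (x, j) != (i, j).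
    by apply: (short _ _ _ _ Eij (ltnW ix) (leqnn _) _ xj); rewrite ix.
  by apply/andP; split; apply/andP.
have cE' : #|[set e : P * P | E' e.1 e.2]| = m.
  have := Em; rewrite (cardsD1 (i, j)) inE Eij => -[<-].
  by apply: eq_card => -[p q]; rewrite !inE /E' /= andbC.
have [f fF] := flow_up_add_corner E'cl nE' ij E'bet (fun v => IH E' v cE' E'cl) w.
by exists f; apply: flow_up_ext fF.
Qed.
End FlowUp.

(** * Antisymmetrizing over the columns *)

Section Columns.
Variables (P : finType) (rk : P -> nat) (E : rel P) (col : P -> nat).
Hypothesis rk_inj : injective rk.
Hypothesis Ecl : closed_rel rk E.
Hypothesis Ecol : forall p q, E p q -> col p != col q.
Local Notation pol := (mpoly #|P| algC).
Implicit Types (s t : {perm P}) (F : {perm P} -> pol) (p q x : P).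

Definition colpt p : algC := (col p)%:R.
Definition colperm s := [forall p, col (s p) == col p].
Definition colanti F s : algC :=
  \sum_(t | colperm t) (-1) ^+ t * evalp colpt (F (t * s)%g).

Lemma colpermP s : reflect (forall p, col (s p) = col p) (colperm s).
Proof. exact: 'forall_eqP. Qed.

Definition gkm_perm F := forall p q s, E p q -> divides (lin p q) (F s - F (tperm p q * s)%g).

(** The functions on permutations that come from degree at most k; their
    filtration by k carries the grading by ascents. *)
Definition level k (phi : {perm P} -> algC) :=
  exists F, [/\ gkm_perm F, forall s, deg_le k (F s) & forall s, phi s = colanti F s].

Lemma colantiB c F1 F2 s :
  colanti (fun s => F1 s - mpolyC _ c * F2 s) s = colanti F1 s - c * colanti F2 s.
Proof.
rewrite /colanti mulr_sumr -sumrB; apply: eq_bigr => t _.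
by rewrite rmorphB rmorphM /= evalpC mulrBr [X in _ - X]mulrCA.
Qed.

Lemma colanti_mul (g : pol) F s :
  colanti (fun s => g * F s) s = evalp colpt g * colanti F s.
Proof.
rewrite /colanti mulr_sumr; apply: eq_bigr => t _.
by rewrite rmorphM /= mulrCA.
Qed.

Lemma eq_colanti F1 F2 : F1 =1 F2 -> colanti F1 =1 colanti F2.
Proof. by move=> e s; apply: eq_bigr => t _; rewrite e. Qed.

Lemma level_lin k c phi psi : level k phi -> level k psi -> level k (fun s => phi s - c * psi s).
Proof.
move=> [F [FM Fd Fe]] [F' [FM' Fd' Fe']].
exists (fun s => F s - mpolyC _ c * F' s); split.
- move=> p q s Epq; have := divides_sub (FM _ _ s Epq) (divides_mull (mpolyC _ c) (FM' _ _ s Epq)).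
  by congr (divides _ _); ring.
- move=> s; apply: deg_leB => //; rewrite -[k]add0n; apply: deg_leM => //; exact: deg_leC.
- by move=> s; rewrite colantiB Fe Fe'.
Qed.

Lemma level0 k : level k (fun=> 0).
Proof.
exists (fun=> 0); split.
- by move=> p q s _; rewrite subrr; exists 0; rewrite mulr0.
- by move=> s; exact: deg_le0.
- by move=> s; rewrite /colanti big1 // => t _; rewrite rmorph0 mulr0.
Qed.

Lemma level_translate k phi t : level k phi -> level k (fun s => phi (s * t)%g).
Proof.
move=> [F [FM Fd Fe]]; exists (fun s => F (s * t)%g); split=> //.
  by move=> p q s Epq; have := FM _ _ (s * t)%g Epq; rewrite mulgA.
by move=> s; rewrite Fe; apply: eq_bigr => x _; rewrite mulgA.
Qed.

Lemma level_le k l phi : (k <= l)%N -> level k phi -> level l phi.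
Proof.
by move=> kl [F [FM Fd Fe]]; exists F; split=> // s; exact: deg_leW kl _.
Qed.

(** At a point with equal coordinates at i and j the values of F before and
    after the exchange agree, and the terms of the alternating sum cancel in
    pairs. *)
Lemma colanti_sym F i j s : i != j -> col i = col j ->
  (forall s, divides (lin i j) (F s - F (tperm i j * s)%g)) -> colanti F s = 0.
Proof.
move=> nij cij FM; apply/eqP; rewrite -eqNr; apply/eqP.
have cp t : colperm (tperm i j * t)%g = colperm t.
  apply/colpermP/colpermP => h p; last first.
    by rewrite permM h; case: tpermP => // ->.
  by have := h (tperm i j p); rewrite permM tpermK => ->; case: tpermP => // ->.
rewrite {2}/colanti (reindex_inj (mulgI (tperm i j))) /= (eq_bigl _ _ cp).
rewrite -sumrN; apply: eq_bigr => t _.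
rewrite odd_permM odd_tperm nij addTb signrN mulNr -mulgA; congr (- (_ * _)).
have [g /(congr1 (evalp colpt))] := FM (t * s)%g.
by rewrite rmorphB rmorphM /= evalp_lin /colpt cij subrr mul0r => /eqP; rewrite subr_eq0 => /eqP.
Qed.

Section Word.
Variables (r : nat) (b : {ffun P -> 'I_r}).
Local Notation word := {ffun P -> 'I_r}.
Implicit Types (u v w : word) (f : word -> pol).

Lemma swap_wact p q s : swap p q (wact b s) = wact b (tperm p q * s)%g.
Proof. by apply/ffunP => x; rewrite !ffunE permM. Qed.

Lemma in_class_swap p q w : in_class b (swap p q w) = in_class b w.
Proof.
apply/in_classP/in_classP => -[s e].
  by exists (tperm p q * s)%g; rewrite -swap_wact -e swapK.
by exists (tperm p q * s)%g; rewrite -swap_wact -e.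
Qed.

Definition strict w := [forall p, forall q, (col p == col q) && (rk p < rk q)%N ==> (w p < w q)%N].

Lemma strictP w : reflect (forall p q, col p = col q -> (rk p < rk q)%N -> (w p < w q)%N) (strict w).
Proof.
apply: (iffP forallP) => [h p q c l|h p].
  by have /forallP/(_ q)/implyP := h p; apply; rewrite c eqxx l.
by apply/forallP => q; apply/implyP => /andP[/eqP c l]; exact: h.
Qed.

Definition word_anti f s := colanti (f \o wact b) s.

Lemma gkm_wact f : gkm E f -> gkm_perm (f \o wact b).
Proof. by move=> fM p q s Epq /=; rewrite -swap_wact; exact: fM. Qed.

(** At the first cell p that t moves, the new letter comes from a later cell of
    the same column, so it is larger when w is strict. *)
Lemma strict_last w t s : strict w -> w = wact b s -> colperm t -> t != 1%g -> wlt rk (wact b (t * s)%g) w.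
Proof.
move=> /strictP ws ew /colpermP ct nt.
have [p0 np0] : exists p, t p != p.
  apply/existsP; apply: contraNT nt; rewrite negb_exists => /forallP h.
  by apply/eqP/permP => p; rewrite perm1; apply/eqP; have := h p; rewrite negbK.
case: (@arg_minnP _ p0 (fun p => t p != p) rk np0) => p np pmin.
have lpt : (rk p < rk (t p))%N.
  have ntt : t (t p) != t p by apply: contraNneq np => /perm_inj ->.
  rewrite ltn_neqAle pmin // andbT; apply: contraNneq np => e; exact/eqP/esym/rk_inj.
have e q : wact b (t * s)%g q = w (t q) by rewrite ew !ffunE permM.
apply/wltP; exists p; first by rewrite e; apply: ws.
move=> q qp; rewrite e; congr (w _); apply/eqP.
by apply: contraTT qp => /pmin; rewrite -leqNgt.
Qed.

Lemma evalp_lead w : evalp colpt (lead E w) != 0.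
Proof.
rewrite /lead rmorph_prod /=; apply/prodf_neq0 => -[p q]; rewrite inE /= => /andP[Epq _].
by rewrite evalp_lin subr_eq0 /colpt eqr_nat; exact: Ecol.
Qed.

(** By strict_last all terms of the alternating sum belong to words before w. *)
Lemma word_anti_lt w u f s : (forall v, wlt rk v w -> f v = 0) ->
  strict u -> wlt rk u w -> u = wact b s -> word_anti f s = 0.
Proof.
move=> f0 us uw es; rewrite /word_anti /colanti big1 // => t ct /=.
rewrite f0 ?rmorph0 ?mulr0 //; case: (eqVneq t 1%g) => [->|nt]; first by rewrite mul1g -es.
by apply: (wlt_trans rk_inj _ uw); exact: strict_last.
Qed.

(** By strict_last all terms but the one of the identity belong to words before
    w, and the leading value survives since attacking cells lie in different
    columns. *)
Lemma word_anti_eq w f s : flow_up rk E w f -> strict w -> w = wact b s ->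
  word_anti f s != 0.
Proof.
move=> [_ fw f0 _] ws es; rewrite /word_anti /colanti (bigD1 1%g) /=; last first.
  by apply/colpermP => p; rewrite perm1.
rewrite odd_perm1 expr0 mul1r mul1g -es fw big1 ?addr0 ?evalp_lead // => t /andP[ct nt].
by rewrite f0 ?rmorph0 ?mulr0 //; exact: strict_last.
Qed.

Section Basis.
Variable fl : word -> word -> pol.
Hypothesis flP : forall w, flow_up rk E w (fl w).

Lemma word_anti_free (c : word -> algC) :
  (forall w, c w != 0 -> in_class b w && strict w) ->
  (forall s, \sum_w c w * word_anti (fl w) s = 0) -> forall w, c w = 0.
Proof.
move=> cS c0 w0; apply/eqP; apply: contraT => n0.
case: (@arg_minnP _ w0 (fun w => c w != 0) (fun w => word_index rk w) n0) => w nw wmin.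
have /andP[/in_classP[s es] ws] := cS _ nw.
have := c0 s; rewrite (bigD1 w) //= big1 ?addr0.
  move=> /eqP; rewrite mulf_eq0 (negbTE nw) /=.
  by rewrite (negbTE (word_anti_eq (flP w) ws es)).
move=> v nv; case: (eqVneq (c v) 0) => [->|cv]; first by rewrite mul0r.
have [_ _ f0 _] := flP v.
rewrite (word_anti_lt f0 ws _ es) ?mulr0 // -(word_index_ltE rk_inj) ltn_neqAle wmin // andbT.
by apply: contraNneq nv => /(word_index_inj rk_inj) ->.
Qed.

Hypothesis corners : forall w, ~~ strict w -> exists i j,
  [/\ col i = col j, (rk i < rk j)%N, (w j <= w i)%N
    & forall x, (rk i < rk x)%N -> (rk x < rk j)%N -> E i x && E x j].

(** Take the class of w for the relation enlarged by a corner (i, j) of w inside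
    a column. Since (i, j) is not an ascent of w, the leading value is the same,
    and the condition for (i, j) makes the alternating sum vanish by
    colanti_sym. *)
Lemma nonstrict_flow w : ~~ strict w ->
  exists f, flow_up rk E w f /\ forall s, word_anti f s = 0.
Proof.
move=> /corners[i [j [cij ij wij Ebet]]].
have nEij : ~~ E i j by apply/negP => /Ecol; rewrite cij eqxx.
have nij : i != j by apply: contraTneq ij => ->; rewrite ltnn.
have [f [fM fw f0 fd]] :=
  flow_up_add_corner rk_inj Ecl nEij ij Ebet (fun v => flow_up_exists rk_inj v Ecl) w.
exists f; split; first split.
- by move=> p q u Epq; apply: fM; rewrite /add_corner Epq.
- by rewrite fw /lead asc_add_corner_le.
- exact: f0.
- by move=> u; have := fd u; rewrite asc_add_corner_le.
move=> s; rewrite /word_anti; apply: (colanti_sym _ nij cij) => t /=.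
by rewrite -swap_wact; apply: fM; rewrite /add_corner !eqxx orbT.
Qed.

(** Elimination along the order of words. The first nonzero value of f, at v, is
    a multiple of the leading value, so subtracting the quotient times a class
    at v moves the first nonzero value further; the evaluated quotient is the
    coefficient. When v is not strict the class of nonstrict_flow is used, which
    contributes nothing. By degree, only words with at most k ascents occur. *)
Lemma word_anti_span k f : gkm E f -> (forall w, deg_le k (f w)) ->
  (forall w, ~~ in_class b w -> f w = 0) ->
  exists2 c : word -> algC,
    forall w, c w != 0 -> [&& in_class b w, strict w & (#|asc E w| <= k)%N]
  & forall s, word_anti f s = \sum_w c w * word_anti (fl w) s.
Proof.
have [m] : exists m, forall w, (word_index rk w + m < #|word|)%N -> f w = 0.
  by exists #|word| => w; rewrite ltnNge leq_addl.
elim: m f => [|m IH] f fm fM fd fC.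
  have f0 w : f w = 0.
    apply: fm; rewrite addn0 -cardsT; apply: proper_card.
    by rewrite properT; apply: contraTneq isT => /setP/(_ w); rewrite !inE wltxx.
  exists (fun=> 0); first by move=> w; rewrite eqxx.
  move=> s; rewrite big1 => [|w _]; last by rewrite mul0r.
  by rewrite /word_anti /colanti big1 // => t _ /=; rewrite f0 rmorph0 mulr0.
have [/existsP[v /andP[/eqP vm nv]]|] :=
  boolP [exists v : word, ((word_index rk v + m.+1)%N == #|word|) && (f v != 0)].
  have [g [gF gs gn]] : exists g, [/\ flow_up rk E v g, strict v -> g = fl v
      & ~~ strict v -> forall s, word_anti g s = 0].
    case: (boolP (strict v)) => sv; first by exists (fl v).
    by have [g [gF g0]] := nonstrict_flow sv; exists g.
  have [gM gv g0 gd] := gF.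
  have f0 u : wlt rk u v -> f u = 0.
    by move=> uv; apply: fm; rewrite -vm ltn_add2r word_index_ltE.
  have vC : in_class b v by apply: contraNT nv => /fC ->.
  have [a ea] := gkm_lead_dvd Ecl fM f0.
  have := fd v; rewrite ea => /(deg_le_lead_div Ecl)[a0|[ka da]].
    by move: nv; rewrite ea a0 mulr0 eqxx.
  (* Restricting to the class of b respects the GKM condition, since exchanges
     preserve the class. *)
  pose g' u := if in_class b u then g u else 0.
  have [||||c' cS ce] := IH (fun u => f u - a * g' u).
  - move=> u um; rewrite /g'; case: (ltngtP (word_index rk u) (word_index rk v)) => [uv|uv|uv].
    + have uv' : wlt rk u v by rewrite -word_index_ltE.
      by rewrite f0 // g0 // if_same mulr0 subr0.
    + by move: um; rewrite -vm addnS ltnS leq_add2r leqNgt uv.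
    + have -> : u = v by apply: (word_index_inj rk_inj).
      by rewrite vC gv ea mulrC subrr.
  - move=> p q u Epq; have h1 := fM p q u Epq.
    have h2 : divides (lin p q) (g' u - g' (swap p q u)).
      rewrite /g' in_class_swap; case: (in_class b u); first exact: gM.
      by rewrite subrr; exists 0; rewrite mulr0.
    by have := divides_sub h1 (divides_mull a h2); congr (divides _ _); ring.
  - move=> u; apply: deg_leB => //; rewrite -(subnK ka); apply: deg_leM => //.
    by rewrite /g'; case: (in_class b u); [exact: gd|exact: deg_le0].
  - by move=> u nu; rewrite /g' (negbTE nu) fC // mulr0 subr0.
  have fe s : word_anti f s = word_anti (fun u => f u - a * g' u) s + evalp colpt a * word_anti g s.
    rewrite /word_anti -colanti_mul /colanti -big_split /=; apply: eq_bigr => t _.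
    rewrite -mulrDr -rmorphD /= /g' (_ : in_class b _) ?subrK //.
    by apply/in_classP; exists (t * s)%g.
  case: (boolP (strict v)) => sv; last first.
    by exists c' => // s; rewrite fe (gn sv) mulr0 addr0 ce.
  exists (fun w => c' w + (w == v)%:R * evalp colpt a).
    move=> w; case: (eqVneq w v) => [->|_]; first by rewrite vC sv ka.
    by rewrite mul0r addr0; exact: cS.
  move=> s; rewrite fe ce (gs sv).
  under [RHS]eq_bigr => w _ do rewrite mulrDl.
  rewrite big_split /=; congr (_ + _).
  rewrite (bigD1 v) //= eqxx mul1r big1 ?addr0 // => w /negbTE ->.
  by rewrite !mul0r.
rewrite negb_exists => /forallP h; apply: IH => // w.
rewrite -addnS leq_eqVlt => /orP[wm|/fm//].
by have := h w; rewrite wm /= negbK => /eqP.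
Qed.
End Basis.
End Word.
End Columns.

(** * Fixed vectors and permutation characters *)

Lemma mxtrace_idem (F : fieldType) n (e : 'M[F]_n) : e *m e = e -> \tr e = (\rank e)%:R.
Proof.
move=> ee; rewrite -{1}[e]mulmx_base mxtrace_mulC.
suff -> : row_base e *m col_base e = 1%:M by rewrite mxtrace1.
have /row_freeP[R rR] := row_base_free e.
have /row_fullP[L lL] := col_base_full e.
have h := ee; rewrite -{1 2 3}[e]mulmx_base in h.
move: (col_base e) (row_base e) L R lL rR h => A B L R lL rR /(congr1 (fun M => L *m M *m R)).
by rewrite !mulmxA lL !mul1mx -!mulmxA rR !mulmx1.
Qed.

(** A matrix of the largest rank among those with rows in S. *)
Lemma subspace_mx (F : fieldType) n (S : 'rV[F]_n -> Prop) :
  S 0 -> (forall c u v, S u -> S v -> S (u + c *: v)) ->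
  exists U : 'M[F]_n, forall v, (v <= U)%MS <-> S v.
Proof.
move=> S0 Slin.
have Ssub m (A : 'M_(m, n)) v : (forall i, S (row i A)) -> (v <= A)%MS -> S v.
  move=> SA /submxP[D ->]; rewrite mulmx_sum_row.
  by apply: (big_ind S) => [//|u w Su Sw|i _];
     [rewrite -[w]scale1r; exact: Slin | rewrite -[_ *: _]add0r; exact: Slin].
pose Q r := `[< exists A : 'M[F]_n, (forall i, S (row i A)) /\ \rank A = r >].
have Q0 : exists r, Q r.
  exists 0%N; apply/asboolP; exists 0; rewrite mxrank0; split=> // i.
  by rewrite row0.
have Qle r : Q r -> (r <= n)%N by move=> /asboolP[A [_ <-]]; exact: rank_leq_col.
case: (ex_maxnP Q0 Qle) => r /asboolP[A [SA rA]] rmax.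
exists A => v; split=> [|Sv]; first exact: Ssub.
apply/negPn/negP => nvA.
have SAv : forall i, S (row i (A + v)%MS).
  move=> i; have /sub_addsmxP[[D1 D2] -> /=] := row_sub i (A + v)%MS.
  have -> : D1 *m A + D2 *m v = D1 *m A + D2 0 0 *: v.
    by rewrite [D2]mx11_scalar mul_scalar_mx mxE eqxx.
  by apply: Slin => //; apply: (Ssub _ A) => //; exact: submxMl.
have := rmax (\rank (A + v)%MS); rewrite leqNgt -rA ltnNge.
have lt : (A < A + v)%MS.
  by rewrite /ltmx addsmxSl /= addsmx_sub submx_refl /= nvA.
have := rank_ltmx lt; rewrite ltnNge => /negbTE -> h.
by suff /h : Q (\rank (A + v)) by []; apply/asboolP; exists (A + v)%MS.
Qed.

Section FixedVectors.
Variables (gT : finGroupType) (G H : {group gT}).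
Hypothesis sHG : H \subset G.

(** By Frobenius reciprocity this is the mean value of the character on H, that
    is, the trace of the averaging projection onto the fixed vectors. *)
Lemma cfdot_fix n (rG : mx_representation algC G n) :
  '[cfRepr rG, 'Ind[G] (1 : 'CF(H))] = (\rank (rfix_mx rG H))%:R.
Proof.
rewrite -cfdot_Res_l cfdotE.
pose e : 'M[algC]_n := #|H|%:R^-1 *: \sum_(x in H) rG x.
have nH : #|H|%:R != 0 :> algC by exact: neq0CG.
have eJ x : x \in H -> e *m rG x = e.
  move=> Hx; rewrite /e -scalemxAl mulmx_suml; congr (_ *: _).
  rewrite [RHS](reindex_inj (mulIg x)) /=.
  apply: eq_big => [y|y Hy]; first by rewrite groupMr.
  by rewrite repr_mxM // (subsetP sHG).
have eF (v : 'rV_n) : (forall x, x \in H -> v *m rG x = v) -> v *m e = v.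
  move=> vF; rewrite /e -scalemxAr mulmx_sumr (eq_bigr (fun=> v)) //.
  by rewrite sumr_const -scaler_nat scalerA mulVf // scale1r.
have ee : e *m e = e.
  by apply/row_matrixP => i; rewrite row_mul eF // => x Hx; rewrite -row_mul eJ.
have efix : (e :=: rfix_mx rG H)%MS.
  apply/eqmxP/andP; split; first by apply/rfix_mxP.
  apply/row_subP => i; rewrite -[row i _]eF ?submxMl // => x Hx.
  by rewrite -row_mul rfix_mx_id.
rewrite -efix -(mxtrace_idem ee) /e mxtraceZ raddf_sum /=; congr (_ * _).
apply: eq_bigr => x Hx.
by rewrite cfResE // cfunE (subsetP sHG) // mulr1n cfun1E Hx conjC1 mulr1.
Qed.
End FixedVectors.

Section Perms.
Variable P : finType.
Let G := [set: {perm P}]%G.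
Local Notation N := #|G|.
Implicit Types (phi : {perm P} -> algC) (s t : {perm P}) (H : {group {perm P}}).

(** The permutation character on the rearrangements of b. *)
Definition hperm r (b : {ffun P -> 'I_r}) : 'CF(G) := 'Ind[G] (1 : 'CF(word_stab_group b)).

Definition fun_vec phi : 'rV[algC]_N := \row_i phi (enum_val i).

Lemma fun_vecE phi s : fun_vec phi 0 (gring_index G s) = phi s.
Proof. by rewrite mxE gring_indexK ?inE. Qed.

Lemma fun_vec_onto (v : 'rV[algC]_N) : fun_vec (fun s => v 0 (gring_index G s)) = v.
Proof. by apply/rowP => i; rewrite mxE gring_valK. Qed.

Lemma fun_vecJ phi t : fun_vec phi *m regular_repr algC G t = fun_vec (fun s => phi (s * t^-1)%g).
Proof.
apply/rowP => j; rewrite mxE [RHS]mxE (bigD1 (gring_index G (enum_val j * t^-1))%g) //=.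
rewrite big1 => [|i ni].
  by rewrite addr0 fun_vecE !mxE gring_indexK ?inE // mulgKV gring_valK !eqxx mulr1.
rewrite [X in _ * X](_ : _ = (j == gring_index G (enum_val i * t)%g)%:R); last first.
  by rewrite !mxE eqxx.
case: eqP => [ej|]; last by rewrite mulr0.
by move: ni; rewrite ej gring_indexK ?inE // mulgK gring_valK eqxx.
Qed.
End Perms.

(** * The characters of the degree filtration *)

Section Levels.
Variables (P : finType) (rk : P -> nat) (E : rel P) (col : P -> nat).
Hypothesis rk_inj : injective rk.
Hypothesis Ecl : closed_rel rk E.
Hypothesis Ecol : forall p q, E p q -> col p != col q.
Hypothesis corners : forall r (w : {ffun P -> 'I_r}), ~~ strict rk col w -> exists i j,
  [/\ col i = col j, (rk i < rk j)%N, (w j <= w i)%N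
    & forall x, (rk i < rk x)%N -> (rk x < rk j)%N -> E i x && E x j].
Local Notation pol := (mpoly #|P| algC).
Let G := [set: {perm P}]%G.
Local Notation N := #|G|.
Local Notation rG := (regular_repr algC G).

Section Word.
Variables (r : nat) (b : {ffun P -> 'I_r}).
Local Notation word := {ffun P -> 'I_r}.
Variable fl : word -> word -> pol.
Hypothesis flP : forall w, flow_up rk E w (fl w).
Local Notation H := (word_stab_group b).
Local Notation phi_ w := (word_anti col b (fl w)).

Definition level_words k := [set w : word | [&& in_class b w, strict rk col w & (#|asc E w| <= k)%N]].

(** Averaging over the stabilizer of b makes a GKM function on permutations s
    depend only on the word that s makes of b, and word_anti_span applies. *)
Lemma level_fixed_span k phi : level E col k phi ->
  (forall s t, t \in H -> phi (s * t)%g = phi s) ->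
  exists2 c : word -> algC, forall w, c w != 0 -> w \in level_words k
  & forall s, phi s = \sum_w c w * phi_ w s.
Proof.
move=> [F [FM Fd Fe]] phiH.
pose Fb s := \sum_(t in H) F (s * t)%g.
have FbH s t : t \in H -> Fb (s * t)%g = Fb s.
  move=> tH; rewrite /Fb [RHS](reindex_inj (mulgI t)) /=.
  by apply: eq_big => [x|x _]; rewrite ?mulgA // groupMl.
pose f w := if [pick s | w == wact b s] is Some s then Fb s else 0.
have fE s : f (wact b s) = Fb s.
  rewrite /f; case: pickP => [s' /eqP e|/(_ s)]; last by rewrite eqxx.
  have -> : s = (s' * (s'^-1 * s))%g by rewrite mulKVg.
  rewrite FbH //; apply/word_stabP => p; rewrite permM.
  by have /ffunP/(_ (s'^-1 p)%g) := e; rewrite !ffunE permKV.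
have f0 w : ~~ in_class b w -> f w = 0.
  rewrite /f; case: pickP => // s /eqP e /in_classP[]; by exists s.
have FbM : gkm_perm E Fb.
  move=> p q s Epq; rewrite /Fb -sumrB.
  apply: (big_ind (divides (lin p q))); first by exists 0; rewrite mulr0.
    by move=> x y; exact: divides_add.
  by move=> t _; rewrite -mulgA; exact: FM.
have [||//|c cS ce] := word_anti_span rk_inj Ecl Ecol (b := b) (fl := fl) flP (@corners r) (k := k) (f := f).
- move=> p q w Epq; case: (boolP (in_class b w)) => [/in_classP[s ->]|nw].
    by rewrite swap_wact !fE; exact: FbM.
  by rewrite !f0 ?in_class_swap // subrr; exists 0; rewrite mulr0.
- move=> w; rewrite /f; case: pickP => [s _|_]; last exact: deg_le0.
  by apply: deg_le_sum => t _; exact: Fd.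
have nH : #|H|%:R != 0 :> algC by exact: neq0CG.
exists (fun w => #|H|%:R^-1 * c w).
  move=> w; rewrite inE mulf_eq0 negb_or => /andP[_]; exact: cS.
move=> s; under eq_bigr => w _ do rewrite -mulrA.
rewrite -mulr_sumr -ce /word_anti.
apply: (mulfI nH); rewrite mulrA mulfV // mul1r.
rewrite (@eq_colanti _ _ _ Fb); last by move=> t /=; rewrite fE.
transitivity (\sum_(t in H) phi (s * t)%g).
  by rewrite (eq_bigr (fun=> phi s)) => [|t /phiH //]; rewrite sumr_const mulr_natl.
rewrite /colanti /Fb.
under [RHS]eq_bigr => x _ do rewrite rmorph_sum /= mulr_sumr.
rewrite exchange_big /=; apply: eq_bigr => t _.
by rewrite Fe /colanti; apply: eq_bigr => x _; rewrite mulgA.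
Qed.

(** By level_fixed_span and word_anti_free the antisymmetrized classes of the
    words in level_words form a basis. *)
Lemma rank_level_fixed k (U : 'M[algC]_N) :
  (forall v : 'rV_N, (v <= U)%MS <-> level E col k (fun s => v 0 (gring_index G s))) ->
  \rank (U :&: rfix_mx rG H)%MS = #|level_words k|.
Proof.
move=> UP.
pose B : 'M[algC]_(#|level_words k|, N) := \matrix_(i, j) fun_vec (phi_ (enum_val i)) 0 j.
have rowB i : row i B = fun_vec (phi_ (enum_val i)).
  by apply/rowP => j; rewrite [LHS]mxE [LHS]mxE.
have vecL (phi : {perm P} -> algC) : level E col k phi -> (fun_vec phi <= U)%MS.
  move=> [F [FM Fd Fe]]; apply/UP; exists F; split=> // s; by rewrite fun_vecE.
have mulB (v : 'rV_#|level_words k|) :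
    v *m B = fun_vec (fun s => \sum_i v 0 i * phi_ (enum_val i) s).
  by apply/rowP => j; rewrite !mxE; apply: eq_bigr => i _; rewrite !mxE.
have memS (i : 'I_#|level_words k|) :
    [&& in_class b (enum_val i), strict rk col (enum_val i) & (#|asc E (enum_val i)| <= k)%N].
  by have := enum_valP i; rewrite inE.
suff /eqmxP -> : (U :&: rfix_mx rG H == B)%MS.
  apply/eqP; rewrite -/(row_free B) -kermx_eq0; apply/rowV0P => v /sub_kermxP vB.
  pose c w : algC := \sum_(i | enum_val i == w) v 0 i.
  have c0 : forall w, c w = 0.
    refine (@word_anti_free _ _ _ _ rk_inj Ecol _ b fl flP c _ _) => [w nw|s].
      have [i /eqP <-|no] := pickP (fun i : 'I_#|level_words k| => enum_val i == w).
        by have /and3P[-> ->] := memS i.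
      by move: nw; rewrite /c big_pred0 ?eqxx.
    have := congr1 (fun M : 'rV_N => M 0 (gring_index G s)) vB.
    rewrite mulB fun_vecE mxE => e0; rewrite -[RHS]e0.
    under eq_bigr => w _ do rewrite /c mulr_suml.
    rewrite (exchange_big_dep predT) //=; apply: eq_bigr => i _.
    by rewrite (big_pred1 (enum_val i)) // => w; rewrite eq_sym.
  apply/rowP => i; rewrite [RHS]mxE -(c0 (enum_val i)) /c (big_pred1 i) // => j.
  by rewrite /= (inj_eq enum_val_inj).
apply/andP; split; apply/row_subP => i.
  have : (row i (U :&: rfix_mx rG H) <= U :&: rfix_mx rG H)%MS by exact: row_sub.
  rewrite sub_capmx; move: (row i _) => v /andP[vU vF].
  have vH s t : t \in H -> v 0 (gring_index G (s * t)%g) = v 0 (gring_index G s).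
    move=> tH; have := elimT (rfix_mxP _) vF t^-1%g (groupVr tH).
    rewrite -{1}(fun_vec_onto v) fun_vecJ invgK => /(congr1 (fun M : 'rV_N => M 0 (gring_index G s))).
    by rewrite fun_vecE.
  have [c cS ce] := level_fixed_span ((UP v).1 vU) vH.
  rewrite -(fun_vec_onto v); apply/submxP; exists (\row_i c (enum_val i)); rewrite mulB.
  congr fun_vec; apply/funext => s; rewrite ce.
  rewrite (bigID (mem (level_words k))) /= [X in _ + X]big1 ?addr0; last first.
    by move=> w nw; case: (eqVneq (c w) 0) => [->|/cS]; rewrite ?mul0r // (negbTE nw).
  by rewrite big_enum_val /=; apply: eq_bigr => j _; rewrite mxE.
rewrite rowB sub_capmx; have /and3P[wC wS wk] := memS i.
have [wM _ _ wd] := flP (enum_val i).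
apply/andP; split.
  apply: vecL; exists (fl (enum_val i) \o wact b); split=> //; first exact: gkm_wact.
  by move=> s /=; exact: (deg_leW wk (wd _)).
apply/rfix_mxP => t tH; rewrite fun_vecJ; congr fun_vec; apply/funext => s.
rewrite /word_anti /colanti; apply: eq_bigr => x _ /=; congr (_ * evalp _ (fl _ _)).
apply/ffunP => p; rewrite !ffunE mulgA permM.
by have /word_stabP -> := groupVr tH.
Qed.
End Word.

Lemma level_module k (U : 'M[algC]_N) :
  (forall v : 'rV_N, (v <= U)%MS <-> level E col k (fun s => v 0 (gring_index G s))) ->
  mxmodule rG U.
Proof.
move=> UP; apply/mxmoduleP => t _; apply/row_subP => i.
rewrite row_mul; move: (row_sub i U); move: (row i U) => v /UP vL.
apply/UP; rewrite -(fun_vec_onto v) fun_vecJ.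
have := level_translate t^-1 vL; congr (level _ _ _ _); apply/funext => s.
by rewrite fun_vecE.
Qed.

(** The levels are increasing submodules of the regular representation, and
    complete reducibility makes the differences characters. *)
Theorem level_characters : exists chi : nat -> 'CF(G),
  [/\ forall k, chi k \is a character, forall k, chi k.+1 - chi k \is a character
    & forall k r (b : {ffun P -> 'I_r}),
        '[chi k, hperm b] = #|level_words b k|%:R].
Proof.
have /choice[U UP] : forall k, exists U : 'M[algC]_N,
    forall v : 'rV_N, (v <= U)%MS <-> level E col k (fun s => v 0 (gring_index G s)).
  move=> k; apply: (subspace_mx (S := fun v => level E col k (fun s => v 0 (gring_index G s)))).
    have := level0 E col k; congr (level _ _ _ _); apply/funext => s; by rewrite mxE.
  move=> c u v uL vL; have := level_lin (- c) uL vL.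
  by congr (level _ _ _ _); apply/funext => s; rewrite !mxE mulNr opprK.
have modU k := level_module (UP k).
pose chi k := cfRepr (submod_repr (modU k)).
exists chi; split=> [k|k|k r b]; first exact: cfRepr_char.
  have sU : (U k <= U k.+1)%MS.
    apply/row_subP => i; move: (row_sub i (U k)); move: (row i (U k)) => v /UP vL.
    by apply/UP; exact: level_le vL.
  have [|W modW defW dxW] := mx_reducibleS (modU k.+1) (submx1 _) _ (modU k) sU.
    by apply: mx_Maschke_pchar; exact: algC'G_pchar.
  suff -> : chi k.+1 - chi k = cfRepr (submod_repr modW) by exact: cfRepr_char.
  apply/eqP; rewrite subr_eq eq_sym; apply/eqP/cfun_inP => x Gx.
  rewrite cfunE addrC ![cfRepr _ _]cfunE Gx !mulr1n.
  exact: (mxtrace_dadd_mod (modU k) modW (modU k.+1) defW dxW).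
have [fl flP] := choice (fun w : {ffun P -> 'I_r} => flow_up_exists rk_inj w Ecl).
rewrite /chi /hperm cfdot_fix ?subsetT // rfix_submod ?subsetT // mxrank_in_submod ?capmxSl //.
by rewrite (rank_level_fixed b flP (UP k)).
Qed.
End Levels.

(** * Shapes and horizontal strips *)

Local Open Scope nat_scope.

Section Shapes.
Variable n : nat.

(** Weakly decreasing rows are not imposed: a shape obtained from another one by
    adding a horizontal strip has them. Row lengths are bounded by n, so that
    shapes form a finite type. *)
Definition shape := {ffun 'I_n.+1 -> 'I_n.+1}.
Implicit Types (y z la mu nu rho kap : shape) (f g : nat -> nat).

Definition rowlen y i : nat := if insub i is Some j then y j else 0.
Definition shape_size y := \sum_(i < n.+1) rowlen y i.
Definition hstrip y z := [forall i : 'I_n.+1, (rowlen y i <= rowlen z i) && (rowlen z i.+1 <= rowlen y i)].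
Definition shape_of f : shape := [ffun i : 'I_n.+1 => inord (f i)].

Lemma rowlen_ord y (i : 'I_n.+1) : rowlen y i = y i.
Proof. by rewrite /rowlen valK. Qed.

Lemma rowlen_big y i : n < i -> rowlen y i = 0.
Proof. by move=> ni; rewrite /rowlen insubF // ltnS leqNgt ni. Qed.

Lemma rowlen_le y i : rowlen y i <= n.
Proof. by rewrite /rowlen; case: insubP => // j _ _; rewrite -ltnS. Qed.

Lemma rowlen_mk f i : i <= n -> f i <= n -> rowlen (shape_of f) i = f i.
Proof. by move=> ni fi; rewrite /rowlen insubT /= ffunE inordK. Qed.

Lemma rowlen_inj y z : (forall i, i <= n -> rowlen y i = rowlen z i) -> y = z.
Proof. by move=> e; apply/ffunP => i; apply: val_inj; have := e i (leq_ord i); rewrite !rowlen_ord. Qed.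

Lemma hstripP y z : reflect (forall i, rowlen y i <= rowlen z i /\ rowlen z i.+1 <= rowlen y i) (hstrip y z).
Proof.
apply: (iffP forallP) => [h i|h i]; last by have [-> ->] := h i.
case: (leqP i n) => [ni|ni]; last by rewrite !rowlen_big // ltnW.
by have /andP[] := h (Ordinal (ni : i < n.+1)).
Qed.

Lemma hstrip_top y z : hstrip y z -> shape_size z <= n -> rowlen z n = 0.
Proof.
move=> /hstripP h zn; apply/eqP; rewrite -leqn0 leqNgt; apply/negP => zn0.
have dec i : i <= n -> rowlen z n <= rowlen z (n - i).
  elim: i => [|i IH] ni; first by rewrite subn0.
  apply: leq_trans (IH (ltnW ni)) _; have [h1 h2] := h (n - i.+1).
  by move: h2; rewrite subnSK // => h2; exact: leq_trans h2 h1.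
have : n.+1 <= shape_size z.
  rewrite -{1}[n.+1]card_ord -sum1_card; apply: leq_sum => i _.
  by rewrite -(subKn (leq_ord i)); apply: leq_trans zn0 (dec _ (leq_subr _ _)).
by rewrite leqNgt ltnS zn.
Qed.

Lemma hstrip_size y z : hstrip y z -> shape_size y <= shape_size z.
Proof. by move=> /hstripP h; apply: leq_sum => i _; case: (h i). Qed.

Lemma shape_size_recl y : shape_size y = rowlen y 0 + \sum_(i < n) rowlen y i.+1.
Proof. by rewrite /shape_size big_ord_recl. Qed.

Lemma shape_size_recr y : shape_size y = \sum_(i < n) rowlen y i + rowlen y n.
Proof. by rewrite /shape_size big_ord_recr. Qed.

Section LocalRule.
Variables (la rho : shape) (m : nat).
Let lo i := maxn (rowlen la i.+1) (rowlen rho i.+1).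
Let hi i := minn (rowlen la i) (rowlen rho i).
Hypotheses (mn : m <= n) (lam : shape_size la <= m) (rhom : shape_size rho <= m).

Lemma sum_lohi : rowlen la n = 0 -> rowlen rho n = 0 ->
  \sum_(i < n) (lo i + hi i) + maxn (rowlen la 0) (rowlen rho 0) = shape_size la + shape_size rho.
Proof.
move=> la0 rho0.
have -> : shape_size la + shape_size rho = \sum_(i < n.+1) (maxn (rowlen la i) (rowlen rho i) + hi i).
  by rewrite -big_split /=; apply: eq_bigr => i _; rewrite /hi; lia.
have e1 : \sum_(i < n.+1) maxn (rowlen la i) (rowlen rho i) =
    maxn (rowlen la 0) (rowlen rho 0) + \sum_(i < n) lo i by rewrite big_ord_recl.
have e2 : \sum_(i < n.+1) hi i = \sum_(i < n) hi i.
  by rewrite big_ord_recr /= {2}/hi la0 min0n addn0.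
by rewrite !big_split /= e1 e2 addnC addnA.
Qed.

Definition above := [set nu | [&& hstrip la nu, hstrip rho nu & shape_size nu == m]].
Definition below := [set kap | [&& hstrip kap la, hstrip kap rho & shape_size la + shape_size rho <= m + shape_size kap]].

(** A shape nu above la and rho has row i + 1 between lo i and hi i, and so does
    row i of a shape below both. Reflecting this row in the interval from lo i
    to hi i is a bijection; the first row of nu, which is not reflected, is
    determined by the size m. *)
Lemma above_le_below : #|above| <= #|below|.
Proof.
pose F nu := shape_of (fun i => lo i + hi i - rowlen nu i.+1).
have FE nu i : nu \in above -> rowlen (F nu) i = lo i + hi i - rowlen nu i.+1
      /\ lo i <= rowlen nu i.+1 <= hi i.
  rewrite inE => /and3P[/hstripP h1 /hstripP h2 /eqP nm].
  have [a1 b1] := h1 i; have [a2 b2] := h2 i; have [a3 b3] := h1 i.+1; have [a4 b4] := h2 i.+1.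
  have ineq : lo i <= rowlen nu i.+1 <= hi i.
    by rewrite /lo /hi geq_max leq_min a3 a4 b1 b2.
  split=> //; case: (leqP i n) => ni.
    rewrite rowlen_mk //; apply: leq_trans (rowlen_le la i).
    by move: ineq; rewrite /hi => /andP[]; lia.
  by rewrite rowlen_big // /lo /hi !(rowlen_big _ ni) !(rowlen_big _ (ltnW _)).
rewrite -(card_in_imset (f := F)); last first.
  move=> nu nu' nuA nuA' e.
  have eS i : rowlen nu i.+1 = rowlen nu' i.+1.
    have [e1 i1] := FE nu i nuA; have [e2 i2] := FE nu' i nuA'.
    by move: e1 e2 i1 i2; rewrite e; lia.
  have e0 : rowlen nu 0 = rowlen nu' 0.
    move: nuA nuA'; rewrite !inE => /and3P[_ _ /eqP s1] /and3P[_ _ /eqP s2].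
    move: s1 s2; rewrite !shape_size_recl => <- /eqP.
    by rewrite (eq_bigr _ (fun (i : 'I_n) _ => eS i)) eqn_add2r => /eqP.
  by apply: rowlen_inj => -[|i] _.
apply/subset_leq_card/subsetP => _ /imsetP[nu nuA ->].
have := nuA; rewrite inE => /and3P[hla hrho /eqP nm].
have nu_n : shape_size nu <= n by rewrite nm.
have la0 : rowlen la n = 0.
  by apply/eqP; rewrite -leqn0 -(hstrip_top hla nu_n); have /hstripP/(_ n)[] := hla.
have rho0 : rowlen rho n = 0.
  by apply/eqP; rewrite -leqn0 -(hstrip_top hrho nu_n); have /hstripP/(_ n)[] := hrho.
rewrite inE; apply/and3P; split.
- apply/hstripP => i; have [-> /andP[]] := FE nu i nuA; rewrite /lo /hi; lia.
- apply/hstripP => i; have [-> /andP[]] := FE nu i nuA; rewrite /lo /hi; lia.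
have sF : shape_size (F nu) + \sum_(i < n) rowlen nu i.+1 = \sum_(i < n) (lo i + hi i).
  rewrite shape_size_recr (_ : rowlen (F nu) n = 0) ?addn0.
    rewrite -big_split /=; apply: eq_bigr => i _.
    by have [-> /andP[]] := FE nu i nuA; lia.
  by have [-> _] := FE nu n nuA; rewrite /lo /hi la0 rho0 !rowlen_big.
have := sum_lohi la0 rho0; have := nm; rewrite shape_size_recl -sF.
have : maxn (rowlen la 0) (rowlen rho 0) <= rowlen nu 0.
  by rewrite geq_max; have /hstripP/(_ 0)[-> _] := hla; have /hstripP/(_ 0)[-> _] := hrho.
lia.
Qed.

(** The same reflection read backwards, with the first row chosen so as to give
    size m. *)
Lemma below_le_above : #|below| <= #|above|.
Proof.
pose s kap := \sum_(i < n) (lo i + hi i - rowlen kap i).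
pose F kap := shape_of (fun i => if i is j.+1 then lo j + hi j - rowlen kap j else m - s kap).
have FS kap i : kap \in below -> i < n -> rowlen (F kap) i.+1 = lo i + hi i - rowlen kap i.
  rewrite inE => /and3P[/hstripP h1 /hstripP h2 _] ni; rewrite rowlen_mk //.
  have [a1 b1] := h1 i; have [a2 b2] := h2 i.
  by apply: leq_trans (rowlen_le la i); rewrite /lo /hi; lia.
have F0 kap : rowlen (F kap) 0 = m - s kap.
  by rewrite rowlen_mk // (leq_trans (leq_subr _ _)).
have top kap : kap \in below -> [/\ rowlen la n = 0, rowlen rho n = 0 & rowlen kap n = 0].
  rewrite inE => /and3P[h1 h2 _].
  have l0 := hstrip_top h1 (leq_trans lam mn); have r0 := hstrip_top h2 (leq_trans rhom mn).
  split=> //; apply/eqP; rewrite -leqn0 -l0; by have /hstripP/(_ n)[] := h1.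
have sE kap : kap \in below -> s kap + maxn (rowlen la 0) (rowlen rho 0) <= m.
  move=> kB; have [l0 r0 k0] := top _ kB; have := kB; rewrite inE => /and3P[/hstripP h1 /hstripP h2 h3].
  have : s kap + shape_size kap = \sum_(i < n) (lo i + hi i).
    rewrite shape_size_recr k0 addn0 -big_split /=; apply: eq_bigr => i _.
    have [a1 b1] := h1 i; have [a2 b2] := h2 i; rewrite /lo /hi; lia.
  have := sum_lohi l0 r0; lia.
rewrite -(card_in_imset (f := F)); last first.
  move=> kap kap' kB kB' e; apply: rowlen_inj => i; rewrite leq_eqVlt => /orP[/eqP->|ni].
    by have [_ _ ->] := top _ kB; have [_ _ ->] := top _ kB'.
  have := FS _ _ kB ni; have := FS _ _ kB' ni; rewrite e => ->.
  move: kB kB'; rewrite !inE => /and3P[/hstripP/(_ i)[a1 b1] /hstripP/(_ i)[a2 b2] _].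
  move=> /and3P[/hstripP/(_ i)[a3 b3] /hstripP/(_ i)[a4 b4] _]; rewrite /lo /hi; lia.
apply/subset_leq_card/subsetP => _ /imsetP[kap kB ->].
have [l0 r0 k0] := top _ kB; have sm := sE _ kB.
have := kB; rewrite inE => /and3P[/hstripP h1 /hstripP h2 _].
have FSS i : rowlen (F kap) i.+1 = lo i + hi i - rowlen kap i.
  case: (ltnP i n) => ni; first exact: FS.
  rewrite rowlen_big ?ltnS // /lo /hi !(rowlen_big _ (_ : n < i.+1)) ?ltnS //.
  move: ni; rewrite leq_eqVlt => /orP[/eqP<-|ni]; first by rewrite l0 r0.
  by rewrite !(rowlen_big _ ni).
rewrite inE; apply/and3P; split.
- apply/hstripP => i; have [a1 b1] := h1 i; have [a2 b2] := h2 i; split; last by rewrite FSS /lo /hi; lia.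
  case: i a1 b1 a2 b2 => [|i] a1 b1 a2 b2; first by rewrite F0; lia.
  by have [a3 b3] := h1 i; have [a4 b4] := h2 i; rewrite FSS /lo /hi; lia.
- apply/hstripP => i; have [a1 b1] := h1 i; have [a2 b2] := h2 i; split; last by rewrite FSS /lo /hi; lia.
  case: i a1 b1 a2 b2 => [|i] a1 b1 a2 b2; first by rewrite F0; lia.
  by have [a3 b3] := h1 i; have [a4 b4] := h2 i; rewrite FSS /lo /hi; lia.
rewrite shape_size_recl F0 (eq_bigr _ (fun (i : 'I_n) _ => FSS i)) -/(s kap); lia.
Qed.

(** The local rule of Fomin, in the form that counts. *)
Lemma local_rule : #|above| = #|below|.
Proof. by apply/eqP; rewrite eqn_leq above_le_below below_le_above. Qed.
End LocalRule.
End Shapes.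

(** * Counting matrices by pairs of tableaux *)

(** What may remain of the row sums a of a matrix when a column of sum y is
    removed. *)
Fixpoint removals (a : seq nat) (y : nat) : seq (seq nat) :=
  if a is x :: a' then
    flatten [seq [seq (x - m) :: c | c <- removals a' (y - m)] | m <- iota 0 (minn x y).+1]
  else if y == 0 then [:: [::]] else [::].

(** The number of matrices of natural numbers with row sums a and column sums b,
    by removing the columns one at a time. *)
Fixpoint matrices (a b : seq nat) : nat :=
  if b is y :: b' then \sum_(c <- removals a y) matrices c b' else sumn a == 0.

Lemma sum_removals (a : seq nat) x y (f : seq nat -> nat) :
  \sum_(c <- removals (x :: a) y) f c =
  \sum_(m < (minn x y).+1) \sum_(c <- removals a (y - m)) f ((x - m) :: c).
Proof.
have -> : removals (x :: a) y =
  flatten [seq [seq (x - m) :: c | c <- removals a (y - m)] | m <- index_iota 0 (minn x y).+1] by [].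
by rewrite big_flatten big_map big_mkord; apply: eq_bigr => m _; rewrite big_map.
Qed.

Lemma removals_sumn a y c : c \in removals a y -> sumn c + y = sumn a.
Proof.
elim: a y c => [|x a IH] y c; first by case: y => //=; rewrite inE => /eqP ->.
move=> /flatten_mapP[m]; rewrite mem_iota /= ltnS leq_min => /andP[mx my] /mapP[c' /IH e ->] /=.
by rewrite -e; lia.
Qed.

Section RSK.
Variable n : nat.
Implicit Types (la mu nu rho kap : shape n) (a b c : seq nat).

(** The Kostka number of mu and the content a, listed from the largest letter:
    the cells of a semistandard tableau containing the largest letter form a
    horizontal strip, and so on downwards. *)
Fixpoint kostka a mu : nat :=
  if a is x :: a' then \sum_(la | hstrip la mu && (shape_size mu == shape_size la + x)) kostka a' la
  else shape_size mu == 0.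

Lemma kostka_size a mu : kostka a mu != 0 -> shape_size mu = sumn a.
Proof.
elim: a mu => [|x a IH] mu /=; first by rewrite eqb0 negbK => /eqP.
rewrite sum_nat_eq0 negb_forall => /existsP[la].
rewrite negb_imply => /andP[/andP[_ /eqP ->] /IH ->]; exact: addnC.
Qed.

Lemma size0_rowlen mu : shape_size mu = 0 -> forall i, rowlen mu i = 0.
Proof.
move=> /eqP; rewrite sum_nat_eq0 => /forallP h i; case: (leqP i n) => ni; last exact: rowlen_big.
by have /eqP := h (Ordinal (ni : i < n.+1)).
Qed.

Lemma size0_eq mu nu : shape_size mu = 0 -> shape_size nu = 0 -> mu = nu.
Proof. by move=> h1 h2; apply: rowlen_inj => i _; rewrite !size0_rowlen. Qed.

Lemma size_shape_of0 : shape_size (shape_of n (fun=> 0)) = 0.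
Proof. by rewrite /shape_size big1 // => i _; rewrite rowlen_mk // -ltnS. Qed.

Lemma strip_add_remove_nil (y : nat) rho :
  \sum_(nu | hstrip rho nu && (shape_size nu == shape_size rho + y)) kostka [::] nu = \sum_(c <- removals [::] y) kostka c rho.
Proof.
case: (eqVneq (shape_size rho + y) 0) => [/eqP|n0].
  rewrite addn_eq0 => /andP[/eqP r0 /eqP ->] /=.
  rewrite big_seq1 /= r0 eqxx (big_pred1 rho) ?r0 // => nu /=.
  apply/andP/eqP => [[_ /eqP h]|->]; first by apply: size0_eq; rewrite // h.
  by split; [apply/hstripP => i; rewrite !size0_rowlen | rewrite ?r0 ?addn0].
rewrite big1 => [|nu /andP[_ /eqP h]].
  case: y n0 => [|y] /=; last by rewrite big_nil.
  by rewrite addn0 big_seq1 /= => /negbTE ->.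
by rewrite /= h (negbTE n0).
Qed.

(** Adding a strip of size x and then removing one of size y amounts to removing
    and then adding, with both sizes lowered by the same m: this is local_rule
    sorted by the size of the lower shape. *)
Lemma strip_exchange x y (la rho : shape n) : shape_size la + x <= n ->
  #|[set nu | hstrip rho nu && (shape_size nu == shape_size rho + y) & hstrip la nu && (shape_size nu == shape_size la + x)]| =
  \sum_(m < (minn x y).+1)
     #|[set kap | hstrip kap rho && (shape_size rho == shape_size kap + (x - m)) & hstrip kap la && (shape_size la == shape_size kap + (y - m))]|.
Proof.
move=> ln; case: (eqVneq (shape_size rho + y) (shape_size la + x)) => [e|ne]; last first.
  rewrite big1 => [|m _].
    apply/eqP; rewrite cards_eq0; apply/eqP/setP => nu; rewrite !inE.
    by apply/negP => /andP[/andP[_ /eqP ->] /andP[_ /eqP]] /eqP; rewrite (negbTE ne).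
  apply/eqP; rewrite cards_eq0; apply/eqP/setP => kap; rewrite !inE.
  apply/negP => /andP[/andP[_ /eqP h1] /andP[_ /eqP h2]]; move/eqP: ne; apply.
  have := leq_ord m; rewrite leq_min; lia.
transitivity #|above la rho (shape_size la + x)|.
  apply: eq_card => nu; rewrite !inE e; case: (hstrip rho nu); rewrite ?andbF //=.
  by case: (shape_size nu == _); rewrite ?andbF //= andbT.
rewrite local_rule ?leq_addr //; last by rewrite -e leq_addr.
under [RHS]eq_bigr => m _ do rewrite -sum1dep_card big_mkcond.
rewrite -sum1dep_card exchange_big [LHS]big_mkcond /=; apply: eq_bigr => kap _.
rewrite -big_mkcond sum1dep_card.
case: (boolP (hstrip kap la)) => hla /=; last first.
  by rewrite eq_card0 // => m; rewrite !inE ?andbF.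
case: (boolP (hstrip kap rho)) => hrho /=; last first.
  by rewrite eq_card0 // => m; rewrite !inE.
have s1 := hstrip_size hla; have s2 := hstrip_size hrho.
case: leqP => le; last first.
  rewrite eq_card0 // => m; rewrite !inE ?hla ?hrho /=.
  apply/negP => /andP[/eqP h1 /eqP h2]; have := leq_ord m; rewrite leq_min; lia.
have m0P : shape_size kap + x - shape_size rho < (minn x y).+1 by rewrite ltnS leq_min; lia.
rewrite -(card1 (Ordinal m0P)); apply/esym; apply: eq_card => m; rewrite !inE ?hla ?hrho /=.
apply/andP/eqP => [[/eqP h1 /eqP h2]|->] /=.
  by apply: val_inj => /=; have := leq_ord m; rewrite leq_min; lia.
split; apply/eqP; lia.
Qed.

(** Commutes the removal of a strip past all the additions that a tableau of
    content a consists of. *)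
Lemma strip_add_remove a y rho : sumn a <= n ->
  \sum_(nu | hstrip rho nu && (shape_size nu == shape_size rho + y)) kostka a nu = \sum_(c <- removals a y) kostka c rho.
Proof.
elim: a y rho => [|x a IH] y rho an; first exact: strip_add_remove_nil.
have {}IH z rh := IH z rh (leq_trans (leq_addl _ _) an).
rewrite sum_removals.
transitivity (\sum_la kostka a la * #|[set nu | hstrip rho nu && (shape_size nu == shape_size rho + y)
     & hstrip la nu && (shape_size nu == shape_size la + x)]|).
  rewrite [LHS]/=.
  under eq_bigr => nu _ do rewrite big_mkcond.
  rewrite exchange_big; apply: eq_bigr => la _.
  rewrite -big_mkcondr sum_nat_const mulnC; congr (_ * _).
  by apply: eq_card => nu; rewrite !inE.
transitivity (\sum_(m < (minn x y).+1) \sum_(kap | hstrip kap rho && (shape_size rho == shape_size kap + (x - m)))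
    \sum_(la | hstrip kap la && (shape_size la == shape_size kap + (y - m))) kostka a la); last first.
  apply: eq_bigr => m _; rewrite [RHS]exchange_big /=.
  by apply: eq_bigr => kap _; rewrite IH.
under [RHS]eq_bigr => m _ do (under eq_bigr => kap _ do rewrite big_mkcond).
under [RHS]eq_bigr => m _ do rewrite exchange_big.
rewrite [RHS]exchange_big; apply: eq_bigr => la _.
case: (eqVneq (kostka a la) 0) => [k0|/kostka_size la_a].
  rewrite k0 mul0n big1 // => m _; rewrite big1 // => kap _; by case: ifP => // _; exact: k0.
rewrite strip_exchange; last by rewrite la_a addnC; exact: an.
rewrite big_distrr /=; apply: eq_bigr => m _.
rewrite -big_mkcondr sum_nat_const mulnC; congr (_ * _).
by apply: eq_card => nu; rewrite !inE.
Qed.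

Lemma kostka_empty a mu : shape_size mu = 0 -> kostka a mu = (sumn a == 0).
Proof.
move=> m0; elim: a => [|x a IH] /=; first by rewrite m0.
case: x => [|x] /=.
  rewrite (big_pred1 mu) // => la /=; rewrite m0 addn0.
  apply/andP/eqP => [[_ /eqP h]|->]; first by apply: size0_eq; rewrite -?h.
  by split; [apply/hstripP => i; rewrite !size0_rowlen | rewrite ?m0].
by rewrite big1 // => la /andP[_]; rewrite m0 addnS.
Qed.

(** Each y in b removes a strip of that size; commuting it past the tableau of
    content a removes a column of sum y from a matrix with row sums a. *)
Theorem rsk_count a b : sumn a <= n -> \sum_mu kostka a mu * kostka b mu = matrices a b.
Proof.
elim: b a => [|y b IH] a an.
  rewrite (bigD1 (shape_of n (fun=> 0))) //= size_shape_of0 muln1 big1 ?addn0 ?kostka_empty ?size_shape_of0 //.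
  move=> mu nmu; case: eqP => [m0|_]; last by rewrite muln0.
  by case/eqP: nmu; apply: size0_eq m0 size_shape_of0.
transitivity (\sum_(c <- removals a y) \sum_rho kostka c rho * kostka b rho); last first.
  rewrite [RHS]/= big_seq [RHS]big_seq; apply: eq_bigr => c /removals_sumn e; apply: IH.
  by apply: leq_trans an; rewrite -e leq_addr.
rewrite exchange_big /=.
under eq_bigr => mu _ do rewrite big_distrr /= big_mkcond.
rewrite exchange_big /=; apply: eq_bigr => rho _.
by rewrite -big_mkcond -[LHS]big_distrl -[RHS]big_distrl /= strip_add_remove.
Qed.
End RSK.

(** * Matrices as lists of vectors *)

Lemma removals_cons x a y :
  removals (x :: a) y = [seq (x - m) :: c | m <- iota 0 (minn x y).+1, c <- removals a (y - m)].
Proof. by []. Qed.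

Lemma removalsP a y c : (c \in removals a y) = all2 leq c a && (sumn c + y == sumn a).
Proof.
elim: a y c => [|x a IH] y c.
  by case: y c => [|y] [|z c] //=; rewrite inE.
rewrite removals_cons; apply/allpairsPdep/idP.
  move=> [m [c' [+ + ->]]]; rewrite mem_iota ltnS leq_min => /andP[_ /andP[mx my]].
  rewrite IH => /andP[h1 /eqP h2] /=; rewrite leq_subr h1 /=; lia.
case: c => [|z c] //; rewrite [all2 _ _ _]/= => /andP[/andP[zx ca] /eqP /= e].
have le : sumn c <= sumn a.
  by elim: c a ca {IH e} => [|u c IHc] [|v a] //= /andP[uv /IHc]; lia.
exists (x - z), c; rewrite -[0 :: _]/(iota 0 (minn x y).+1) mem_iota subKn // IH ca /=; split=> //; lia.
Qed.

Lemma removals_uniq a y : uniq (removals a y).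
Proof.
elim: a y => [|x a IH] y; first by case: y.
rewrite removals_cons; apply: allpairs_uniq_dep; first exact: (iota_uniq 0 (minn x y).+1).
  by move=> m _; exact: IH.
move=> _ _ /allpairsPdep[m [c [+ hc ->]]] /allpairsPdep[m' [c' [+ hc' ->]]] /=.
rewrite !mem_iota !ltnS !leq_min => /andP[_ /andP[mx _]] /andP[_ /andP[mx' _]] [e1 e2].
have em : m = m' by lia. by subst m' c'.
Qed.

(** A matrix is encoded by the vectors of row sums that remain when its columns
    are removed one by one. *)
Fixpoint matrix_codes (a b : seq nat) : seq (seq (seq nat)) :=
  if b is y :: b' then [seq c :: M | c <- removals a y, M <- matrix_codes c b']
  else if sumn a == 0 then [:: [::]] else [::].

Lemma size_matrix_codes a b : size (matrix_codes a b) = matrices a b.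
Proof.
elim: b a => [|y b IH] a /=; first by case: (sumn a == 0).
by rewrite size_allpairs_dep sumnE big_map; apply: eq_bigr => c _; exact: IH.
Qed.

Lemma matrix_codes_uniq a b : uniq (matrix_codes a b).
Proof.
elim: b a => [|y b IH] a /=; first by case: (sumn a == 0).
apply: allpairs_uniq_dep => [|c _|]; [exact: removals_uniq|exact: IH|].
by move=> _ _ /allpairsPdep[c [M [_ _ ->]]] /allpairsPdep[c' [M' [_ _ ->]]] /= [-> ->].
Qed.

Lemma all2_leq_map (T : Type) (f g : T -> nat) s :
  (forall i, f i <= g i) -> all2 leq [seq f i | i <- s] [seq g i | i <- s].
Proof. by move=> fg; elim: s => //= i s ->; rewrite fg. Qed.

Section MatrixCodes.
Variables (I J : finType) (rows : seq I).
Hypothesis rowsP : perm_eq rows (enum I).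
Implicit Types (m : I -> J -> nat) (js : seq J).

Definition row_sums m js := [seq \sum_(j <- js) m i j | i <- rows].
Fixpoint matrix_code m js := if js is j :: js' then row_sums m js' :: matrix_code m js' else [::].
Definition col_sums m js := [seq \sum_i m i j | j <- js].

Lemma sumn_rows (f : I -> nat) : sumn [seq f i | i <- rows] = \sum_i f i.
Proof. by rewrite sumnE big_map (perm_big _ rowsP) big_enum. Qed.

Lemma mem_matrix_code m js : matrix_code m js \in matrix_codes (row_sums m js) (col_sums m js).
Proof.
elim: js => [|j js IH] /=.
  by rewrite sumn_rows big1 // => i _; rewrite big_nil.
apply/allpairsPdep; exists (row_sums m js), (matrix_code m js); split=> //.
rewrite removalsP /row_sums !sumn_rows; apply/andP; split.
  by apply: all2_leq_map => i; rewrite big_cons leq_addl.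
rewrite addnC -big_split /=; apply/eqP; apply: eq_bigr => i _; by rewrite big_cons.
Qed.

Lemma matrix_code_inj m m' js : row_sums m js = row_sums m' js -> matrix_code m js = matrix_code m' js ->
  forall i j, j \in js -> m i j = m' i j.
Proof.
have ext mm mm' s : row_sums mm s = row_sums mm' s -> forall i, \sum_(j <- s) mm i j = \sum_(j <- s) mm' i j.
  by move=> /eq_in_map e i; apply: e; rewrite (perm_mem rowsP) mem_enum.
elim: js => [|j js IH] // /ext e1 [e2 e3] i j'.
rewrite inE => /orP[/eqP->|]; last exact: IH.
have := e1 i; rewrite !big_cons (ext _ _ _ e2); exact: addIn.
Qed.

Lemma eq_matrix_code m m' js : (forall i j, j \in js -> m i j = m' i j) ->
  [/\ row_sums m js = row_sums m' js, col_sums m js = col_sums m' js & matrix_code m js = matrix_code m' js].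
Proof.
have rE s : (forall i j, j \in s -> m i j = m' i j) -> row_sums m s = row_sums m' s.
  by move=> h; apply: eq_map => i; apply: eq_big_seq => j /h ->.
move=> h; split; first exact: rE.
  by apply/eq_in_map => j js_j; apply: eq_bigr => i _; exact: h.
elim: js h => [|j js IH] //= h; congr (_ :: _).
  by apply: rE => i j' h'; apply: h; rewrite inE h' orbT.
by apply: IH => i j' h'; apply: h; rewrite inE h' orbT.
Qed.

Lemma matrix_codes_matrix js a b M : uniq js -> size a = size rows -> size b = size js -> M \in matrix_codes a b ->
  exists m, [/\ a = row_sums m js, b = col_sums m js & M = matrix_code m js].
Proof.
elim: js a b M => [|j js IH] a [|y b] M //= => [_ sa _|/andP[nj uj] sa [sb]].
  case: eqP => // a0; rewrite inE => /eqP ->; exists (fun _ _ => 0); split=> //.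
  rewrite /row_sums; under eq_map => i do rewrite big_nil.
  elim: (a) (rows) sa a0 => [|x a' IHa] [|i s] //= [sa]; case: x => // a0; congr (_ :: _).
  exact: IHa.
move=> /allpairsPdep[c [M' [+ M'c ->]]]; rewrite removalsP => /andP[ca /eqP cy].
have sc : size c = size rows by rewrite -sa; move: ca; rewrite all2E => /andP[/eqP].
have [m [ec eb eM]] := IH c b M' uj sc sb M'c.
pose d i := nth 0 a (index i rows) - nth 0 c (index i rows).
pose m' i j' := if j' == j then d i else m i j'.
have ext i j' : j' \in js -> m' i j' = m i j'.
  by rewrite /m'; case: eqP => // -> h; rewrite h in nj.
have [r1 r2 r3] := eq_matrix_code ext.
have us : uniq rows by rewrite (perm_uniq rowsP) enum_uniq.
have le k : k < size rows -> nth 0 c k <= nth 0 a k.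
  move: ca; rewrite all2E => /andP[_ /all_nthP h] ks.
  have := h (0, 0) k; rewrite size_zip sc sa minnn nth_zip ?sc ?sa //=; exact.
have ea : a = row_sums m' (j :: js).
  apply: (@eq_from_nth _ 0); first by rewrite size_map.
  move=> k; rewrite sa => ks; have [i0 _] : exists i : I, true by case: (rows) ks => // i; exists i.
  rewrite (nth_map i0) // big_cons {1}/m' eqxx /d index_uniq //.
  have -> : \sum_(j' <- js) m' (nth i0 rows k) j' = nth 0 c k.
    by rewrite ec -r1 (nth_map i0).
  by rewrite subnK ?le.
exists m'; split=> //; last by rewrite /= r1 r3 -ec -eM.
congr (_ :: _); last by rewrite eb r2.
have := cy; rewrite ea ec -r1 /row_sums !sumn_rows.
under [X in _ = X]eq_bigr => i _ do rewrite big_cons.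
by rewrite big_split /= addnC; exact: addIn.
Qed.
End MatrixCodes.
Local Open Scope ring_scope.

(** * Products of permutation characters *)

Section Orbits.
Variables (P L : finType).
Implicit Types (W : {ffun P -> L}) (s t x : {perm P}).

Lemma card_wact_eq W s0 : #|[set s | wact W s == wact W s0]| = #|word_stab (wact W s0)|.
Proof.
rewrite -(card_imset (mem (word_stab (wact W s0))) (@mulIg _ s0)); apply: eq_card => s.
rewrite inE; apply/eqP/imsetP => [/ffunP e|[x + ->]].
  exists (s * s0^-1)%g; last by rewrite mulgKV.
  rewrite inE; apply/wact_fixP => p.
  by have := e p; rewrite !ffunE permM permKV.
rewrite inE => /wact_fixP e; apply/ffunP => p; have := e p.
by rewrite !ffunE permM.
Qed.

Lemma card_wact_eq_base W s0 : #|[set s | wact W s == wact W s0]| = #|word_stab W|.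
Proof.
rewrite -(card_imset (mem (word_stab W)) (@mulgI _ s0)); apply: eq_card => s.
rewrite inE; apply/eqP/imsetP => [/ffunP e|[x + ->]].
  exists (s0^-1 * s)%g; last by rewrite mulKVg.
  rewrite inE; apply/wact_fixP => p.
  by have := e (s0^-1 p)%g; rewrite !ffunE permM permKV.
rewrite inE => /wact_fixP e; apply/ffunP => p.
by rewrite !ffunE permM e.
Qed.

Lemma sum_wstab W :
  \sum_(W' : {ffun P -> L} | [exists s, W' == wact W s]) #|word_stab W'| = #|[set: {perm P}]| :> nat.
Proof.
rewrite -sum1_card (partition_big (wact W) (fun W' => [exists s, W' == wact W s])) /=.
  apply: eq_bigr => W' /existsP[s0 /eqP ->].
  by rewrite -card_wact_eq -sum1_card; apply: eq_bigl => s; rewrite !inE.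
by move=> s _; apply/existsP; exists s.
Qed.
End Orbits.

Section PermCharacter.
Variable P : finType.
Let G := [set: {perm P}]%G.

(** The cosets of the stabilizer of b are the rearrangements of b, so the
    induced character counts the rearrangements that are fixed. *)
Lemma hpermE r (b : {ffun P -> 'I_r}) x :
  hperm b x = (\sum_(u | in_class b u) (x \in word_stab u))%:R.
Proof.
rewrite /hperm cfIndE ?subsetT //.
have nH : #|word_stab b|%:R != 0 :> algC by exact: (neq0CG (word_stab_group b)).
apply: (mulfI nH); rewrite mulrA mulfV // mul1r.
have memE y : (x ^ y \in word_stab b)%g = (x \in word_stab (wact b y)).
  apply/word_stabP/idP => [h|].
    rewrite inE; apply/wact_fixP => p; have := h (y p).
    by rewrite !ffunE /conjg !permM permK.
  rewrite inE => /wact_fixP h p; have := h (y^-1 p)%g.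
  by rewrite !ffunE /conjg !permM permKV.
rewrite (eq_bigr (fun y => (x \in word_stab (wact b y))%:R)); last by move=> y _; rewrite cfun1E; congr (_%:R); rewrite memE.
rewrite -natr_sum -natrM; congr _%:R.
rewrite (partition_big (wact b) (in_class b)) /= => [|y _]; last first.
  by apply/existsP; exists y.
rewrite big_distrr /=; apply: eq_bigr => u /existsP[s0 /eqP ->].
rewrite (eq_bigr (fun=> (x \in word_stab (wact b s0)) : nat)) => [|y /andP[_ /eqP ->]] //.
rewrite sum_nat_cond_const; congr (_ * _)%N.
transitivity #|[set s | wact b s == wact b s0]|.
  by apply: eq_card => s; rewrite !inE.
rewrite card_wact_eq_base; apply: eq_card => s; rewrite !inE.
by apply/wact_fixP/eqP => [h|/ffunP h p]; [apply/ffunP => p; rewrite ffunE|have := h p; rewrite ffunE].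
Qed.

Lemma hperm_char r (b : {ffun P -> 'I_r}) : hperm b \is a character.
Proof. by rewrite cfInd_char // rpred1. Qed.

Definition letter_counts r (b : {ffun P -> 'I_r}) : seq nat :=
  [seq wcount b i | i <- rev (enum 'I_r)].

Lemma in_classE n (u v : {ffun P -> 'I_n}) :
  in_class u v = (letter_counts v == letter_counts u).
Proof.
apply/existsP/eqP => [[s /eqP ->]|/eq_in_map e].
  by apply: eq_map => i; rewrite wact_count.
have [|s es] := @same_count_wact _ _ u v; last by exists s; rewrite es.
by move=> i; rewrite e // mem_rev mem_enum.
Qed.

(** The product counts the orbits on pairs of rearrangements, by the orbit-
    counting lemma. A pair of words is a word in pairs of letters, and its orbit
    is determined by the matrix of the numbers of positions at which each pair
    of letters occurs. *)
Theorem cfdot_hperm r r' (b : {ffun P -> 'I_r}) (b' : {ffun P -> 'I_r'}) :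
  '[hperm b, hperm b'] = (matrices (letter_counts b) (letter_counts b'))%:R.
Proof.
pose L := ('I_r * 'I_r')%type.
pose p1 (W : {ffun P -> L}) := [ffun p => (W p).1].
pose p2 (W : {ffun P -> L}) := [ffun p => (W p).2].
pose X W := in_class b (p1 W) && in_class b' (p2 W).
have rowsP n : perm_eq (rev (enum 'I_n)) (enum 'I_n) by rewrite perm_rev.
pose m (W : {ffun P -> L}) (i : 'I_r) (j : 'I_r') := wcount W (i, j).
pose js := rev (enum 'I_r').
have rE W : row_sums (rev (enum 'I_r)) (m W) js = letter_counts (p1 W).
  apply: eq_map => i; rewrite (perm_big _ (rowsP r')) big_enum /=.
  rewrite /wcount -sum1_card (partition_big (fun p => (W p).2) predT) //=.
  apply: eq_bigr => j _; rewrite /m /wcount -sum1_card; apply: eq_bigl => p; rewrite !inE ffunE.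
  by rewrite -pair_eqE.
have cE W : col_sums (m W) js = letter_counts (p2 W).
  apply: eq_map => j.
  rewrite /wcount -sum1_card (partition_big (fun p => (W p).1) predT) //=.
  apply: eq_bigr => i _; rewrite /m /wcount -sum1_card; apply: eq_bigl => p; rewrite !inE ffunE.
  by rewrite -pair_eqE andbC.
have classE := in_classE.
pose c W := matrix_code (rev (enum 'I_r)) (m W) js.
have cX W : X W -> c W \in matrix_codes (letter_counts b) (letter_counts b').
  by rewrite /X !classE => /andP[/eqP<- /eqP<-]; rewrite -rE -cE; exact: (mem_matrix_code (rowsP r)).
have js_uniq : uniq js by rewrite (perm_uniq (rowsP r')) enum_uniq.
have cE' W W' : X W -> X W' -> (c W == c W') = [exists s, W' == wact W s].
  rewrite /X !classE => /andP[/eqP e1 _] /andP[/eqP e1' _].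
  apply/eqP/existsP => [e|[s /eqP ->]].
    have [|s ->] := @same_count_wact _ _ W W'; last by exists s.
    move=> [i j]; apply: (matrix_code_inj (rowsP r) _ e); first by rewrite !rE e1.
    by rewrite mem_rev mem_enum.
  by have [] := @eq_matrix_code _ _ (rev (enum 'I_r)) (m W) (m (wact W s)) js
     (fun i j _ => esym (wact_count _ _ _)).
have ex_word M : M \in matrix_codes (letter_counts b) (letter_counts b') -> exists2 W, X W & c W = M.
  move=> hM.
  have [||m' [e1 e2 e3]] := matrix_codes_matrix (rowsP r) js_uniq _ _ hM; rewrite ?size_map //.
  have [|W Wm] := @word_of_count P L (fun l => m' l.1 l.2).
    have := congr1 sumn e1; rewrite /letter_counts (sumn_rows (rowsP r)) /row_sums (sumn_rows (rowsP r)).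
    under [X in _ = X]eq_bigr => i _ do rewrite (perm_big _ (rowsP r')) big_enum /=.
    rewrite pair_big /= => <-.
    rewrite -[RHS]sum1_card (partition_big b predT) //=.
    by apply: eq_bigr => i _; rewrite /wcount -sum1_card; apply: eq_bigl => p; rewrite inE.
  have [r1 r2 r3] := @eq_matrix_code _ _ (rev (enum 'I_r)) (m W) m' js (fun i j _ => Wm (i, j)).
  exists W; last by rewrite /c r3.
  by rewrite /X !classE -rE -cE r1 r2 -e1 -e2 !eqxx.
have part (F : {ffun P -> L} -> nat) : (\sum_(W | X W) F W =
    \sum_(M <- matrix_codes (letter_counts b) (letter_counts b')) \sum_(W | X W && (c W == M)) F W)%N.
  rewrite (exchange_big_dep X) /=; last by move=> M W _ /andP[].
  apply: eq_bigr => W XW; rewrite (eq_bigl (fun M => M == c W)) => [|M]; last first.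
    by rewrite XW eq_sym.
  rewrite big_mkcond (bigD1_seq (c W)) ?matrix_codes_uniq ?cX //= eqxx big1 ?addn0 // => M.
  by move=> /negbTE ->.
have total : (\sum_(W | X W) #|word_stab W| = #|G| * matrices (letter_counts b) (letter_counts b'))%N.
  rewrite part -size_matrix_codes big_seq (eq_bigr (fun=> #|G|)) => [|M /ex_word[W0 XW0 <-]].
    by rewrite -big_seq big_const_seq count_predT iter_addn_0.
  rewrite -(sum_wstab W0); apply: eq_bigl => W.
  case: (boolP (X W)) => XW /=; first by rewrite eq_sym cE'.
  apply/esym/negbTE; apply: contra XW => /existsP[s /eqP ->].
  move: XW0; rewrite /X !classE => /andP[/eqP <- /eqP <-].
  have p1s : p1 (wact W0 s) = wact (p1 W0) s by apply/ffunP => p; rewrite !ffunE.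
  have p2s : p2 (wact W0 s) = wact (p2 W0) s by apply/ffunP => p; rewrite !ffunE.
  apply/andP; split; apply/eqP/eq_map => i; by rewrite (p1s, p2s) wact_count.
rewrite cfdotE; have nG : #|G|%:R != 0 :> algC by exact: neq0CG.
apply: (mulfI nG); rewrite mulrA mulfV // mul1r -natrM -total.
rewrite (eq_bigr (fun x => ((\sum_(u | in_class b u) (x \in word_stab u)) *
    (\sum_(u | in_class b' u) (x \in word_stab u)))%N%:R)); last first.
  by move=> x _; rewrite (hpermE b x) (hpermE b' x) natrM conjC_nat.
rewrite -natr_sum; congr _%:R.
transitivity (\sum_(x in G) \sum_(W | X W) (x \in word_stab W))%N.
  apply: eq_bigr => x _; rewrite big_distrlr /= pair_big /=.
  rewrite (reindex (fun W : {ffun P -> L} => (p1 W, p2 W))) /=.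
    apply: eq_bigr => W _; rewrite mulnb; congr nat_of_bool.
    rewrite !inE; apply/andP/wact_fixP => [[/wact_fixP h1 /wact_fixP h2] p|h].
      have := h1 p; have := h2 p; rewrite !ffunE.
      by case: (W (x p)) => ? ?; case: (W p) => ? ? /= -> ->.
    by split; apply/wact_fixP => p; rewrite !ffunE h.
  exists (fun uv : {ffun P -> 'I_r} * {ffun P -> 'I_r'} => [ffun p => (uv.1 p, uv.2 p)]).
    by move=> W _; apply/ffunP => p; rewrite !ffunE /=; case: (W p).
  by move=> [u v] _; congr pair; apply/ffunP => p; rewrite !ffunE.
rewrite exchange_big /=; apply: eq_bigr => W _.
by rewrite -sum1_card big_mkcond [RHS]big_mkcond /=; apply: eq_bigr => x _; rewrite inE; case: (x \in _).
Qed.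

Lemma hperm_relabel r r' (b : {ffun P -> 'I_r}) (f : 'I_r -> 'I_r') :
  injective f -> hperm [ffun p => f (b p)] = hperm b.
Proof.
move=> fI; rewrite /hperm; congr ('Ind[G] (1 : 'CF(_))).
have -> // : word_stab_group [ffun p => f (b p)] = word_stab_group b.
apply: val_inj; apply/setP => x; apply/word_stabP/word_stabP => h p; last by rewrite !ffunE h.
by have := h p; rewrite !ffunE => /fI.
Qed.
End PermCharacter.

(** * Semistandard fillings as words *)

Section FiniteSum.
Variables (nu : {fset cell}) (r : nat).
Implicit Types (T : filling nu) (w : {ffun nu -> 'I_r}).

Definition lift_word w : filling nu := [ffun x => val (w x)].

Lemma lift_word_inj : injective lift_word.
Proof. by move=> w w' /ffunP e; apply/ffunP => x; apply: val_inj; have := e x; rewrite !ffunE. Qed.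

Definition fits (a : monomial) := forall k, a k != 0%N -> (k < r)%N.

Lemma content_fits T a : fits a -> content T = a -> exists w, T = lift_word w.
Proof.
move=> ar e; have Tr x : (T x < r)%N.
  by apply: ar; rewrite -e contentE cards_eq0; apply/set0Pn; exists x; rewrite inE.
by exists [ffun x => Ordinal (Tr x)]; apply/ffunP => x; rewrite !ffunE.
Qed.

Lemma ssyt_gf_fin (R : comNzRingType) (wt : filling nu -> R) a : fits a ->
  ssyt_gf wt a = \sum_(w | is_ssyt (lift_word w) && (content (lift_word w) == a)) wt (lift_word w).
Proof.
move=> ar; rewrite /ssyt_gf.
pose s := [seq lift_word w | w <- enum (fun w => is_ssyt (lift_word w) && (content (lift_word w) == a))].
have -> : [set T | is_ssyt T /\ content T = a]%classic = [set` s]%classic.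
  apply/seteqP; split => T /=.
    move=> [sT cT]; have [w ew] := content_fits ar cT; apply/mapP; exists w => //.
    by rewrite mem_enum unfold_in -ew sT cT eqxx.
  by move=> /mapP[w]; rewrite mem_enum unfold_in => /andP[h /eqP h'] ->.
rewrite -fsbig_seq ?map_inj_uniq ?enum_uniq //; last exact: lift_word_inj.
by rewrite big_map big_enum.
Qed.
End FiniteSum.

(** * Schur functions by chains of shapes *)

Local Open Scope nat_scope.

Section ChainList.
Variable n : nat.
Implicit Types (la mu : shape n) (a : seq nat).

Fixpoint is_chain a mu (c : seq (shape n)) : bool :=
  match a, c with
  | [::], [::] => shape_size mu == 0
  | x :: a', la :: c' => [&& hstrip la mu, shape_size mu == shape_size la + x & is_chain a' la c']
  | _, _ => false
  end.

(** The chains counted by kostka, in decreasing order and without their top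
    shape mu. *)
Fixpoint chain_list a mu : seq (seq (shape n)) :=
  if a is x :: a' then
    [seq la :: c | la <- enum (fun la => hstrip la mu && (shape_size mu == shape_size la + x)), c <- chain_list a' la]
  else if shape_size mu == 0 then [:: [::]] else [::].

Lemma size_chain_list a mu : size (chain_list a mu) = kostka a mu.
Proof.
elim: a mu => [|x a IH] mu /=; first by case: (shape_size mu == 0).
rewrite size_allpairs_dep sumnE big_map big_enum /=; apply: eq_bigr => la _; exact: IH.
Qed.

Lemma chain_list_uniq a mu : uniq (chain_list a mu).
Proof.
elim: a mu => [|x a IH] mu /=; first by case: (shape_size mu == 0).
apply: allpairs_uniq_dep => [|la _|]; [exact: enum_uniq|exact: IH|].
by move=> _ _ /allpairsPdep[la [c [_ _ ->]]] /allpairsPdep[la' [c' [_ _ ->]]] /= [-> ->].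
Qed.

Lemma mem_chain_list a mu c : (c \in chain_list a mu) = is_chain a mu c.
Proof.
elim: a mu c => [|x a IH] mu [|la c] /=.
- by case: (shape_size mu == 0).
- by case: (shape_size mu == 0).
- by apply/allpairsPdep => -[? [? []]].
apply/allpairsPdep/and3P => [[la' [c' [+ + [-> ->]]]]|[h1 h2 h3]].
  by rewrite mem_enum unfold_in IH => /andP[-> ->] ->.
by exists la, c; rewrite mem_enum unfold_in h1 h2 IH h3.
Qed.

(** The members of f are numbered from the bottom, while chains and contents are
    listed from the top; hence the reversals. *)
Lemma is_chainP a (f : nat -> shape n) :
  reflect (shape_size (f 0) = 0 /\ forall k, k < size a ->
      hstrip (f k) (f k.+1) /\ shape_size (f k.+1) = shape_size (f k) + nth 0 (rev a) k)
    (is_chain a (f (size a)) [seq f k | k <- rev (iota 0 (size a))]).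
Proof.
elim: a => [|x a IH] /=; first by apply: (iffP eqP) => [|[]].
rewrite -[0 :: iota 1 (size a)]/(iota 0 (size a).+1) -addn1 iotaD rev_cat /= add0n addn1.
apply: (iffP and3P) => [[h1 /eqP h2 /IH[h3 h4]]|[h0 h]].
  split=> // k; rewrite ltnS leq_eqVlt rev_cons nth_rcons size_rev => /orP[/eqP->|ka].
    by rewrite ltnn eqxx.
  by rewrite ka; exact: h4.
have [h1 h2] := h _ (ltnSn _); rewrite rev_cons nth_rcons size_rev ltnn eqxx in h2.
split=> //; first exact/eqP.
apply/IH; split=> // k ka; have [h3 h4] := h k (ltnW ka); split=> //.
by rewrite h4 rev_cons nth_rcons size_rev ka.
Qed.

Lemma is_chain_size a mu c : is_chain a mu c -> size c = size a.
Proof. by elim: a mu c => [|x a IH] mu [|la c] //= /and3P[_ _ /IH ->]. Qed.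

Lemma chain_fun a mu c : size c = size a ->
  exists f : nat -> shape n, f (size a) = mu /\ c = [seq f k | k <- rev (iota 0 (size a))].
Proof.
move=> sc; exists (nth mu (rev (mu :: c))); rewrite rev_cons.
split; first by rewrite nth_rcons size_rev sc ltnn eqxx.
apply: (@eq_from_nth _ mu); first by rewrite size_map size_rev size_iota.
move=> i; rewrite sc => ic; rewrite (nth_map 0) ?size_rev ?size_iota // nth_rev ?size_iota // nth_iota ?add0n; last by lia.
rewrite nth_rcons size_rev sc; case: ltnP => h; last by lia.
by rewrite nth_rev; [congr nth; lia|lia].
Qed.
End ChainList.

Section Kostka.
Variables (mu : intpart) (r : nat).
Let nu := diagram (parts mu).
Let n := #|` nu|.
Implicit Types (T : filling nu).

Definition part_shape m : shape m := shape_of m (nth 0 (parts mu)).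

Lemma card_subdiagram (f : nat -> nat) : (forall i, f i <= nth 0 (parts mu) i) ->
  forall N, size (parts mu) <= N -> #|[set x : nu | (val x).2 < f (val x).1]%SET| = \sum_(i < N) f i.
Proof.
move=> fmu N sN; rewrite -sum1_card.
have rowlt (x : nu) : (val x).1 < N.
  have := valP x; rewrite mem_diagram => h; apply: leq_trans sN.
  by case: ltnP => // /(nth_default 0) e; rewrite e in h.
rewrite (partition_big (fun x : nu => Ordinal (rowlt x)) predT) //=.
apply: eq_bigr => i _; rewrite sum1dep_card -[RHS]card_ord.
have inD (j : 'I_(f i)) : ((i : nat), (j : nat)) \in nu.
  by rewrite mem_diagram /=; apply: leq_trans (fmu i).
pose g (j : 'I_(f i)) : nu := FSetSub (inD j).
have gI : injective g by move=> j k /(congr1 val) [] /val_inj.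
rewrite -(card_imset _ gI); apply: eq_card => x; rewrite !inE.
apply/andP/imsetP => [[h1 /eqP h2]|[j _ ->]].
  have xi : (val x).1 = i by rewrite -h2.
  rewrite xi in h1; exists (Ordinal h1) => //; apply: val_inj => /=.
  by rewrite -xi -surjective_pairing.
by rewrite /= ltn_ord; split=> //; apply/eqP/val_inj.
Qed.

Lemma card_nu : n = \sum_(i < size (parts mu)) nth 0 (parts mu) i.
Proof.
rewrite -(card_subdiagram (f := nth 0 (parts mu))) // /n cardfE; apply: eq_card => x.
by rewrite !inE -mem_diagram (valP x).
Qed.

Lemma length_part_le : size (parts mu) <= n.
Proof.
rewrite card_nu -[X in X <= _]card_ord -sum1_card; apply: leq_sum => i _.
have /andP[_] := valP mu; rewrite lt0n; apply: contra => /eqP <-; exact: mem_nth.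
Qed.

Lemma part_le i : nth 0 (parts mu) i <= n.
Proof.
case: (ltnP i (size (parts mu))) => [h|/(nth_default 0) -> //].
by rewrite card_nu (bigD1 (Ordinal h)) //= leq_addr.
Qed.

Lemma rowlen_part_shape i : rowlen (part_shape n) i = nth 0 (parts mu) i.
Proof.
case: (leqP i n) => ni; first by rewrite rowlen_mk // part_le.
by rewrite rowlen_big // nth_default // (leq_trans length_part_le) // ltnW.
Qed.

Definition row_count T k i := #|[set x : nu | ((val x).1 == i) && (T x < k)]%SET|.

Lemma row_count_part T k i : row_count T k i <= nth 0 (parts mu) i.
Proof.
pose c (x : nu) := (val x).2.
have cI : {in [set x : nu | ((val x).1 == i) && (T x < k)]%SET &, injective c}.
  move=> x y; rewrite !inE => /andP[/eqP xi _] /andP[/eqP yi _] e; apply: val_inj.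
  by apply/eqP; rewrite -pair_eqE /= xi yi eqxx -/(c x) e eqxx.
rewrite /row_count cardE -(size_map c) -[X in _ <= X](size_iota 0); apply: uniq_leq_size.
  by rewrite map_inj_in_uniq ?enum_uniq // => x y; rewrite !mem_enum; exact: cI.
move=> _ /mapP[x + ->]; rewrite mem_enum inE mem_iota /= add0n => /andP[/eqP <- _].
by have := valP x; rewrite mem_diagram.
Qed.

(** The entries below k form an initial segment of each row. *)
Lemma row_count_lt T k (x : nu) : is_ssyt T -> (T x < k) = ((val x).2 < row_count T k (val x).1).
Proof.
move=> /forallP sT.
have weak (y z : nu) : (val y).1 = (val z).1 -> (val y).2 <= (val z).2 -> T y <= T z.
  move=> e; rewrite leq_eqVlt => /orP[/eqP e2|lt].
    rewrite (_ : y = z) //; apply: val_inj; apply/eqP.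
    by rewrite -pair_eqE /= e e2 !eqxx.
  by have /forallP/(_ z)/andP[/implyP h _] := sT y; apply: h; rewrite e eqxx.
set i := (val x).1; set j := (val x).2.
have inD (m : nat) : m <= j -> (i, m) \in nu.
  move=> mj; have := valP x; rewrite !mem_diagram /=; exact: leq_ltn_trans.
apply/idP/idP => [xk|].
  rewrite -[j.+1]card_ord.
  pose g (m : 'I_j.+1) : nu := FSetSub (inD m (leq_ord m)).
  have gI : injective g by move=> m m' /(congr1 val) [] /val_inj.
  rewrite -(card_imset _ gI); apply: subset_leq_card; apply/fintype.subsetP => y /imsetP[m _ ->].
  rewrite inE eqxx /=; apply: leq_ltn_trans xk; apply: weak => //=; exact: leq_ord.
apply: contraTT; rewrite -!leqNgt => kx.
have sub : [set y : nu | ((val y).1 == i) && (T y < k)]%SET \subset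
    [set y : nu | ((val y).1 == i) && ((val y).2 < j)]%SET.
  apply/fintype.subsetP => y; rewrite !inE => /andP[/eqP yi yk]; rewrite yi eqxx /=.
  rewrite ltnNge; apply/negP => h; have := leq_trans kx (weak x y (esym yi) h).
  by rewrite leqNgt yk.
apply: leq_trans (subset_leq_card sub) _.
pose c (y : nu) := (val y).2.
rewrite cardE -(size_map c) -[X in _ <= X](size_iota 0); apply: uniq_leq_size.
  rewrite map_inj_in_uniq ?enum_uniq // => y z; rewrite !mem_enum !inE.
  move=> /andP[/eqP yi _] /andP[/eqP zi _] e; apply: val_inj.
  by apply/eqP; rewrite -pair_eqE /= yi zi eqxx -/(c y) e eqxx.
by move=> _ /mapP[y + ->]; rewrite mem_enum inE mem_iota /= add0n => /andP[].
Qed.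

Definition sub_shape T k : shape n := shape_of n (row_count T k).

Lemma rowlen_sub_shape T k i : rowlen (sub_shape T k) i = row_count T k i.
Proof.
case: (leqP i n) => ni; first by rewrite rowlen_mk // (leq_trans (row_count_part _ _ _)) // part_le.
rewrite rowlen_big //; apply/esym/eqP; rewrite -leqn0; apply: leq_trans (row_count_part _ _ _) _.
by rewrite nth_default // (leq_trans length_part_le) // ltnW.
Qed.

Lemma size_sub_shape T k : is_ssyt T -> shape_size (sub_shape T k) = #|[set x | T x < k]%SET|.
Proof.
move=> sT; rewrite /shape_size; under eq_bigr => i _ do rewrite rowlen_sub_shape.
rewrite -(card_subdiagram (f := row_count T k)).
- by apply: eq_card => x; rewrite !inE -row_count_lt.
- exact: row_count_part.
- exact: leq_trans length_part_le _.
Qed.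

Variable a : monomial.
Hypothesis ar : fits r a.
Let A := [seq a i | i <- rev (iota 0 r)].

Let sA : size A = r. Proof. by rewrite size_map size_rev size_iota. Qed.
Let nA k : k < r -> nth 0 (rev A) k = a k.
Proof. by move=> kr; rewrite -map_rev revK (nth_map 0) ?size_iota // nth_iota. Qed.

Lemma ssyt_chain T : is_ssyt T -> content T = a ->
  is_chain A (part_shape n) [seq sub_shape T k | k <- rev (iota 0 r)].
Proof.
move=> sT cT.
have Tr x : T x < r.
  by apply: ar; rewrite -cT contentE cards_eq0; apply/set0Pn; exists x; rewrite inE.
have -> : part_shape n = sub_shape T (size A).
  apply: rowlen_inj => i _; rewrite rowlen_part_shape rowlen_sub_shape sA; apply/eqP.
  rewrite eqn_leq row_count_part andbT leqNgt; apply/negP => h.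
  have xn : (i, row_count T r i) \in nu by rewrite mem_diagram.
  by have := row_count_lt r [` xn]%fset sT; rewrite Tr /= ltnn.
rewrite (_ : rev (iota 0 r) = rev (iota 0 (size A))) ?sA // -sA; apply/is_chainP; split=> [|k]; first rewrite size_sub_shape //.
  by apply/eqP; rewrite cards_eq0; apply/eqP/setP => x; rewrite !inE.
rewrite sA => kr; split; last first.
  by rewrite !size_sub_shape // !card_lt_content cT big_ord_recr nA.
apply/hstripP => i; rewrite !rowlen_sub_shape; split.
  apply: subset_leq_card; apply/fintype.subsetP => x; rewrite !inE => /andP[-> /=].
  by move=> /ltnW.
case e: (row_count T k.+1 i.+1) => [|j] //.
have xn : (i.+1, j) \in nu.
  by rewrite mem_diagram /=; apply: leq_trans (row_count_part T k.+1 i.+1); rewrite e.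
have yn : (i, j) \in nu.
  by move: xn; rewrite !mem_diagram /= => h; apply: leq_trans h (nth_part_le _ _).
have := row_count_lt k [` yn]%fset sT; rewrite /= => <-.
have := row_count_lt k.+1 [` xn]%fset sT; rewrite /= e ltnSn ltnS => h.
apply: leq_trans h; move/forallP: (sT) => /(_ [` yn]%fset)/forallP/(_ [` xn]%fset)/andP[_ /implyP]; apply.
by rewrite /= eqxx ltnSn.
Qed.

Lemma ssyt_chain_inj T T' : is_ssyt T -> is_ssyt T' -> (forall x, T x < r) -> (forall x, T' x < r) ->
  [seq sub_shape T k | k <- rev (iota 0 r)] = [seq sub_shape T' k | k <- rev (iota 0 r)] -> T = T'.
Proof.
move=> sT sT' Tr Tr' /eq_in_map e.
have lt k x : k < r -> (T x < k) = (T' x < k).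
  move=> kr; rewrite !row_count_lt // -!rowlen_sub_shape e //.
  by rewrite mem_rev mem_iota.
apply/ffunP => x; apply/eqP; rewrite eqn_leq leqNgt [T' x <= _]leqNgt.
by rewrite -(lt _ x (Tr x)) ltnn (lt _ x (Tr' x)) ltnn.
Qed.

Lemma chain_ssyt c : is_chain A (part_shape n) c ->
  exists T, [/\ is_ssyt T, content T = a & [seq sub_shape T k | k <- rev (iota 0 r)] = c].
Proof.
move=> cA; have sc := is_chain_size cA.
have [f [fr ec]] := chain_fun (part_shape n) sc; rewrite sA in fr ec.
move: cA; rewrite ec -{1}fr -{1 2}sA => /is_chainP[f0 fS]; rewrite sA in fS.
have mono k l i : k <= l -> l <= r -> rowlen (f k) i <= rowlen (f l) i.
  elim: l => [|l IH]; first by rewrite leqn0 => /eqP ->.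
  rewrite leq_eqVlt => /orP[/eqP->//|]; rewrite ltnS => kl lr.
  by apply: leq_trans (IH kl (ltnW lr)) _; have [/hstripP/(_ i)[]] := fS _ lr.
pose T : filling nu := [ffun x => \sum_(k < r) (rowlen (f k.+1) (val x).1 <= (val x).2)].
have Tlt x k : k <= r -> (T x < k) = ((val x).2 < rowlen (f k) (val x).1).
  move=> kr; rewrite ffunE; apply/idP/idP.
    apply: contraTT; rewrite -!leqNgt => h.
    rewrite -[X in X <= _]card_ord -sum1_card.
    rewrite (bigID (fun i : 'I_r => i < k)) /= -[X in X <= _]addn0; apply: leq_add => //.
    rewrite (big_ord_widen_cond r (fun _ => true) (fun _ => 1)) //=.
    apply: leq_sum => i ik; rewrite lt0b; apply: leq_trans h.
    exact: mono.
  case: k kr => [|k] kr h; first by rewrite (size0_rowlen f0) in h.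
  rewrite ltnS (bigID (fun i : 'I_r => i < k)) /= [X in _ + X]big1 ?addn0.
    apply: leq_trans (_ : \sum_(i < r | i < k) 1 <= k).
      by apply: leq_sum => i _; exact: leq_b1.
    by rewrite -(big_ord_widen_cond r (fun _ => true) (fun _ => 1)) ?sum_nat_const ?card_ord ?muln1 // ltnW.
  move=> i; rewrite -leqNgt => ki; apply/eqP; rewrite eqb0 -ltnNge.
  by apply: leq_trans h _; apply: mono.
have Tr x : T x < r.
  by rewrite Tlt // fr rowlen_part_shape -mem_diagram (valP x).
have sT : is_ssyt T.
  apply/forallP => x; apply/forallP => y; apply/andP; split; apply/implyP => /andP[/eqP e lt].
    rewrite -ltnS Tlt // e; apply: ltn_trans lt _; rewrite -Tlt //; exact: Tr.
  rewrite (Tlt _ _ (ltnW (Tr y))) e.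
  have := ltnSn (T y); rewrite (Tlt _ _ (Tr y)) => h; apply: leq_trans h _.
  have [/hstripP hk _] := fS _ (Tr y); apply: leq_trans (hk (val x).1).2.
  have dec m : rowlen (f (T y).+1) ((val x).1.+1 + m) <= rowlen (f (T y).+1) (val x).1.+1.
    elim: m => [|m IH]; first by rewrite addn0.
    rewrite addnS; apply: leq_trans IH; have [h1 h2] := hk ((val x).1.+1 + m).
    exact: leq_trans h2 h1.
  by rewrite -(subnKC lt); exact: dec.
have shE k : k <= r -> sub_shape T k = f k.
  move=> kr; apply: rowlen_inj => i _; rewrite rowlen_sub_shape; apply/eqP; rewrite eqn_leq leqNgt [X in _ && X]leqNgt.
  have fi : rowlen (f k) i <= nth 0 (parts mu) i.
    by rewrite -rowlen_part_shape -fr; exact: mono.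
  apply/andP; split; apply/negP => h.
    have xn : (i, rowlen (f k) i) \in nu.
      by rewrite mem_diagram; exact: leq_trans h (row_count_part _ _ _).
    by have := Tlt [` xn]%fset k kr; rewrite row_count_lt //= h ltnn.
  have xn : (i, row_count T k i) \in nu by rewrite mem_diagram; exact: leq_trans h fi.
  by have := Tlt [` xn]%fset k kr; rewrite row_count_lt //= h ltnn.
exists T; split=> //; last first.
  by apply/eq_in_map => k; rewrite mem_rev mem_iota add0n => /andP[_ /ltnW]; exact: shE.
apply/fsfunP => k; case: (ltnP k r) => kr; last first.
  rewrite contentE (_ : a k = 0); last by apply/eqP; apply: contraTT kr => /ar; rewrite -ltnNge.
  apply/eqP; rewrite cards_eq0; apply/eqP/setP => x; rewrite !inE; apply/negbTE.
  by apply: contraTneq (Tr x) => ->; rewrite -leqNgt.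
have [_] := fS k kr; rewrite nA // -(shE _ kr) -(shE _ (ltnW kr)) !size_sub_shape // !card_lt_content big_ord_recr /=.
exact: addnI.
Qed.

(** A tableau is determined by the subshapes of its entries below k, for all k;
    strictness in the columns says that consecutive subshapes differ by a
    horizontal strip. *)
Theorem schur_chain (R : comNzRingType) : schur R mu a = (kostka A (part_shape n))%:R.
Proof.
rewrite /schur (ssyt_gf_fin _ ar) sumr_const -size_chain_list; congr (_ *+ _).
pose s := enum (fun w : {ffun nu -> 'I_r} => is_ssyt (lift_word w) && (content (lift_word w) == a)).
pose Phi (w : {ffun nu -> 'I_r}) := [seq sub_shape (lift_word w) k | k <- rev (iota 0 r)].
have ms w : (w \in s) = is_ssyt (lift_word w) && (content (lift_word w) == a) by rewrite mem_enum.
rewrite cardE -/s -(size_map Phi); apply: perm_size; apply: uniq_perm.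
- rewrite map_inj_in_uniq ?enum_uniq // => w w'; rewrite !ms => /andP[h1 _] /andP[h2 _] e.
  by apply: lift_word_inj; apply: ssyt_chain_inj e => // x; rewrite ffunE ltn_ord.
- exact: chain_list_uniq.
move=> c; rewrite mem_chain_list; apply/mapP/idP => [[w]|/chain_ssyt[T [sT cT <-]]].
  by rewrite ms => /andP[h1 /eqP h2] ->; exact: ssyt_chain.
by have [w ew] := content_fits ar cT; exists w; rewrite ?ms /Phi -ew ?sT ?cT ?eqxx.
Qed.
End Kostka.
Local Open Scope ring_scope.

(** * Partitions as shapes *)

Section Partitions.
Variable n : nat.

Definition part_size (mu : intpart) := #|` diagram (parts mu)|.

Lemma nth_parts_inj (mu la : intpart) :
  (forall i, nth 0%N (parts mu) i = nth 0%N (parts la) i) -> mu = la.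
Proof.
move=> e.
have z (m : intpart) i : (i < size (parts m))%N = (0 < nth 0 (parts m) i)%N.
  case: ltnP => [lt|/(nth_default 0%N)->//]; rewrite lt0n; apply/esym.
  by have /andP[_] := valP m; apply: contra => /eqP <-; rewrite mem_nth.
apply: val_inj; apply: (@eq_from_nth _ 0%N) => //.
case: (ltngtP (size (parts mu)) (size (parts la))) => // h.
  by move: (h); rewrite z -e -z ltnn.
by move: (h); rewrite z e -z ltnn.
Qed.

Lemma part_shape_inj (mu la : intpart) : part_size mu = n -> part_size la = n ->
  part_shape mu n = part_shape la n -> mu = la.
Proof.
move=> smu sla e; apply: nth_parts_inj => i.
by rewrite -!rowlen_part_shape -/(part_size mu) -/(part_size la) smu sla e.
Qed.

(** Collected from the finitely many shapes bounded by n, as a partition of n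
    can be recovered from its shape. *)
Definition partitions_of : {fset intpart} :=
  seq_fset tt [seq mu <-
    [seq xget (exist is_part [::] isT) [set mu | part_size mu = n /\ part_shape mu n = nu]%classic
      | nu <- enum {: shape n}] | part_size mu == n].

Lemma mem_partitions mu : (mu \in partitions_of) = (part_size mu == n).
Proof.
rewrite seq_fsetE mem_filter; case: eqP => //= smu.
apply/mapP; exists (part_shape mu n); rewrite ?mem_enum //.
case: xgetP => [la _ [sla e]|/(_ mu)[]//].
exact/esym/part_shape_inj.
Qed.

Lemma kostka_rowlen_le a (nu : shape n) i : kostka a nu != 0%N -> (rowlen nu i.+1 <= rowlen nu i)%N.
Proof.
case: a => [|x a] /=; first by rewrite eqb0 negbK => /eqP /size0_rowlen h; rewrite h.
rewrite sum_nat_eq0 negb_forall => /existsP[la]; rewrite negb_imply => /andP[/andP[/hstripP/(_ i)[h1 h2] _] _].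
exact: leq_trans h2 h1.
Qed.

(** The rows before the first empty one are the parts. *)
Lemma shape_part (nu : shape n) : (forall i, rowlen nu i.+1 <= rowlen nu i)%N -> shape_size nu = n ->
  exists2 mu, part_size mu = n & part_shape mu n = nu.
Proof.
move=> dec snu.
have mono i j : (i <= j)%N -> (rowlen nu j <= rowlen nu i)%N.
  by move=> /subnKC <-; elim: (j - i)%N => [|k IH]; rewrite ?addn0 // addnS (leq_trans (dec _)).
pose k := find (fun i => rowlen nu i == 0%N) (iota 0 n.+2).
have hk : has (fun i => rowlen nu i == 0%N) (iota 0 n.+2).
  by apply/hasP; exists n.+1; rewrite ?mem_iota ?ltnSn // rowlen_big.
have kn : (k < n.+2)%N by have := hk; rewrite has_find size_iota.
have rk0 : rowlen nu k = 0%N.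
  by have /eqP := nth_find 0%N hk; rewrite -/k nth_iota.
have rk1 i : (i < k)%N -> rowlen nu i != 0%N.
  move=> ik; have := before_find 0%N ik; rewrite nth_iota ?add0n => [->//|].
  exact: ltn_trans kn.
have pP : is_part (mkseq (rowlen nu) k).
  apply/andP; split; last by apply/mapP => -[i]; rewrite mem_iota /= add0n => /rk1 + e; rewrite -e eqxx.
  apply/(sortedP 0%N) => i; rewrite size_mkseq => ik.
  by rewrite /= !nth_mkseq // ltnW.
have nthP i : nth 0%N (mkseq (rowlen nu) k) i = rowlen nu i.
  case: (ltnP i k) => ik; first by rewrite nth_mkseq.
  rewrite nth_default ?size_mkseq //; apply/esym/eqP; rewrite -leqn0 -rk0; exact: mono.
have smu : part_size (exist is_part _ pP) = n.
  rewrite /part_size card_nu /= size_mkseq; apply: etrans snu; rewrite /shape_size.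
  rewrite (@big_ord_widen _ _ _ k n.+1 (nth 0%N (mkseq (rowlen nu) k))) // big_mkcond /=.
  apply: eq_bigr => i _; rewrite nthP; case: ltnP => [//|ki].
  by apply/esym/eqP; rewrite -leqn0 -rk0; exact: mono.
exists (exist is_part _ pP) => //; apply: rowlen_inj => i ni.
have := rowlen_part_shape (exist is_part _ pP) i; rewrite -/(part_size _) smu => ->; exact: nthP.
Qed.

(** A shape that admits a tableau of content a has weakly decreasing rows and n
    cells, hence comes from a partition of n. *)
Lemma rsk_partitions a b : sumn a = n ->
  (\sum_(mu <- partitions_of) kostka a (part_shape mu n) * kostka b (part_shape mu n) = matrices a b)%N.
Proof.
move=> an; rewrite -(@rsk_count n) ?an //.
rewrite -(big_map (fun mu => part_shape mu n) predT (fun nu => kostka a nu * kostka b nu)%N).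
set s := map _ _; have us : uniq s.
  rewrite map_inj_in_uniq ?fset_uniq // => mu la; rewrite !mem_partitions => /eqP h1 /eqP h2.
  exact: part_shape_inj.
rewrite big_uniq //= [LHS]big_mkcond; apply: eq_bigr => nu _.
case: ifP => // /negbT nus; case: (eqVneq (kostka a nu) 0%N) => [->|k0]; first by rewrite mul0n.
case/negP: nus; have [||mu smu <-] := @shape_part nu.
- by move=> i; exact: kostka_rowlen_le k0.
- by rewrite (kostka_size k0).
by apply: map_f; rewrite mem_partitions smu.
Qed.
End Partitions.

(** * Characters from a unitriangular system *)

Section TriangularCharacters.
Variables (gT : finGroupType) (G : {group gT}) (T : eqType) (Y : seq T).
Variables (h : T -> 'CF(G)) (K : T -> T -> nat) (rk : T -> nat).
Hypothesis Y_uniq : uniq Y.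
Hypothesis h_char : forall la, h la \is a character.
Hypothesis K1 : forall mu, mu \in Y -> K mu mu = 1%N.
Hypothesis K_tri : forall mu la, mu \in Y -> la \in Y -> K mu la != 0%N -> mu = la \/ (rk la < rk mu)%N.
Hypothesis h_dot : forall la la', la \in Y -> la' \in Y ->
  '[h la, h la'] = (\sum_(mu <- Y) K mu la * K mu la')%N%:R.

Let is_mult (g : 'CF(G)) (k : T -> nat) :=
  forall la, la \in Y -> '[g, h la] = (\sum_(mu <- Y) k mu * K mu la)%N%:R.

Let B := (\sum_(mu <- Y) rk mu)%N.

Let rkB mu : mu \in Y -> (rk mu <= B)%N.
Proof. by move=> muY; rewrite /B (bigD1_seq mu) //= leq_addr. Qed.

(** Solves the equations h mu = sum over nu of K nu mu * xi nu for the unknown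
    xi by back substitution, in decreasing order of rank; f bounds the depth of
    the recursion. *)
Fixpoint peel f mu : 'CF(G) :=
  if f is f'.+1 then h mu - \sum_(nu <- Y | (rk mu < rk nu)%N) (K nu mu)%:R *: peel f' nu
  else h mu.

Lemma peel_mult f g k mu : is_mult g k -> mu \in Y -> (B - rk mu <= f)%N -> '[g, peel f mu] = (k mu)%:R.
Proof.
move=> gk; elim: f mu => [|f IH] mu muY fb.
  rewrite /= gk // (bigD1_seq mu) //= K1 // muln1 big1_seq ?addn0 // => nu /andP[nm nuY].
  case: (eqVneq (K nu mu) 0%N) => [->|/(K_tri nuY muY)[e|lt]]; first by rewrite muln0.
    by rewrite e eqxx in nm.
  have := leq_trans lt (rkB nuY).
  by rewrite ltnNge -subn_eq0 -leqn0 fb.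
rewrite /= cfdotBr cfdot_sumr gk // (bigD1_seq mu) //= K1 // muln1 natrD.
rewrite [X in _ - X](_ : _ = (\sum_(nu <- Y | nu != mu) k nu * K nu mu)%N%:R) ?addrK //.
rewrite natr_sum [LHS]big_mkcond [RHS]big_mkcond /=; apply: eq_big_seq => nu nuY.
case: ltnP => [lt|le].
  have -> : nu != mu by apply: contraTneq lt => ->; rewrite ltnn.
  rewrite cfdotZr conjC_nat IH // ?natrM 1?mulrC //.
  rewrite -ltnS; apply: leq_trans fb; apply: ltn_sub2l => //.
  exact: leq_trans lt (rkB nuY).
case: (eqVneq nu mu) => //= nm.
case: (eqVneq (K nu mu) 0%N) => [->|/(K_tri nuY muY)[e|]]; first by rewrite muln0.
  by rewrite e eqxx in nm.
by rewrite ltnNge le.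
Qed.

Let xi := peel B.

Let xi_mult g k mu : is_mult g k -> mu \in Y -> '[g, xi mu] = (k mu)%:R.
Proof. by move=> gk muY; apply: peel_mult => //; exact: leq_subr. Qed.

Let h_mult la : la \in Y -> is_mult (h la) (fun mu => K mu la).
Proof. by move=> laY la' laY'; rewrite h_dot. Qed.

Let xi_h mu la : mu \in Y -> la \in Y -> '[xi mu, h la] = (K mu la)%:R.
Proof. by move=> muY laY; rewrite cfdotC (xi_mult (h_mult laY)) // conjC_nat. Qed.

Let xi_orth mu nu : mu \in Y -> nu \in Y -> '[xi mu, xi nu] = (mu == nu)%:R.
Proof.
move=> muY nuY; rewrite (@xi_mult _ (fun nu => mu == nu)) // => la laY.
rewrite xi_h // (bigD1_seq mu) //= eqxx mul1n big1 ?addn0 // => i /negbTE.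
by rewrite eq_sym => ->.
Qed.

Let xi_char mu : mu \in Y -> xi mu \is a character.
Proof.
move=> muY; have xZ : forall f nu, peel f nu \in 'Z[irr G].
  elim=> [|f IH] nu /=; first exact: char_vchar.
  apply: rpredB; first exact: char_vchar.
  by apply: rpred_sum => la _; rewrite scaler_nat; apply: rpredMn; exact: IH.
have [|b [i e]] := vchar_norm1P (xZ B mu); first by rewrite xi_orth // eqxx.
rewrite /xi e; case: b e => e; last by rewrite scale1r irr_char.
have := xi_h muY muY; rewrite /xi e K1 // expr1 scaleN1r cfdotNl => e1.
have : 0 <= '['chi_i, h mu] by rewrite natr_ge0 // Cnat_cfdot_char ?irr_char.
by rewrite -oppr_le0 e1 lern0.
Qed.

(** The virtual characters given by peel are dual to the h, and h_dot makes them
    orthonormal. Hence each of them is an irreducible character up to sign, and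
    the sign is positive because the product with h mu is 1. A class function
    with the products and the norm of a combination of the xi differs from it by
    a function of norm zero. *)
Theorem triangular_characters : exists2 xi : T -> 'CF(G),
  forall mu, mu \in Y -> xi mu \is a character
  & forall g k, (forall la, la \in Y -> '[g, h la] = (\sum_(mu <- Y) k mu * K mu la)%N%:R) ->
      '[g] = (\sum_(mu <- Y) k mu * k mu)%N%:R -> g = \sum_(mu <- Y) (k mu)%:R *: xi mu.
Proof.
exists xi => [//|g k gk gg]; apply/eqP; rewrite -subr_eq0 -cfnorm_eq0.
set s := \sum_(mu <- Y) _.
have gs : '[g, s] = '[g].
  rewrite /s cfdot_sumr gg natr_sum; apply: eq_big_seq => mu muY.
  by rewrite cfdotZr conjC_nat (xi_mult gk) // natrM.
have ss : '[s] = '[g].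
  rewrite {1}/s cfdot_suml gg natr_sum; apply: eq_big_seq => mu muY.
  rewrite cfdotZl /s cfdot_sumr (bigD1_seq mu) //= cfdotZr conjC_nat xi_orth // eqxx mulr1.
  rewrite big1_seq ?addr0 ?natrM // => nu /andP[nm nuY].
  by rewrite cfdotZr xi_orth // eq_sym (negbTE nm) mulr0.
by rewrite cfdotBl !cfdotBr ss gs (cfdotC s) gs gg conjC_nat !subrr.
Qed.
End TriangularCharacters.

(** * Decomposition of the permutation characters *)

Section SymmetricGroup.
Variable P : finType.
Let n := #|P|.
Let Y := partitions_of n.

Lemma sumn_letter_counts r (b : {ffun P -> 'I_r}) : sumn (letter_counts b) = n.
Proof.
rewrite sumnE big_map (perm_big (enum 'I_r)) /=; last by rewrite perm_rev.
rewrite big_enum /= /n -[RHS]sum1_card (partition_big b predT) //=.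
by apply: eq_bigr => i _; rewrite /wcount -sum1_card; apply: eq_bigl => p; rewrite inE.
Qed.

Definition kostka_word r (b : {ffun P -> 'I_r}) (mu : intpart) := kostka (letter_counts b) (part_shape mu n).

Lemma content_word (mu : intpart) : mu \in Y ->
  exists b : {ffun P -> 'I_n.+1}, forall i, wcount b i = nth 0%N (parts mu) i.
Proof.
rewrite mem_partitions => /eqP smu.
apply: word_of_count; rewrite -[RHS]smu /part_size card_nu.
have le : (size (parts mu) <= n.+1)%N by rewrite ltnW // ltnS -smu /part_size length_part_le.
rewrite [RHS](big_ord_widen n.+1 (nth 0%N (parts mu))) // [RHS]big_mkcond /=.
by apply: eq_bigr => i _; case: ltnP => // /(nth_default 0%N).
Qed.

Lemma content_super (mu : intpart) k : content (super mu) k = nth 0%N (parts mu) k.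
Proof.
rewrite contentE.
pose f (j : 'I_(nth 0%N (parts mu) k)) : diagram (parts mu) :=
  FSetSub (etrans (mem_diagram (parts mu) (k, nat_of_ord j)) (ltn_ord j)).
have fi : injective f by move=> j i /(congr1 val) [] /val_inj.
rewrite -[RHS]card_ord -(card_imset predT fi); apply: eq_card => x; rewrite [LHS]inE ffunE.
apply/eqP/imsetP => [xi|[j _ ->]//].
have := valP x; rewrite mem_diagram xi => jlt; exists (Ordinal jlt) => //.
by apply: val_inj; rewrite /f /= -xi -surjective_pairing.
Qed.

(** Kostka numbers of partitions are the coefficients of Schur functions at
    superstandard contents, for which triangularity in the dominance order is
    given by schur_pre. *)
Lemma kostka_schur (mu la : intpart) (b : {ffun P -> 'I_n.+1}) : mu \in Y -> la \in Y ->
  (forall i, wcount b i = nth 0%N (parts la) i) ->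
  (kostka_word b mu)%:R = schur int mu (content (super la)).
Proof.
rewrite !mem_partitions => /eqP smu /eqP sla hb.
rewrite (@schur_chain _ n.+1); last first.
  move=> k; rewrite content_super; case: (ltnP k (size (parts la))) => [h _|/(nth_default 0%N)->//].
  by rewrite (leq_trans h) // ltnW // ltnS -sla /part_size length_part_le.
congr _%:R; rewrite /kostka_word -/(part_size mu) smu; congr kostka.
rewrite /letter_counts -[in RHS]val_enum_ord -map_rev -map_comp; apply: eq_map => i.
by rewrite /= hb content_super.
Qed.

(** The rule of Young. The rank used for triangularity adds up the sizes of the
    first r rows over all r, so that it refines the dominance order. *)
Theorem hperm_decomposition : exists2 xi : intpart -> 'CF([set: {perm P}]%G),
  forall mu, mu \in Y -> xi mu \is a character
  & forall r (b : {ffun P -> 'I_r}), hperm b = \sum_(mu <- Y) (kostka_word b mu)%:R *: xi mu.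
Proof.
pose W mu : {ffun P -> 'I_n.+1} := if pselect (exists b : {ffun P -> 'I_n.+1},
  forall i, wcount b i = nth 0%N (parts mu) i) is left e then projT1 (cid e) else [ffun=> ord0].
have WP mu : mu \in Y -> forall i, wcount (W mu) i = nth 0%N (parts mu) i.
  by move=> /content_word e; rewrite /W; case: pselect => // e'; case: (cid e').
have dot r r' (b : {ffun P -> 'I_r}) (b' : {ffun P -> 'I_r'}) :
    '[hperm b, hperm b'] = (\sum_(mu <- Y) kostka_word b mu * kostka_word b' mu)%N%:R.
  by rewrite cfdot_hperm -(@rsk_partitions n) // sumn_letter_counts.
pose rk mu := (\sum_(r < n.+1) prefix_card mu r)%N.
have [|||||xi x1 x2] := @triangular_characters _ [set: {perm P}]%G _ Y (fun mu => hperm (W mu))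
   (fun mu la => kostka_word (W la) mu) rk; last first.
- by exists xi => // r b; apply: x2 => [la laY|]; rewrite dot.
- by move=> la la' _ _; exact: dot.
- move=> mu la muY laY; rewrite -(eqr_nat int) (kostka_schur muY laY (WP _ laY)) => /schur_pre le.
  case: (ltnP (rk la) (rk mu)) => [|ge]; [by right|left; apply: pre_part => r].
  move: muY laY; rewrite !mem_partitions => /eqP smu /eqP sla.
  case: (ltnP r n.+1) => [rn|/ltnW nr]; last first.
    by rewrite !pre_big -/(part_size _) ?smu ?sla //; apply: leq_trans (length_part_le _) _;
       rewrite -/(part_size _) ?smu ?sla.
  apply/eqP; rewrite eqn_leq le andbT leqNgt; apply/negP => lt.
  move: ge; rewrite leqNgt => /negP; apply.
  rewrite /rk (bigD1 (Ordinal rn)) //= [X in (_ < X)%N](bigD1 (Ordinal rn)) //=.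
  by rewrite -addSn leq_add // leq_sum.
- move=> mu muY; apply/eqP; rewrite -(eqr_nat int) (kostka_schur muY muY (WP _ muY)).
  by rewrite schur_super.
- by move=> la; exact: hperm_char.
- exact: fset_uniq.
Qed.
End SymmetricGroup.

(** * Graded multiplicities *)

Section GradedMultiplicities.
Variables (P : finType) (rk : P -> nat) (E : rel P) (col : P -> nat).
Hypothesis rk_inj : injective rk.
Hypothesis Ecl : closed_rel rk E.
Hypothesis Ecol : forall p q, E p q -> col p != col q.
Hypothesis corners : forall r (w : {ffun P -> 'I_r}), ~~ strict rk col w -> exists i j,
  [/\ col i = col j, (rk i < rk j)%N, (w j <= w i)%N
    & forall x, (rk i < rk x)%N -> (rk x < rk j)%N -> E i x && E x j].

Definition exact_words r (b : {ffun P -> 'I_r}) k :=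
  [set w : {ffun P -> 'I_r} | [&& in_class b w, strict rk col w & #|asc E w| == k]]%SET.

(** The words with exactly k ascents are counted by the character of the k-th
    graded piece, and c k mu is the multiplicity in it of the irreducible
    character of mu. *)
Theorem graded_multiplicities : exists2 c : nat -> intpart -> nat,
  forall k r (b : {ffun P -> 'I_r}),
    #|exact_words b k| = (\sum_(mu <- partitions_of #|P|) kostka_word b mu * c k mu)%N
  & forall k r r' (b : {ffun P -> 'I_r}) (b' : {ffun P -> 'I_r'}),
    hperm b = hperm b' -> #|exact_words b k| = #|exact_words b' k|.
Proof.
have [chi [c0 cS cE]] := level_characters rk_inj Ecl Ecol corners.
have [xi xi_char hE] := hperm_decomposition P.
pose psi k := if k is k'.+1 then chi k - chi k' else chi 0%N.
have psi_char k : psi k \is a character by case: k => [|k] /=; [exact: c0|exact: cS].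
have psiE k r (b : {ffun P -> 'I_r}) : '[psi k, hperm b] = #|exact_words b k|%:R.
  case: k => [|k] /=.
    rewrite cE; congr _%:R; apply: eq_card => w; rewrite !inE leqn0; reflexivity.
  rewrite cfdotBl !cE; apply/eqP; rewrite subr_eq -natrD eqr_nat -cardsUI.
  rewrite [X in (_ + X)%N](_ : _ = 0%N) ?addn0; last first.
    apply/eqP; rewrite cards_eq0; apply/eqP/setP => w; rewrite !inE.
    by apply/negP => /andP[/and3P[_ _ /eqP->] /and3P[_ _]]; rewrite ltnn.
  apply/eqP/eq_card => w; rewrite !inE -/(in_class b w) -!andb_orr leq_eqVlt ltnS.
  reflexivity.
exists (fun k mu => Num.trunc '[psi k, xi mu]) => [k r b|k r r' b b' e]; last first.
  by apply/eqP; rewrite -(eqr_nat algC) -!psiE e.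
apply/eqP; rewrite -(eqr_nat algC) -psiE hE cfdot_sumr natr_sum; apply/eqP.
apply: eq_big_seq => mu muY; rewrite cfdotZr conjC_nat natrM; congr (_ * _).
by apply/esym/eqP; rewrite -natrE Cnat_cfdot_char ?xi_char.
Qed.
End GradedMultiplicities.

(** * The strip and its attacking cells *)

Local Open Scope nat_scope.

Section Strip.
Variables (n : nat) (la : intpart).
Let P := strip n la.
Implicit Types x y z p q : P.

Lemma strip_cell p : val p = ((val p).1, nth 0 (parts la) (val p).1) /\ (val p).1 < n.
Proof.
by have /imfsetP[i /=] := valP p; rewrite mem_iota /= => ni ->.
Qed.

Lemma strip_row_inj p q : (val p).1 = (val q).1 -> p = q.
Proof. by move=> e; apply: val_inj; rewrite (strip_cell p).1 (strip_cell q).1 e. Qed.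

Lemma strip_col p : (val p).2 = nth 0 (parts la) (val p).1.
Proof. by rewrite {1}(strip_cell p).1. Qed.

Lemma card_strip : #|{: P}| = n.
Proof.
have inP (i : 'I_n) : (val i, nth 0 (parts la) i) \in P.
  by apply/imfsetP; exists (val i); rewrite //= mem_iota /= ltn_ord.
pose f i : P := FSetSub (inP i).
have fI : injective f by move=> i j /(congr1 val) [] /val_inj.
rewrite -[RHS]card_ord -(card_imset predT fI); apply: eq_card => p; rewrite [LHS]inE.
apply/esym/imsetP; exists (Ordinal (strip_cell p).2) => //.
exact: strip_row_inj.
Qed.

Definition strip_col_of (p : P) := (val p).2.
Let B := (nth 0 (parts la) 0).+1.

(** Reading order: diagonal by diagonal, in decreasing order of columns inside a
    diagonal; B exceeds every column of the strip. *)
Definition strip_rank (p : P) := diag_index (val p) * B + (B - (val p).2).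
Definition attacks : rel P := fun x y =>
  (diag_index (val y) == diag_index (val x)) && ((val y).2 < (val x).2)
  || (diag_index (val y) == (diag_index (val x)).+1) && ((val x).2 < (val y).2).

Lemma strip_rank_lt p q : (strip_rank p < strip_rank q) =
  (diag_index (val p) < diag_index (val q)) ||
  (diag_index (val p) == diag_index (val q)) && ((val q).2 < (val p).2).
Proof.
have bd x : (val x).2 < B by rewrite strip_col ltnS nth_part_le.
rewrite /strip_rank; move: (bd p) (bd q); move: B.
move: (diag_index _) (diag_index _) (val p).2 (val q).2 => d e a b N aN bN.
case: (ltngtP d e) => de /=.
- have : d.+1 * N <= e * N by rewrite leq_mul2r de orbT.
  rewrite mulSn; move: (d * N) (e * N) => X Y; lia.
- have : e.+1 * N <= d * N by rewrite leq_mul2r de orbT.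
  rewrite mulSn; move: (d * N) (e * N) => X Y; lia.
by rewrite de; move: (e * N) => X; lia.
Qed.

Lemma strip_rank_inj : injective strip_rank.
Proof.
move=> p q e; apply: strip_row_inj.
have h1 : ~~ (strip_rank p < strip_rank q) by rewrite e ltnn.
have h2 : ~~ (strip_rank q < strip_rank p) by rewrite e ltnn.
move: h1 h2; rewrite !strip_rank_lt /diag_index.
case: (val p) (val q) => i j [i' j'] /=. lia.
Qed.

Lemma attacks_closed : closed_rel strip_rank attacks.
Proof.
split=> [p q|p x q]; rewrite /attacks !strip_rank_lt.
  lia.
lia. Qed.

Lemma attacks_col p q : attacks p q -> strip_col_of p != strip_col_of q.
Proof. rewrite /attacks /strip_col_of; lia. Qed.

Lemma same_col_rank p q : (val p).2 = (val q).2 ->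
  (strip_rank p < strip_rank q) = ((val p).1 < (val q).1).
Proof.
rewrite strip_rank_lt /diag_index; case: (val p) (val q) => i j [i' j'] /= ->.
by rewrite ltnn andbF orbF ltn_add2r.
Qed.

(** As the parts decrease, the cells of a column of the strip lie in consecutive
    rows, so a failure of strictness already occurs at two vertical neighbours.
    These lie on consecutive diagonals, and a cell read between them is on the
    diagonal of the first and to its left, or on that of the second and to its
    right. *)
Lemma strip_corners r (w : {ffun P -> 'I_r}) : ~~ strict strip_rank strip_col_of w ->
  exists i j, [/\ strip_col_of i = strip_col_of j, strip_rank i < strip_rank j, w j <= w i
    & forall x, strip_rank i < strip_rank x -> strip_rank x < strip_rank j ->
      attacks i x && attacks x j].
Proof.
move=> nst; apply: contrapT => nex; move/negP: nst; apply; apply/strictP => p q cpq.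
rewrite same_col_rank // => lt.
have step x y : (val x).2 = (val y).2 -> (val y).1 = (val x).1.+1 -> w x < w y.
  move=> c e; rewrite ltnNge; apply/negP => h; apply: nex; exists x, y; split=> //.
    by rewrite same_col_rank // e.
  move=> z; rewrite !strip_rank_lt /attacks /diag_index; move: c e.
  case: (val x) (val y) (val z) => i j [i' j'] [i'' j''] /=; lia.
have mid m : (val p).1 <= m -> m <= (val q).1 -> nth 0 (parts la) m = (val p).2.
  move=> h1 h2; apply/eqP; rewrite eqn_leq {2}(cpq : (val p).2 = (val q).2) !strip_col.
  by rewrite !nth_part_le.
have [k ek] : exists k, (val q).1 = (val p).1 + k.+1.
  by exists ((val q).1 - (val p).1.+1); rewrite subnSK ?subnKC //; exact: ltnW.
elim: k q ek {cpq lt} mid => [|k IH] q ek mid; have pq : (val p).1 <= (val q).1 by rewrite ek leq_addr.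
  apply: step; last by rewrite ek addn1.
  by rewrite [RHS]strip_col (mid _ pq (leqnn _)).
have zP : ((val p).1 + k.+1, nth 0 (parts la) ((val p).1 + k.+1)) \in P.
  apply/imfsetP; exists ((val p).1 + k.+1) => //=; rewrite mem_iota /=.
  by have [_] := strip_cell q; rewrite ek addnS; apply: ltnW.
have qk : (val q).1 = ((val p).1 + k.+1).+1 by rewrite ek addnS.
apply: (@ltn_trans (w [` zP]%fset)).
  apply: IH => // m h1 h2; apply: mid => //=; rewrite qk; exact: leqW.
apply: step => //=; rewrite [RHS]strip_col (mid _ pq (leqnn _)) mid ?leq_addr //.
by rewrite qk leqnSn.
Qed.
End Strip.
Local Open Scope ring_scope.

(** * The series of a strip *)

Section Fits.
Implicit Types a b : monomial.

Lemma exists_fits a : exists r, fits r a.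
Proof.
exists (\max_(k <- finsupp a) k).+1 => k ak; rewrite ltnS.
by apply: leq_bigmax_seq => //; rewrite mem_finsupp.
Qed.

Lemma ssyt_gf_neq0 (R : comNzRingType) (nu : {fset cell}) (wt : filling nu -> R) a :
  ssyt_gf wt a != 0 -> exists2 T : filling nu, is_ssyt T & content T = a.
Proof.
move=> n0; apply: contrapT => h; move/eqP: n0; apply; rewrite /ssyt_gf.
rewrite (_ : [set _ | _]%classic = classical_sets.set0) ?fsbig_set0 //.
by apply/seteqP; split=> T //= [sT cT]; apply: h; exists T.
Qed.

Lemma ssyt_gf_bounded (R : comNzRingType) (nu : {fset cell}) (wt : filling nu -> R) : bounded_degree (ssyt_gf wt).
Proof.
exists #|{: nu}| => a /ssyt_gf_neq0[T _ <-].
under eq_bigr => k _ do rewrite contentE -sum1dep_card big_mkcond /=.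
rewrite exchange_big /= -sum1_card; apply: leq_sum => x _.
have -> : (\sum_(k <- finsupp (content T)) (if T x == k then 1 else 0) = count (pred1 (T x)) (finsupp (content T)))%N.
  by rewrite -sum1_count [RHS]big_mkcond; apply: eq_bigr => k _; rewrite /= eq_sym.
by rewrite count_uniq_mem ?fset_uniq // leq_b1.
Qed.

Lemma content_lift_word (nu : {fset cell}) r (w : {ffun nu -> 'I_r}) (i : 'I_r) : content (lift_word w) i = wcount w i.
Proof. by rewrite contentE; apply: eq_card => x; rewrite !inE ffunE. Qed.

Lemma content_lift_wordP (nu : {fset cell}) r (w : {ffun nu -> 'I_r}) a : fits r a ->
  reflect (forall i : 'I_r, wcount w i = a i) (content (lift_word w) == a).
Proof.
move=> ar; apply: (iffP eqP) => [<- i|h]; first by rewrite content_lift_word.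
apply/fsfunP => k; case: (ltnP k r) => kr.
  by rewrite (content_lift_word w (Ordinal kr)) h.
transitivity 0%N; last by apply/esym/eqP; apply: contraTT kr => /ar; rewrite -ltnNge.
rewrite contentE; apply/eqP; rewrite cards_eq0; apply/eqP/setP => x; rewrite !inE ffunE.
by apply/negbTE; apply: contraTneq (ltn_ord (w x)) => ->; rewrite -leqNgt.
Qed.

(** A word with letters below r and content a; its existence says that a has the
    right degree. *)
Definition realizes (nu : {fset cell}) r a (b : {ffun nu -> 'I_r}) :=
  fits r a /\ forall i, wcount b i = a i.

Lemma gf_unrealized (R : comNzRingType) (nu : {fset cell}) (wt : filling nu -> R) a :
  ~ (exists r (b : {ffun nu -> 'I_r}), realizes a b) -> ssyt_gf wt a = 0.
Proof.
move=> h; apply/eqP/negPn/negP => /ssyt_gf_neq0[T _ cT]; apply: h.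
have [r ar] := exists_fits a; exists r.
have [w ew] := content_fits ar cT; exists w; split=> // i.
by rewrite -cT ew content_lift_word.
Qed.

Lemma realizes_transfer (nu nu' : {fset cell}) r a (b : {ffun nu -> 'I_r}) :
  #|{: nu}| = #|{: nu'}| -> realizes a b -> exists b' : {ffun nu' -> 'I_r}, realizes a b'.
Proof.
move=> e [ar ab]; have [|b' hb'] := @word_of_count nu' 'I_r (fun i => a i).
  rewrite -e -[RHS]sum1_card (partition_big b predT) //=; apply: eq_bigr => i _.
  by rewrite -ab /wcount -sum1_card; apply: eq_bigl => p; rewrite inE.
by exists b'.
Qed.
End Fits.

Section StripExpansion.
Variables (n : nat) (la : intpart).
Let P := strip n la.
Let rk := @strip_rank n la.
Let E := @attacks n la.
Let col := @strip_col_of n la.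

(** A strip has one cell in each row, so that only the column condition remains.
    *)
Lemma strip_ssyt r (w : {ffun P -> 'I_r}) : is_ssyt (lift_word w) = strict rk col w.
Proof.
apply/forallP/strictP => [h p q cpq|h p].
  rewrite same_col_rank // => lt; have /forallP/(_ q)/andP[_ /implyP] := h p.
  by rewrite !ffunE; apply; rewrite lt andbT; apply/eqP.
apply/forallP => q; rewrite !ffunE; apply/andP; split; apply/implyP => /andP[/eqP e lt].
  by rewrite (strip_row_inj e) ltnn in lt.
by apply: h => //; rewrite same_col_rank.
Qed.

Lemma strip_dinv r (w : {ffun P -> 'I_r}) : dinv (lift_word w) = #|asc E w|.
Proof. by apply: eq_card => e; rewrite !inE /d_inversion !ffunE andbC. Qed.

Lemma asc_le r (w : {ffun P -> 'I_r}) : (#|asc E w| < #|{: P * P}|.+1)%N.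
Proof. by rewrite ltnS max_card. Qed.

Lemma strip_gf_words (R : comNzRingType) (q : R) r a (b : {ffun P -> 'I_r}) : realizes a b ->
  ssyt_gf (fun T : filling P => q ^+ dinv T) a =
  \sum_(k < #|{: P * P}|.+1) #|exact_words rk E col b k|%:R * q ^+ k.
Proof.
move=> [ar ab]; rewrite (ssyt_gf_fin _ ar).
rewrite (partition_big (fun w => Ordinal (asc_le w)) predT) //=; apply: eq_bigr => k _.
rewrite mulr_natl -sumr_const; apply: eq_big => [w|w /andP[_ /eqP <-]]; last by rewrite strip_dinv.
rewrite inE strip_ssyt -[_ == k]val_eqE /=.
have -> : (content (lift_word w) == a) = in_class b w; last by rewrite !andbA [in_class b w && _]andbC.
rewrite in_classE; apply/content_lift_wordP/eqP => // h.
  by apply: eq_map => i; rewrite h ab.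
by move=> i; have /eq_in_map/(_ i) := h; rewrite ab; apply; rewrite mem_rev mem_enum.
Qed.

(** If no word has content a, all the series involved vanish at a, because the
    strip and the partitions have the same number of cells. *)
Lemma strip_expansion : exists M (c : nat -> intpart -> nat), forall (R : comNzRingType) (q : R) a,
  ssyt_gf (fun T : filling P => q ^+ dinv T) a =
  \sum_(mu <- partitions_of n) (\sum_(k < M) (c k mu)%:R * q ^+ k) * schur R mu a.
Proof.
have [c cE _] := graded_multiplicities (@strip_rank_inj n la) (@attacks_closed n la)
  (@attacks_col n la) (@strip_corners n la).
exists #|{: P * P}|.+1, c => R q a.
case: (pselect (exists r (b : {ffun P -> 'I_r}), realizes a b)) => [[r [b rb]]|nr].
  rewrite (strip_gf_words _ rb); under [RHS]eq_bigr do rewrite big_distrl /=.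
  rewrite exchange_big /=; apply: eq_bigr => k _; rewrite cE card_strip natr_sum big_distrl /=.
  apply: eq_big_seq => mu; rewrite mem_partitions => /eqP smu.
  have -> : schur R mu a = (kostka_word b mu)%:R; last by rewrite natrM -mulrA mulrC.
  have [ar ab] := rb; rewrite (schur_chain _ ar) /kostka_word card_strip -/(part_size mu) smu.
  congr (kostka _ _)%:R; rewrite /letter_counts -val_enum_ord -map_rev -map_comp; apply: eq_map => i.
  by rewrite /= ab.
rewrite gf_unrealized // big1_seq // => mu; rewrite mem_partitions => /andP[_ /eqP smu].
suff -> : schur R mu a = 0 by rewrite mulr0.
apply: gf_unrealized => -[r [b rb]]; apply: nr; exists r.
by apply: realizes_transfer rb; rewrite card_strip -smu /part_size cardfE.
Qed.

(** Permuting the variables relabels the letters of a word of given content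
    injectively, and this does not affect hperm. *)
Lemma strip_symmetric (R : comNzRingType) (q : R) :
  symmetric_function (ssyt_gf (fun T : filling P => q ^+ dinv T)).
Proof.
have [_ _ csym] := graded_multiplicities (@strip_rank_inj n la) (@attacks_closed n la)
  (@attacks_col n la) (@strip_corners n la).
split=> [|s sbij a a' aE]; first exact: ssyt_gf_bounded.
have [s' sK s'K] := sbij.
set f := ssyt_gf _.
have transport (t t' : nat -> nat) (e e' : monomial) : cancel t t' -> cancel t' t ->
    (forall k, e' k = e (t k)) -> forall r' (b : {ffun P -> 'I_r'}), realizes e' b -> f e = f e'.
  move=> tK t'K e'E r' b [e'r' be].
  have [r0 er0] := exists_fits e.
  pose r := maxn r0 (\max_(i < r') t i).+1.
  have tr (i : 'I_r') : (t i < r)%N by rewrite leq_max ltnS leq_bigmax ?orbT.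
  pose g i := Ordinal (tr i); have gI : injective g.
    by move=> i j /(congr1 val) /= /(can_inj tK) /val_inj.
  have re : realizes e [ffun p => g (b p)].
    split=> [k /er0 h|j]; first by rewrite /r leq_max h.
    case: (boolP (j \in codom g)) => [/codomP[i ->]|nj].
      by rewrite /= -e'E -be; apply: eq_card => p; rewrite !inE ffunE (inj_eq gI).
    transitivity 0%N.
      apply/eqP; rewrite cards_eq0; apply/eqP/setP => p; rewrite !inE ffunE.
      by apply/negbTE; apply: contra nj => /eqP <-; exact: codom_f.
    apply/esym/eqP; apply: contraNT nj => ej.
    have lt : (t' j < r')%N by apply: e'r'; rewrite e'E t'K.
    by apply/codomP; exists (Ordinal lt); apply: val_inj; rewrite /= t'K.
  rewrite /f (strip_gf_words q re) (strip_gf_words q (conj e'r' be)).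
  apply: eq_bigr => k _; congr (_%:R * _); apply: csym; exact: hperm_relabel.
case: (pselect (exists r (b : {ffun P -> 'I_r}), realizes a' b)) => [[r [b rb]]|n1].
  apply/esym/(transport s s' a a' sK s'K aE r b rb).
case: (pselect (exists r (b : {ffun P -> 'I_r}), realizes a b)) => [[r [b rb]]|n2].
  by apply: (transport s' s) rb => // k; rewrite aE s'K.
by rewrite /f !gf_unrealized.
Qed.
End StripExpansion.

(** * Sums over partitions *)

Section Combinations.
Variable R : comNzRingType.
Implicit Types (f g : series R) (a : monomial).

Lemma symmetric_functionD c f g : symmetric_function f -> symmetric_function g ->
  symmetric_function (fun a => c * f a + g a).
Proof.
move=> [[d fd] fs] [[e ge] gs]; split=> [|s sbij a b ab]; last by rewrite (fs _ sbij _ _ ab) (gs _ sbij _ _ ab).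
exists (d + e)%N => a; case: (eqVneq (f a) 0) => [->|/fd h _]; last by rewrite (leq_trans h) // leq_addr.
by rewrite mulr0 add0r => /ge h; rewrite (leq_trans h) // leq_addl.
Qed.

Lemma symmetric_function_sum (I : Type) (s : seq I) (c : I -> R) (f : I -> series R) :
  (forall i, symmetric_function (f i)) -> symmetric_function (fun a => \sum_(i <- s) c i * f i a).
Proof.
move=> fs; elim: s => [|i s IH].
  split=> [|t _ a b _]; last by rewrite !big_nil.
  by exists 0%N => a; rewrite big_nil eqxx.
have := symmetric_functionD (c i) (fs i) IH.
by congr symmetric_function; apply/funext => a; rewrite big_cons.
Qed.

Lemma schur_expansion_sum (Y : {fset intpart}) (C : intpart -> R) f :
  (forall a, f a = \sum_(mu <- Y) C mu * schur R mu a) ->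
  schur_expansion f [fsfun mu in Y => C mu].
Proof.
move=> fE a; rewrite fE [RHS](@big_fset_incl _ _ _ _ _ Y); first 1 last.
- exact: finsupp_sub.
- by move=> mu _; rewrite memNfinsupp => /eqP ->; rewrite mul0r.
by apply: eq_big_seq => mu muY; rewrite fsfunE muY.
Qed.

Lemma ssyt_gfZ (nu : {fset cell}) c (wt : filling nu -> R) a :
  ssyt_gf (fun T => c * wt T) a = c * ssyt_gf wt a.
Proof. by have [r ar] := exists_fits a; rewrite !(ssyt_gf_fin _ ar) mulr_sumr. Qed.
End Combinations.

Lemma diagram_parts_inj : injective (fun la : intpart => diagram (parts la)).
Proof.
move=> mu la /fsetP e; apply: nth_parts_inj => i.
have lt j : (j < nth 0 (parts mu) i)%N = (j < nth 0 (parts la) i)%N.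
  by have := e (i, j); rewrite !mem_diagram.
apply/eqP; rewrite eqn_leq leqNgt [X in _ && X]leqNgt.
by rewrite -lt ltnn lt ltnn.
Qed.

Lemma finite_in_delta n : finite_set [set la : intpart | in_delta n la]%classic.
Proof.
have := @finite_preimage _ _ [set` fpowerset (diagram (delta n))]%classic
  (fun la : intpart => diagram (parts la))
  (fun x y _ _ => @diagram_parts_inj x y) (finite_fset _).
by apply: sub_finite_set => la; rewrite /= /in_delta fpowersetE.
Qed.

Lemma NqP (p : {poly int}) : reflect (forall i, p`_i \is a Num.nat) (p \in Nq).
Proof. exact: polyOverP. Qed.

Lemma Nq_sum (I : Type) (s : seq I) (F : I -> {poly int}) :
  (forall i, F i \in Nq) -> \sum_(i <- s) F i \in Nq.
Proof. by move=> h; apply/NqP => j; rewrite coef_sum rpred_sum // => i _; exact: (NqP _ (h i)). Qed.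

Lemma NqtP (p : {poly {poly int}}) : reflect (forall i, p`_i \in Nq) (p \in Nqt).
Proof.
apply: (iffP (all_nthP 0)) => [h i|h i _]; last exact: h.
case: (ltnP i (size p)) => [|/(nth_default 0) ->]; first exact: h.
by apply/NqP => k; rewrite coef0.
Qed.

Lemma Nq_poly M (c : nat -> nat) : \sum_(k < M) (c k)%:R * 'X^k \in Nq.
Proof.
apply: Nq_sum => k; apply/NqP => j.
by rewrite mulr_natl coefMn coefXn rpredMn // natr_nat.
Qed.

Lemma Nqt_sum (I : Type) (s : seq I) (e M : I -> nat) (c : I -> nat -> nat) :
  \sum_(i <- s) qt_t ^+ e i * \sum_(k < M i) (c i k)%:R * qt_q ^+ k \in Nqt.
Proof.
apply/NqtP => j; rewrite coef_sum; apply: Nq_sum => i.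
rewrite (_ : \sum_(k < M i) _ = (\sum_(k < M i) (c i k)%:R * 'X^k)%:P).
  rewrite coefMC coefXn; case: eqP => _; rewrite (mul0r, mul1r); last by apply/NqP => k; rewrite coef0.
  exact: Nq_poly.
by rewrite rmorph_sum; apply: eq_bigr => k _; rewrite /qt_q rmorphM rmorph_nat rmorphXn.
Qed.

Theorem theorem3p1p3 (n : nat) (hn : (1 <= n)%N) :
  [/\ symmetric_function (D n),
      forall mu : intpart, hall (D n) (schur _ mu) \in Nqt
    & forall la : intpart, in_delta n la ->
        symmetric_function (Dlam n la) /\
        exists2 c : {fsfun intpart -> {poly int} with 0},
          schur_expansion (Dlam n la) c & forall mu : intpart, c mu \in Nq].
Proof.
have /choice[M /choice[c cE]] := strip_expansion n.
pose X := fset_set [set la : intpart | in_delta n la]%classic.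
pose f la := ssyt_gf (fun T : filling (strip n la) => qt_q ^+ dinv T).
have DE : D n = fun a => \sum_(la <- X) qt_t ^+ codeg n la * f la a.
  apply/funext => a; rewrite /D fsbig_finite; last exact: finite_in_delta.
  by apply: eq_bigr => la _; rewrite ssyt_gfZ.
split=> [|mu|la _].
- by rewrite DE; apply: symmetric_function_sum => la; exact: strip_symmetric.
- pose C mu := \sum_(la <- X) qt_t ^+ codeg n la * \sum_(k < M la) (c la k mu)%:R * qt_q ^+ k.
  have exD : schur_expansion (D n) [fsfun mu in partitions_of n => C mu].
    apply: schur_expansion_sum => a; rewrite DE.
    under [RHS]eq_bigr do rewrite big_distrl /=.
    rewrite exchange_big /=; apply: eq_bigr => la _.
    by rewrite /f cE mulr_sumr; apply: eq_bigr => nu _; rewrite mulrA.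
  rewrite (hall_schur_coord _ exD) fsfunE; case: ifP => _; first exact: (Nqt_sum X (codeg n) M (fun la k => c la k mu)).
  by apply/NqtP => j; rewrite coef0; apply/NqP => k; rewrite coef0.
split; first exact: strip_symmetric.
exists [fsfun mu in partitions_of n => \sum_(k < M la) (c la k mu)%:R * 'X^k].
  by apply: schur_expansion_sum => a; rewrite /Dlam cE.
move=> mu; rewrite fsfunE; case: ifP => _; first exact: (Nq_poly (M la) (fun k => c la k mu)).
by apply/NqP => j; rewrite coef0.
Qed.
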